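(* Let $(M^7,\varphi)$ be a 7-manifold with $\mathrm{G}_2$-structure, and let $\xi$ be a vector field generating an $S^1$-action on $M$ with $\mathcal{L}_\xi\varphi=0$. Let $(\omega,\Upsilon)$ be its natural basic $\mathrm{SU}(3)$-structure induced on $N^6=M/\xi$, with basic almost complex structure $J$ and torsion $(\upsilon_1,\hat\upsilon_1,\upsilon_6,\hat\upsilon_6,\upsilon_8,\hat\upsilon_8,\upsilon_{12})$. Let $t=|\xi|$, let $\theta$ be the connection 1-form $\theta(Y)=t^{-2}g_\varphi(\xi,Y)$, and write its curvature as $d\theta=X\lrcorner\mathrm{Re}\Upsilon+\lambda\omega+\sigma$ with $X$ a vector field, $\lambda$ a function, and $\sigma\in\Omega^2_8$. Away from the fixed points of $\xi$, the torsion $(\tau_1,\tau_7,\tau_{14},\tau_{27})$ of $\varphi$ is given by \begin{align*} \tau_1&=\tfrac67(t\lambda+4\hat\upsilon_1),\\ \tau_7&=-t\upsilon_1\theta+\tfrac16Y_1,\\ \tau_{14}&=\tfrac23t\theta\wedge JY_2+\tfrac13Y_2\lrcorner\mathrm{Re}\Upsilon-\hat\upsilon_8,\\ \tau_{27}&=t\theta\wedge\left(\tfrac87(t\lambda+\tfrac12\hat\upsilon_1)\omega-\tfrac12JY_3\lrcorner\mathrm{Re}\Upsilon-(\upsilon_8+t\sigma)\right)-\tfrac12JY_3\wedge\omega-\tfrac67(\tfrac12\hat\upsilon_1+t\lambda)\mathrm{Re}\Upsilon-*\upsilon_{12}, \end{align*} where $*\upsilon_{12}$ is the Hodge dual of $\upsilon_{12}$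 with respect to the metric defined by $(\omega,\Upsilon)$, and \begin{align*} Y_1&:=-tJX+\upsilon_6+\hat\upsilon_6+d\ln t,\\ Y_2&:=2tJX-2\upsilon_6+\hat\upsilon_6+d\ln t,\\ Y_3&:=tJX+\upsilon_6-\hat\upsilon_6+d\ln t . \end{align*}
   Context: A $\mathrm{G}_2$-structure $\varphi$ is a non-degenerate 3-form, determining a metric $g_\varphi$ and orientation by $g_\varphi(X,Y)\mathrm{vol}=\frac16(X\lrcorner\varphi)\wedge(Y\lrcorner\varphi)\wedge\varphi$. Its torsion $(\tau_1,\tau_7,\tau_{14},\tau_{27})$ is determined by $d\varphi=\tau_1*\varphi+3\tau_7\wedge\varphi+*\tau_{27}$ and $d{*\varphi}=4\tau_7\wedge*\varphi+*\tau_{14}$, where $\tau_1$ is a function, $\tau_7$ a 1-form, $\tau_{14}$ a 2-form with $*\tau_{14}=-\tau_{14}\wedge\varphi$, and $\tau_{27}$ a 3-form with $\tau_{27}\wedge\varphi=0=\tau_{27}\wedge*\varphi$. An $\mathrm{SU}(3)$-structure on a 6-manifold is a pair $(\omega,\Upsilon)$ of a real positive 2-form and a complex 3-form with $\omega\wedge\Upsilon=0$, $\frac16\omega^3=\frac14\mathrm{Re}\Upsilon\wedge\mathrm{Im}\Upsilon=\mathrm{vol}_g$; the induced metric $g$ and almost complex structure $J$ satisfy $g(X,Y)=\omega(X,JY)$. Vector fields and 1-forms are identified by the metric, so $JX$ also denotes its dual 1-form, and $X\lrcorner\omega=JX$. Let $\Omega^2_8=\{\alpha\in\Omega^2:\alpha\wedge\omega^2=0=\alpha\wedge\Upsilon\}$,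 $\Omega^3_{12}=\{\alpha\in\Omega^3:\alpha\wedge\omega=0=\alpha\wedge\Upsilon\}$. The torsion of $(\omega,\Upsilon)$ consists of functions $\upsilon_1,\hat\upsilon_1$, 1-forms $\upsilon_6,\hat\upsilon_6$, forms $\upsilon_8,\hat\upsilon_8\in\Omega^2_8$ and $\upsilon_{12}\in\Omega^3_{12}$ such that \begin{align*} d\omega&=3\upsilon_1\mathrm{Re}\Upsilon+3\hat\upsilon_1\mathrm{Im}\Upsilon+\upsilon_{12}+\upsilon_6\wedge\omega,\\ d\,\mathrm{Re}\Upsilon&=2\hat\upsilon_1\omega^2+\hat\upsilon_6\wedge\mathrm{Re}\Upsilon+\upsilon_8\wedge\omega,\\ d\,\mathrm{Im}\Upsilon&=-2\upsilon_1\omega^2+\hat\upsilon_6\wedge\mathrm{Im}\Upsilon+\hat\upsilon_8\wedge\omega. \end{align*} The natural basic $\mathrm{SU}(3)$-structure is defined, where $t=|\xi|>0$, by $\omega=\frac1t\xi\lrcorner\varphi$, $\mathrm{Im}\Upsilon=-\frac1t\xi\lrcorner*\varphi$. Then $g_\varphi=g+t^2\theta^2$, and $\varphi=t\theta\wedge\omega+\mathrm{Re}\Upsilon$, $*\varphi=\frac12\omega^2-t\theta\wedge\mathrm{Im}\Upsilon$, with volume form $t\theta\wedge\frac16\omega^3$. Forms on $N$ are identified with their pullbacks to $M$. *)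

(* Defs.v *)
From HB Require Import structures.
From mathcomp Require Import all_boot all_order all_algebra all_fingroup.
From mathcomp Require Import all_classical all_reals all_analysis.

Set Implicit Arguments.
Unset Strict Implicit.
Unset Printing Implicit Defensive.

Import Order.TTheory GRing.Theory Num.Theory.
Import numFieldNormedType.Exports.

Local Open Scope classical_set_scope.
Local Open Scope ring_scope.

(* A [k]-linear form takes its [k] arguments as the rows of a matrix. *)

Notation mform R n k := ('M[R]_(k, n) -> R^o).

Section ExteriorAlgebra.
Context {R : realType} {n : nat}.

Definition multilinearf k (a : mform R n k) : Prop :=
  forall (i : 'I_k) (A B C : 'M[R]_(k, n)) (z : R),
    row i A = z *: row i B + row i C ->
    row' i B = row' i A -> row' i C = row' i A ->
    a A = z * a B + a C.

Definition alternatingf k (a : mform R n k) : Prop :=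
  multilinearf a /\
  forall (A : 'M[R]_(k, n)) (i j : 'I_k),
    i != j -> row i A = row j A -> a A = 0.

(* Normalized so that (dx /\ dy)(e_x, e_y) = 1. *)
Definition wedgef k l (a : mform R n k) (b : mform R n l) : mform R n (k + l) :=
  fun V => (k`! * l`!)%:R^-1 *
    \sum_(s : 'S_(k + l)) (-1) ^+ s *
      (a (usubmx (row_perm s V)) * b (dsubmx (row_perm s V))).

Definition hook k (v : 'rV[R]_n) (a : mform R n k.+1) : mform R n k :=
  fun V => a (col_mx v V).

Definition ip (G : 'M[R]_n) (u v : 'rV[R]_n) : R := (u *m G *m v^T) 0 0.

Definition flatv (G : 'M[R]_n) (v : 'rV[R]_n) : mform R n 1 :=
  fun V => ip G v V.

Definition sharpv (G : 'M[R]_n) (a : mform R n 1) : 'rV[R]_n :=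
  (\row_j a (delta_mx 0 j)) *m invmx G.

(* The components of the dual of b are 1/k! b^I vol_{IJ}, so that its wedge
   product with any a on the left is <a, b> vol; the rows of
   [invmx G] are the basis vectors with their index raised.  The degree [k + l]
   of [vol] may be smaller than [n]: if [vol] and [b] are pulled back along a
   Riemannian submersion, with [vol] a volume form of the base, then [hodge] is
   the pullback of the Hodge dual on the base, since only the horizontal part of
   the inverse metric contributes. *)
Definition hodge k l (G : 'M[R]_n) (vol : mform R n (k + l)) (b : mform R n k) :
    mform R n l :=
  fun W => (k`!)%:R^-1 * \sum_(f : {ffun 'I_k -> 'I_n})
    b (rowsub f (invmx G)) * vol (col_mx (rowsub f 1%:M) W).

End ExteriorAlgebra.

Arguments hodge {R n} k l G vol b.

Section Smooth.
Context {R : realType} {n : nat}.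

Fixpoint iter_partial (s : seq 'I_n) (f : 'rV[R]_n -> R^o) : 'rV[R]_n -> R^o :=
  if s is i :: s' then 'D_(delta_mx 0 i) (iter_partial s' f) else f.

Definition smooth_on (U : set 'rV[R]_n) (f : 'rV[R]_n -> R^o) : Prop :=
  forall s x, U x -> differentiable (iter_partial s f) x.

Definition smooth_map_on m (U : set 'rV[R]_n) (f : 'rV[R]_n -> 'rV[R]_m) :
    Prop :=
  forall j, smooth_on U (fun x => f x 0 j).

End Smooth.

(* A homeomorphism from an open set of M to an open set of R^n; [ccoord] and
   [cparam] are meaningless outside [cdom] and [cimg]. *)
Record chart (R : realType) (n : nat) (M : topologicalType) := Chart {
  cdom : set M;
  cimg : set 'rV[R]_n;
  ccoord : M -> 'rV[R]_n;
  cparam : 'rV[R]_n -> M;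
  open_cdom : open cdom;
  open_cimg : open cimg;
  coord_cimg : forall p, cdom p -> cimg (ccoord p);
  param_cdom : forall x, cimg x -> cdom (cparam x);
  ccoordK : forall p, cdom p -> cparam (ccoord p) = p;
  cparamK : forall x, cimg x -> ccoord (cparam x) = x;
  continuous_coord : forall p, cdom p -> {for p, continuous ccoord};
  continuous_param : forall x, cimg x -> {for x, continuous cparam} }.

Record manifold (R : realType) (n : nat) := Manifold {
  mpoint :> topologicalType;
  manifold_hausdorff : hausdorff_space mpoint;
  manifold_second_countable : @second_countable mpoint;
  atlas : Type;
  chart_of : atlas -> chart R n mpoint;
  chart_at : mpoint -> atlas;
  chart_atP : forall p, cdom (chart_of (chart_at p)) p;
  transition_smooth : forall c c' : atlas,
    smooth_map_on
      [set x | cimg (chart_of c) x /\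
               cdom (chart_of c') (cparam (chart_of c) x)]
      (ccoord (chart_of c') \o cparam (chart_of c)) }.

Coercion chart_of : atlas >-> chart.

(* A tensor field assigns to each point [p] and each chart [c] around [p] its
    components in [c]; components in different charts are related by the
    Jacobian of the transition map.  Values at charts not containing [p] are
    meaningless. *)

Section TensorFields.
Context {R : realType} {n : nat}.
Variable M : manifold R n.

Definition kform k := M -> atlas M -> mform R n k.
Definition vfield := M -> atlas M -> 'rV[R]_n.
Definition bilin_field := M -> atlas M -> 'M[R]_n.

Definition transition_jacobian (p : M) (c c' : atlas M) : 'M[R]_n :=
  jacobian (ccoord c' \o cparam c) (ccoord c p).

Definition chart_region (c : atlas M) (W : set M) : set 'rV[R]_n :=
  [set x | cimg c x /\ W (cparam c x)].

Definition is_function (W : set M) (f : M -> R) : Prop :=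
  forall c : atlas M, smooth_on (chart_region c W) (f \o cparam c).

Definition is_kform k (W : set M) (a : kform k) : Prop :=
  [/\ forall p (c : atlas M), W p -> cdom c p -> alternatingf (a p c),
      forall p (c c' : atlas M), W p -> cdom c p -> cdom c' p ->
        forall V, a p c V = a p c' (V *m transition_jacobian p c c') &
      forall (c : atlas M) V,
        smooth_on (chart_region c W) (fun x => a (cparam c x) c V)].

Definition is_vfield (W : set M) (X : vfield) : Prop :=
  (forall p (c c' : atlas M), W p -> cdom c p -> cdom c' p ->
     X p c' = X p c *m transition_jacobian p c c') /\
  (forall c : atlas M,
     smooth_map_on (chart_region c W) (fun x => X (cparam c x) c)).

Definition is_metric (g : bilin_field) : Prop :=
  [/\ forall p (c : atlas M), cdom c p -> (g p c)^T = g p c,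
      forall p (c : atlas M), cdom c p -> forall v, v != 0 -> 0 < ip (g p c) v v,
      forall p (c c' : atlas M), cdom c p -> cdom c' p ->
        g p c = transition_jacobian p c c' *m g p c' *m
                (transition_jacobian p c c')^T &
      forall (c : atlas M) i j,
        smooth_on (cimg c) (fun x => g (cparam c x) c i j)].

Definition is_volume_form (g : bilin_field) (vol : kform n) : Prop :=
  is_kform setT vol /\
  forall p (c : atlas M), cdom c p -> vol p c 1%:M ^+ 2 = \det (g p c).

Definition dfun (f : M -> R) : kform 1 :=
  fun p c V => 'D_V ((f \o cparam c) : 'rV[R]_n -> R^o) (ccoord c p).

Definition ext_d k (a : kform k) : kform k.+1 :=
  fun p c V => \sum_(i < k.+1) (-1) ^+ i *
    'D_(row i V) (fun x => a (cparam c x) c (row' i V)) (ccoord c p).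

(* The directional derivative D_v X of the components of X in the chart c. *)
Definition dvfield (X : vfield) (p : M) (c : atlas M) (v : 'rV[R]_n) :
    'rV[R]_n :=
  'D_v (fun x => X (cparam c x) c) (ccoord c p).

Definition lie_kform k (xi : vfield) (a : kform k) : kform k :=
  fun p c V =>
    'D_(xi p c) (fun x => a (cparam c x) c V) (ccoord c p) +
    \sum_(i < k) a p c (\matrix_(r, j)
       if r == i then dvfield xi p c (row i V) 0 j else V r j).

Definition lie_bracket (X Y : vfield) : vfield :=
  fun p c => dvfield Y p c (X p c) - dvfield X p c (Y p c).

(* A smooth action of the circle R / 2 pi Z. *)
Record circle_action := CircleAction {
  cact : R -> M -> M;
  cact0 : forall p, cact 0 p = p;
  cactD : forall s s' p, cact (s + s') p = cact s (cact s' p);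
  cact_2pi : forall p, cact (2 * pi) p = p;
  cact_continuous : continuous (fun z : R^o * M => cact z.1 z.2);
  cact_smooth : forall c c' : atlas M,
    let A := fun z : 'rV[R]_(1 + n) =>
      cact (lsubmx z 0 0) (cparam c (rsubmx z)) in
    smooth_map_on [set z | cimg c (rsubmx z) /\ cdom c' (A z)]
                  (ccoord c' \o A) }.

Definition generates (xi : vfield) (A : circle_action) : Prop :=
  forall p (c : atlas M), cdom c p ->
    is_derive (0 : R^o) (1 : R^o) (fun s : R^o => ccoord c (cact A s p)) (xi p c).

Definition nonfixed (xi : vfield) : set M :=
  [set p | xi p (chart_at p) != 0].

End TensorFields.

Arguments kform {R n} M k.
Arguments vfield {R n} M.
Arguments bilin_field {R n} M.
Arguments circle_action {R n} M.

Section G2.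
Context {R : realType}.

Definition covol3 (i j k : nat) : mform R 7 3 :=
  fun V => \det (colsub (tnth [tuple inord i; inord j; inord k]) V).

Definition g2_model : mform R 7 3 :=
  covol3 0 1 2 + covol3 0 3 4 + covol3 0 5 6 + covol3 1 3 5
  - covol3 1 4 6 - covol3 2 3 6 - covol3 2 4 5.

(* Membership in the open GL(7)-orbit of [g2_model], whose stabilizer is G2. *)
Definition nondegenerate3 (a : mform R 7 3) : Prop :=
  exists2 P : 'M[R]_7, P \in unitmx & a = fun V => g2_model (V *m P).

Variable M : manifold R 7.

(* The metric and the orientation, recorded by its volume form, are determined
   by [g2_form] through [g2_form_metric]. *)
Record g2_structure := G2Structure {
  g2_form : kform M 3;
  g2_metric : bilin_field M;
  g2_vol : kform M 7;
  g2_form_is_kform : is_kform setT g2_form;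
  g2_form_nondegenerate : forall p (c : atlas M), cdom c p ->
    nondegenerate3 (g2_form p c);
  g2_metric_is_metric : is_metric g2_metric;
  g2_vol_is_volume_form : is_volume_form g2_metric g2_vol;
  g2_form_metric : forall p (c : atlas M), cdom c p -> forall u v : 'rV[R]_7,
    ip (g2_metric p c) u v *: g2_vol p c =
    (6%:R^-1 : R) *: wedgef (wedgef (hook u (g2_form p c))
                            (hook v (g2_form p c))) (g2_form p c) }.

Variable S : g2_structure.

Local Notation phi := (g2_form S).
Local Notation g := (g2_metric S).
Local Notation vol := (g2_vol S).

Definition g2_coform : kform M 4 := fun p c => hodge 3 4 (g p c) (vol p c) (phi p c).

Record g2_torsion (tau1 : M -> R) (tau7 : kform M 1) (tau14 : kform M 2)
    (tau27 : kform M 3) : Prop := G2Torsion {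
  tau1_function : is_function setT tau1;
  tau7_form : is_kform setT tau7;
  tau14_form : is_kform setT tau14;
  tau27_form : is_kform setT tau27;
  tau14_type : forall p (c : atlas M), cdom c p ->
    hodge 2 5 (g p c) (vol p c) (tau14 p c) = - wedgef (tau14 p c) (phi p c);
  tau27_type : forall p (c : atlas M), cdom c p ->
    wedgef (tau27 p c) (phi p c) = 0 /\ wedgef (tau27 p c) (g2_coform p c) = 0;
  d_g2_form : forall p (c : atlas M), cdom c p ->
    ext_d phi p c =
      tau1 p *: g2_coform p c + (3%:R : R) *: wedgef (tau7 p c) (phi p c)
      + hodge 3 4 (g p c) (vol p c) (tau27 p c);
  d_g2_coform : forall p (c : atlas M), cdom c p ->
    ext_d g2_coform p c =
      (4%:R : R) *: wedgef (tau7 p c) (g2_coform p c)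
      + hodge 2 5 (g p c) (vol p c) (tau14 p c) }.

(* Everything on the orbit space N lives on the complement of the zeros of
    [xi], forms on N being basic forms there. *)

Variable xi : vfield M.

Local Notation M' := (nonfixed xi).

Definition orbit_norm (p : M) : R :=
  let c := chart_at p in Num.sqrt (ip (g p c) (xi p c) (xi p c)).

Local Notation t := orbit_norm.

Definition conn_form : kform M 1 :=
  fun p c => (t p ^- 2) *: flatv (g p c) (xi p c).

Definition su3_omega : kform M 2 :=
  fun p c => (t p)^-1 *: hook (xi p c) (phi p c).

Definition su3_Im : kform M 3 :=
  fun p c => - ((t p)^-1 *: hook (xi p c) (g2_coform p c)).

(* From phi = t theta /\ omega + Re Upsilon. *)
Definition su3_Re : kform M 3 :=
  fun p c => phi p c - t p *: wedgef (conn_form p c) (su3_omega p c).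

(* From v -| omega = J v, vectors and covectors being identified by the metric;
   on horizontal vectors this is g(u, v) = omega(u, J v). *)
Definition su3_J (p : M) (c : atlas M) (v : 'rV[R]_7) : 'rV[R]_7 :=
  sharpv (g p c) (hook v (su3_omega p c)).

Definition su3_vol : kform M 6 :=
  fun p c => (6%:R^-1 : R) *:
    wedgef (wedgef (su3_omega p c) (su3_omega p c)) (su3_omega p c).

Definition basic_function (f : M -> R) : Prop :=
  is_function M' f /\
  forall p (c : atlas M), M' p -> cdom c p -> dfun f p c (xi p c) = 0.

Definition basic_form k (a : kform M k.+1) : Prop :=
  is_kform M' a /\
  forall p (c : atlas M), M' p -> cdom c p ->
    hook (xi p c) (a p c) = 0 /\ lie_kform xi a p c = 0.

(* A vector field on N, identified with its horizontal lift. *)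
Definition basic_vfield (X : vfield M) : Prop :=
  is_vfield M' X /\
  forall p (c : atlas M), M' p -> cdom c p ->
    conn_form p c (X p c) = 0 /\ lie_bracket xi X p c = 0.

Definition Omega2_8 (a : kform M 2) : Prop :=
  basic_form a /\
  forall p (c : atlas M), M' p -> cdom c p ->
    [/\ wedgef (a p c) (wedgef (su3_omega p c) (su3_omega p c)) = 0,
        wedgef (a p c) (su3_Re p c) = 0 & wedgef (a p c) (su3_Im p c) = 0].

Definition Omega3_12 (a : kform M 3) : Prop :=
  basic_form a /\
  forall p (c : atlas M), M' p -> cdom c p ->
    [/\ wedgef (a p c) (su3_omega p c) = 0,
        wedgef (a p c) (su3_Re p c) = 0 & wedgef (a p c) (su3_Im p c) = 0].

(* [u'] stands for the torsion components decorated with a hat. *)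
Record su3_torsion (u1 u1' : M -> R) (u6 u6' : kform M 1) (u8 u8' : kform M 2)
    (u12 : kform M 3) : Prop := SU3Torsion {
  u1_basic : basic_function u1;
  u1'_basic : basic_function u1';
  u6_basic : basic_form u6;
  u6'_basic : basic_form u6';
  u8_type : Omega2_8 u8;
  u8'_type : Omega2_8 u8';
  u12_type : Omega3_12 u12;
  d_su3_omega : forall p (c : atlas M), M' p -> cdom c p ->
    ext_d su3_omega p c =
      (3%:R * u1 p) *: su3_Re p c + (3%:R * u1' p) *: su3_Im p c + u12 p c
      + wedgef (u6 p c) (su3_omega p c);
  d_su3_Re : forall p (c : atlas M), M' p -> cdom c p ->
    ext_d su3_Re p c =
      (2%:R * u1' p) *: wedgef (su3_omega p c) (su3_omega p c)
      + wedgef (u6' p c) (su3_Re p c) + wedgef (u8 p c) (su3_omega p c);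
  d_su3_Im : forall p (c : atlas M), M' p -> cdom c p ->
    ext_d su3_Im p c =
      (- 2%:R * u1 p) *: wedgef (su3_omega p c) (su3_omega p c)
      + wedgef (u6' p c) (su3_Im p c) + wedgef (u8' p c) (su3_omega p c) }.

End G2.

(* Main.v *)
(** Fix a point with [xi <> 0] and a chart around it.  The circle subgroups of
    G2 that rotate two coordinate planes simultaneously move any vector to the
    first axis, so there is a frame [E_0, ..., E_6] in which [phi] is the model
    form, hence [g] is the identity and [vol] is [1], and [xi = t E_0].  Put
    [eta = t theta], the covector dual to [E_0].  Near the point
    [phi = eta /\ omega + Re] and [*phi = omega^2 / 2 - eta /\ Im], while
    [d eta = d(ln t) /\ eta + t d(theta)], so the Leibniz rule expresses
    [d phi] and [d *phi] through the SU(3)-torsion, the curvature and [d(ln t)].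
    The function [t] is constant along [xi]: as [xi -| d omega = 0] and
    [L_xi (xi -| phi) = 0], one has [0 = L_xi (t omega) = xi(t) omega].  Finally
    [tau27 = *(d phi - tau1 *phi - 3 tau7 /\ phi)], and the conditions
    [tau27 /\ phi = 0 = tau27 /\ *phi] are linear equations that determine
    [tau1] and [tau7]; then [d *phi] gives [tau14].

    Forms are evaluated on lists of vectors, where the wedge product is a
    shuffle sum defined by recursion on the list; components of forms with
    integer coefficients in the frame are computed in [int]. *)

Require Import Defs.
From mathcomp Require Import all_boot all_order all_algebra all_fingroup.
From mathcomp Require Import all_classical all_reals all_analysis.
From mathcomp Require Import ring lra zify.

Set Implicit Arguments.
Unset Strict Implicit.
Unset Printing Implicit Defensive.

Import Order.TTheory GRing.Theory Num.Theory.
Import numFieldNormedType.Exports.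

Local Open Scope classical_set_scope.
Local Open Scope ring_scope.

(** Adapted frames are chosen point by point, without smoothness, so nothing is ever differentiated
    in them. The splittings of [phi] and [*phi] are used at every point near the given one, each
    time with a frame of its own; they are differentiated in chart coordinates on constant vectors,
    and the frame of the given point is inserted only into the result. As its vectors count as
    constants of the chart, no bracket terms arise. The second obstacle is size: a wedge product of
    total degree 7 is a sum over 5040 permutations. Shuffles and sparse integer tables let all
    structure constants be computed, and what remains is linear over the rationals in monomials such
    as [t * lam] or [t * x [:: i]]. The constants 6/7, 1/6, 2/3, 8/7 of the theorem are thus
    verified by linear arithmetic, component by component, against the structure equations and the
    type conditions; no representation theory of G2 or SU(3) enters. *)

(** * Shuffle sums compared with sums over permutations *)

Section Shuffles.
Context {R : comNzRingType} {T : Type}.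
Implicit Types (a b : seq T -> R) (s w x y : seq T).

(* The wedge product [a /\ b] on [v :: s']: [v] goes either to [a] or to [b]. *)
Fixpoint shuf (k l : nat) a b s : R :=
  if s is v :: s' then
    (if k is k'.+1 then shuf k' l (a \o cons v) b s' else 0) +
    (if l is l'.+1 then (-1) ^+ k * shuf k l' a (b \o cons v) s' else 0)
  else a [::] * b [::].

(** The signed sum of [f] over all orderings of [s]: the head is inserted at position [j] into an
    ordering of the tail, at the cost of [(-1) ^+ j]. Recursion on the list replaces the symmetric
    group. *)
Fixpoint antisym s (f : seq T -> R) : R :=
  if s is v :: s' then
    \sum_(j < (size s').+1)
      (-1) ^+ j * antisym s' (fun w => f (take j w ++ v :: drop j w))
  else f [::].

Lemma eq_antisym s (f g : seq T -> R) :
  (forall w, size w = size s -> f w = g w) -> antisym s f = antisym s g.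
Proof.
elim: s f g => [|v s IH] f g fg /=; first exact: fg.
apply: eq_bigr => j _; congr (_ * _); apply: IH => w sw; apply: fg.
rewrite size_cat /= size_takel ?size_drop; last by rewrite sw -ltnS.
by rewrite addnS subnKC ?sw // -ltnS.
Qed.

(** [antisym] is linear in [f], so the two signs multiply to 1. This cancels the sign of inserting a
    vector against the sign of moving it back to the front. *)
Lemma signr_antisym s j (f : seq T -> R) :
  (-1) ^+ j * antisym s (fun w => (-1) ^+ j * f w) = antisym s f.
Proof.
elim: s f => [|v s IH] f /=.
  by rewrite mulrA -exprD addnn -mul2n exprM sqrrN !expr1n mul1r.
by rewrite mulr_sumr; apply: eq_bigr => i _; rewrite mulrCA IH.
Qed.

Lemma eq_shuf k l a a' b b' s : size s = (k + l)%N ->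
  (forall w, size w = k -> a w = a' w) ->
  (forall w, size w = l -> b w = b' w) ->
  shuf k l a b s = shuf k l a' b' s.
Proof.
elim: s k l a a' b b' => [|v s IH] k l a a' b b' /= sk aa bb.
  by move: sk aa bb; case: k; case: l => // _ -> // ->.
move: sk aa bb; case: k => [|k]; case: l => [|l] // sk aa bb; congr (_ + _).
- congr (_ * _); apply: IH => //; first by lia.
  by move=> w sw /=; apply: bb; rewrite /= sw.
- by apply: IH => //; [lia|move=> w sw /=; apply: aa; rewrite /= sw].
- by apply: IH => //; [lia|move=> w sw /=; apply: aa; rewrite /= sw].
- congr (_ * _); apply: IH => //; first by lia.
  by move=> w sw /=; apply: bb; rewrite /= sw.
Qed.

Lemma shuf_linl k l a a1 a2 b z s : size s = (k + l)%N ->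
  (forall w, size w = k -> a w = z * a1 w + a2 w) ->
  shuf k l a b s = z * shuf k l a1 b s + shuf k l a2 b s.
Proof.
elim: s k l a a1 a2 b => [|v s IH] k l a a1 a2 b /= sk aa.
  by move: sk aa; case: k => // _ -> //; ring.
move: sk aa; case: k => [|k]; case: l => [|l] // sk aa.
- by rewrite (IH _ _ a a1 a2) //; [ring|lia].
- rewrite (IH _ _ (a \o cons v) (a1 \o cons v) (a2 \o cons v)) //; first by ring.
    by lia.
  by move=> w sw /=; apply: aa; rewrite /= sw.
- rewrite (IH _ l.+1 (a \o cons v) (a1 \o cons v) (a2 \o cons v)) //.
  + by rewrite (IH _ _ a a1 a2) //; [ring|lia].
  + by lia.
  + by move=> w sw /=; apply: aa; rewrite /= sw.
Qed.

Lemma shuf_linr k l a b b1 b2 z s : size s = (k + l)%N ->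
  (forall w, size w = l -> b w = z * b1 w + b2 w) ->
  shuf k l a b s = z * shuf k l a b1 s + shuf k l a b2 s.
Proof.
elim: s k l a b b1 b2 => [|v s IH] k l a b b1 b2 /= sk bb.
  by move: sk bb; case: l => [|l]; case: k => [|k] // _ -> //; ring.
move: sk bb; case: k => [|k]; case: l => [|l] // sk bb.
- rewrite (IH _ _ a (b \o cons v) (b1 \o cons v) (b2 \o cons v)) //; first by ring.
    by lia.
  by move=> w sw /=; apply: bb; rewrite /= sw.
- by rewrite (IH _ _ (a \o cons v) b b1 b2) //; [ring|lia].
- rewrite (IH k.+1 l a (b \o cons v) (b1 \o cons v) (b2 \o cons v)) //.
  + by rewrite (IH _ _ _ b b1 b2) //; [ring|lia].
  + by lia.
  + by move=> w sw /=; apply: bb; rewrite /= sw.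
Qed.

(** The one consequence of alternation used in comparing permutations with shuffles: a vector at
    position [j] reaches the front by [j] transpositions. *)
Definition insert_alt k a := forall v w j, size w = k -> (j <= k)%N ->
  a (take j w ++ v :: drop j w) = (-1) ^+ j * a (v :: w).

(** A vector at position [j] behind [v] is at position [j.+1] of the whole list; it moves to the
    front and then back past [v], with signs [(-1) ^+ j.+1] and [-1]. *)
Lemma insert_alt_cons k a v : insert_alt k.+1 a -> insert_alt k (a \o cons v).
Proof.
move=> aP u w j sw jk /=.
rewrite (_ : v :: _ = take j.+1 (v :: w) ++ u :: drop j.+1 (v :: w)) //.
rewrite aP //= ?sw //.
have := aP u (v :: w) 1%N; rewrite /= take0 drop0 sw => -> //.
by rewrite exprS expr1; ring.
Qed.

(** Each shuffle comes from [k! l!] permutations. In the induction the head of [s] lands either at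
    one of the [k] positions of [a], where alternation makes the [k] contributions equal, or at one
    of the [l] positions of [b], where passing the arguments of [a] costs a further [(-1) ^+ k]. *)
Lemma antisym_shuf k l a b s : size s = (k + l)%N ->
  (forall k', k = k'.+1 -> insert_alt k' a) ->
  (forall l', l = l'.+1 -> insert_alt l' b) ->
  antisym s (fun w => a (take k w) * b (drop k w)) =
  (k`! * l`!)%:R * shuf k l a b s.
Proof.
elim: s k l a b => [|v s IH] k l a b sk aP bP.
  by move: sk aP bP; case: k => //; case: l => //= *; rewrite mul1r.
rewrite [LHS]/=; move: sk => /= sk.
have -> : (size s).+1 = (k + l)%N by [].
rewrite big_split_ord /= [X in _ * X]/=.
have Hl : \sum_(i < k) (-1) ^+ i * antisym s (fun w =>
    a (take k (take i w ++ v :: drop i w)) * b (drop k (take i w ++ v :: drop i w)))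
  = (k`! * l`!)%:R * (if k is k'.+1 then shuf k' l (a \o cons v) b s else 0).
  move: aP sk; case: k => [|k] aP sk; first by rewrite big_ord0 mulr0.
  rewrite (eq_bigr (fun=> (k`! * l`!)%:R * shuf k l (a \o cons v) b s)).
    rewrite sumr_const card_ord -[LHS]mulr_natl mulrA -natrM.
    by rewrite factS mulnA.
  move=> i _; rewrite -IH //; first last.
  - by move=> k' ?; subst k; apply: insert_alt_cons; apply: aP.
  - by lia.
  have -> : antisym s (fun w => a (take k.+1 (take i w ++ v :: drop i w)) *
                        b (drop k.+1 (take i w ++ v :: drop i w))) =
    antisym s (fun w => (-1) ^+ i * ((a \o cons v) (take k w) * b (drop k w))).
    apply: eq_antisym => w sw /=.
    have ik : (i <= k)%N by rewrite -ltnS.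
    have iw : size (take i w) = i by rewrite size_takel // sw; lia.
    rewrite take_cat drop_cat iw ltnNge (leq_trans ik) //= subSn //=.
    rewrite drop_drop subnK //.
    have -> : take i w ++ v :: take (k - i) (drop i w) =
              take i (take k w) ++ v :: drop i (take k w).
      by rewrite take_drop subnK // take_takel.
    by rewrite (aP _ erefl) ?mulrA // size_takel // sw; lia.
  exact: signr_antisym.
have Hr : \sum_(i < l) (-1) ^+ (k + i) * antisym s (fun w =>
    a (take k (take (k + i) w ++ v :: drop (k + i) w)) *
    b (drop k (take (k + i) w ++ v :: drop (k + i) w)))
  = (k`! * l`!)%:R * (if l is l'.+1 then
                        (-1) ^+ k * shuf k l' a (b \o cons v) s else 0).
  move: bP sk {Hl}; case: l => [|l] bP sk; first by rewrite big_ord0 mulr0.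
  rewrite (eq_bigr (fun=> (k`! * l`!)%:R * ((-1) ^+ k * shuf k l a (b \o cons v) s))).
    rewrite sumr_const card_ord -[LHS]mulr_natl mulrA -natrM.
    by rewrite factS mulnCA mulnA.
  move=> i _; rewrite mulrCA -IH //; first last.
  - by move=> l' ?; subst l; apply: insert_alt_cons; apply: bP.
  - by lia.
  have -> : antisym s (fun w => a (take k (take (k + i) w ++ v :: drop (k + i) w)) *
                        b (drop k (take (k + i) w ++ v :: drop (k + i) w))) =
    antisym s (fun w => (-1) ^+ i * (a (take k w) * (b \o cons v) (drop k w))).
    apply: eq_antisym => w sw /=.
    have il : (i <= l)%N by rewrite -ltnS.
    have iw : size (take (k + i) w) = (k + i)%N by rewrite size_takel // sw; lia.
    rewrite take_cat drop_cat iw.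
    have bE : b (take i (drop k w) ++ v :: drop i (drop k w)) =
              (-1) ^+ i * b (v :: drop k w).
      by apply: bP => //; rewrite size_drop sw; lia.
    case: ltnP => ki.
      rewrite take_takel; last by lia.
      rewrite (_ : drop k (take (k + i) w) = take i (drop k w)); last first.
        by rewrite take_drop addnC.
      by move: bE; rewrite drop_drop [(i + k)%N]addnC => ->; ring.
    (* The head is the first argument of [b], exactly at the cut, so nothing of [take (k + i) w]
       passes to [b]. *)
    have i0 : i = 0%N :> nat by lia.
    rewrite i0 addn0 subnn /= cats0 in bE *.
    by rewrite expr0 mul1r.
  by rewrite exprD -mulrA signr_antisym.
by rewrite mulrDr Hl Hr.
Qed.

End Shuffles.

(** * Alternating multilinear functions on lists *)

Section MultilinearAlternating.
Context {R : comNzRingType} {V : lmodType R}.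
Implicit Types (a b : seq V -> R) (s w x y : seq V).

(** Both clauses concern only lists of the right length, a function on lists being arbitrary
    elsewhere. Alternation is asked for adjacent equal arguments; with linearity this gives the sign
    of an adjacent transposition, hence of any reordering. *)
Definition multilin_alt k a :=
  (forall x y u v z, (size x + size y).+1 = k ->
     a (x ++ (z *: u + v) :: y) = z * a (x ++ u :: y) + a (x ++ v :: y)) /\
  (forall x y u, (size x + size y).+2 = k -> a (x ++ u :: u :: y) = 0).

Lemma multilin_alt_swap k a x y u v : multilin_alt k a ->
  (size x + size y).+2 = k -> a (x ++ u :: v :: y) = - a (x ++ v :: u :: y).
Proof.
move=> [lin alt] sk; apply/eqP; rewrite -addr_eq0; apply/eqP.
have := alt x y (1 *: u + v) sk.
have lin2 (h : V) : a (x ++ h :: (1 *: u + v) :: y) =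
    a (x ++ h :: u :: y) + a (x ++ h :: v :: y).
  by rewrite -!(cat_rcons h) lin ?mul1r // size_rcons -sk addSn.
have := alt x y (1 *: u + v) sk.
by rewrite lin /= ?lin2 ?alt // ?mul1r ?add0r ?addr0 // -sk addnS.
Qed.

Lemma multilin_alt_insert k a : multilin_alt k.+1 a -> insert_alt k a.
Proof.
move=> aP v w j sw; elim: j => [|j IH] jk; first by rewrite take0 drop0 mul1r.
rewrite exprS -mulrA -IH ?mulN1r; last by lia.
have jw : (j < size w)%N by rewrite sw.
rewrite (drop_nth v jw) (take_nth v jw) cat_rcons.
rewrite (multilin_alt_swap _ _ aP) // size_take size_drop jw; lia.
Qed.

Lemma eq_multilin_alt k a b : (forall w, size w = k -> a w = b w) ->
  multilin_alt k b -> multilin_alt k a.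
Proof.
move=> ab [lin alt]; split=> [x y u v z sk|x y u sk].
  by rewrite !ab ?lin // size_cat /= addnS.
by rewrite ab ?alt // size_cat /= !addnS.
Qed.

Lemma multilin_alt_cons k a v : multilin_alt k.+1 a -> multilin_alt k (a \o cons v).
Proof.
move=> [lin alt]; split=> [x y u w z sk|x y u sk] /=.
  by rewrite -!cat_cons lin //= addSn sk.
by rewrite -!cat_cons alt //= addSn sk.
Qed.

Lemma multilin_altD k a b : multilin_alt k a -> multilin_alt k b ->
  multilin_alt k (fun s => a s + b s).
Proof.
move=> [la aa] [lb ab]; split=> [x y u w z sk|x y u sk] /=.
  by rewrite la ?lb //; ring.
by rewrite aa ?ab // addr0.
Qed.

Lemma multilin_altZ k a c : multilin_alt k a -> multilin_alt k (fun s => c * a s).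
Proof.
move=> [la aa]; split=> [x y u w z sk|x y u sk] /=; first by rewrite la //; ring.
by rewrite aa ?mulr0.
Qed.

(** A vanishing [a] satisfies [a = -1 * a + a], so linearity gives the claim without another
    induction. *)
Lemma shuf0l k l a b s : size s = (k + l)%N ->
  (forall w, size w = k -> a w = 0) -> shuf k l a b s = 0.
Proof.
move=> sk a0; rewrite (@shuf_linl _ _ k l a a a b (-1)) ?mulN1r ?addNr //.
by move=> w sw; rewrite a0 // mulr0 addr0.
Qed.

Lemma shuf0r k l a b s : size s = (k + l)%N ->
  (forall w, size w = l -> b w = 0) -> shuf k l a b s = 0.
Proof.
move=> sk b0; rewrite (@shuf_linr _ _ k l a b b b (-1)) ?mulN1r ?addNr //.
by move=> w sw; rewrite b0 // mulr0 addr0.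
Qed.

(** Adjacent equal arguments give four terms: both in [a] or both in [b], which vanish by
    alternation, and one in each, where the two orders carry opposite signs because the second
    argument meets one argument of [a] fewer or more. *)
Lemma multilin_alt_shuf k l a b : multilin_alt k a -> multilin_alt l b ->
  multilin_alt (k + l) (shuf k l a b).
Proof.
move=> aP bP; split=> [x y u v z|x y u].
  elim: x k l a b aP bP => [|h x IH] k l a b aP bP /=.
    rewrite add0n; move=> sk; rewrite mulrDr addrACA; congr (_ + _).
      case: k aP sk => [|k] aP sk; first by rewrite mulr0 addr0.
      apply: shuf_linl => [|w sw]; first by lia.
      by have /= := aP.1 [::] w u v z; rewrite add0n sw; apply.
    case: l bP sk => [|l] bP sk; first by rewrite mulr0 addr0.
    rewrite mulrCA -mulrDr; congr (_ * _).
    apply: shuf_linr => [|w sw]; first by lia.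
    by have /= := bP.1 [::] w u v z; rewrite add0n sw; apply.
  move=> sk; rewrite mulrDr addrACA; congr (_ + _).
    case: k aP sk => [|k] aP sk; first by rewrite mulr0 addr0.
    by apply: IH => //; [exact: multilin_alt_cons|lia].
  case: l bP sk => [|l] bP sk; first by rewrite mulr0 addr0.
  rewrite mulrCA -mulrDr; congr (_ * _).
  by apply: IH => //; [exact: multilin_alt_cons|lia].
elim: x k l a b aP bP => [|h x IH] k l a b aP bP /= sk; last first.
  rewrite (_ : (if k is _.+1 then _ else _) = 0) ?add0r; last first.
    case: k aP sk => [|k] // aP sk.
    by apply: IH => //; [exact: multilin_alt_cons|lia].
  case: l bP sk => [|l] // bP sk; rewrite IH ?mulr0 //; last by lia.
  exact: multilin_alt_cons.
have aa0 : (if k is k'.+1 then if k' is k''.+1 then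
    shuf k'' l ((a \o cons u) \o cons u) b y else 0 else 0) = 0.
  case: k aP sk => [|[|k]] // aP sk; apply: shuf0l => [|w sw]; first by lia.
  by have /= := aP.2 [::] w u; rewrite add0n sw; apply.
have bb0 : (if l is l'.+1 then if l' is l''.+1 then
    shuf k l'' a ((b \o cons u) \o cons u) y else 0 else 0) = 0.
  case: l bP sk {aa0} => [|[|l]] // bP sk; apply: shuf0r => [|w sw]; first by lia.
  by have /= := bP.2 [::] w u; rewrite add0n sw; apply.
case: k aP sk aa0 bb0 => [|k] aP sk; case: l bP sk => [|l] bP sk //= aa0 bb0.
- by case: l bP sk bb0 => [|l] bP sk // bb0; rewrite ?bb0; ring.
- by case: k aP sk aa0 => [|k] aP sk // aa0; rewrite ?aa0; ring.
rewrite aa0 add0r; case: l bP sk aa0 bb0 => [|l] bP sk aa0 bb0.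
  by rewrite exprS; ring.
by rewrite bb0 exprS; ring.
Qed.

End MultilinearAlternating.

(** * From forms on matrices to functions on lists *)

Section Evaluation.
Context {R : realType} {n : nat}.
Implicit Types (s w : seq 'rV[R]_n).

Definition stack k s : 'M[R]_(k, n) := \matrix_(i < k) nth 0 s i.
Definition ev k (a : mform R n k) s : R := a (stack k s).

Lemma row_stack k s (i : 'I_k) : row i (stack k s) = nth 0 s i.
Proof. by rewrite rowK. Qed.

Lemma stackK k (A : 'M[R]_(k, n)) : stack k [seq row i A | i <- enum 'I_k] = A.
Proof.
apply/row_matrixP => i; rewrite row_stack (nth_map i) ?size_enum_ord //.
by rewrite nth_ord_enum.
Qed.

Lemma size_rows k (A : 'M[R]_(k, n)) : size [seq row i A | i <- enum 'I_k] = k.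
Proof. by rewrite size_map size_enum_ord. Qed.

Lemma ev_eq k (a b : mform R n k) :
  (forall s, size s = k -> ev a s = ev b s) -> a = b.
Proof.
move=> ab; apply/funext => A; rewrite -[A]stackK; apply: ab; exact: size_rows.
Qed.

Lemma stack_split k l s : size s = (k + l)%N ->
  usubmx (stack (k + l) s) = stack k (take k s) /\
  dsubmx (stack (k + l) s) = stack l (drop k s).
Proof.
move=> sk; split; apply/row_matrixP => i; rewrite row_stack.
  by rewrite nth_take //; apply/rowP => j; rewrite !mxE.
by rewrite nth_drop; apply/rowP => j; rewrite !mxE.
Qed.

Lemma stack_col_mx k l s w : size s = k ->
  col_mx (stack k s) (stack l w) = stack (k + l) (s ++ w).
Proof.
move=> sk; apply/row_matrixP => i; rewrite row_stack -[i]splitK.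
case: (fintype.split i) => j; rewrite /unsplit ?rowKu ?rowKd row_stack nth_cat /=.
  by rewrite sk ltn_ord.
by rewrite sk ltnNge leq_addr /= addKn.
Qed.

Lemma multilin_alt_ev k (a : mform R n k) : alternatingf a -> multilin_alt k (ev a).
Proof.
move=> [lin alt]; split=> [x y u v z sk|x y u sk].
  have ik : (size x < k)%N by lia.
  rewrite /ev (lin (Ordinal ik) _ (stack k (x ++ u :: y)) (stack k (x ++ v :: y)) z) //.
  - by rewrite !row_stack /= !nth_cat ltnn subnn.
  - apply/row_matrixP => i; rewrite !row_rowsub /= !row_stack !nth_cat /=.
    have := neq_lift (Ordinal ik) i; rewrite -val_eqE /=.
    by case: ltngtP => // h _; case: (_ - _)%N (subn_gt0 (size x) (lift (Ordinal ik) i)) => //=; rewrite h.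
  - apply/row_matrixP => i; rewrite !row_rowsub /= !row_stack !nth_cat /=.
    have := neq_lift (Ordinal ik) i; rewrite -val_eqE /=.
    by case: ltngtP => // h _; case: (_ - _)%N (subn_gt0 (size x) (lift (Ordinal ik) i)) => //=; rewrite h.
have ik : (size x < k)%N by lia.
have jk : ((size x).+1 < k)%N by lia.
apply: (alt _ (Ordinal ik) (Ordinal jk)); first by rewrite -val_eqE /= neq_ltn leqnn.
by rewrite !row_stack /= !nth_cat ltnn subnn ltnNge leqnSn /= subSnn.
Qed.

(** [lift_perm j ord0 s] sends [j] to [ord0] and acts as [s] on the rest. Injectivity is enough to
    reindex, since both sides have the same number of elements. *)
Lemma sum_lift_perm m (F : 'S_m.+1 -> R) :
  \sum_s F s = \sum_(j < m.+1) \sum_(s : 'S_m) F (lift_perm j ord0 s).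
Proof.
pose h (p : 'I_m.+1 * 'S_m) := lift_perm p.1 ord0 p.2.
have hI : injective h.
  move=> [j s] [j' s']; rewrite /h /= => e.
  have jj : j = j'.
    apply: (@perm_inj _ (lift_perm j' ord0 s')).
    by rewrite -{1}e !lift_perm_id.
  rewrite -jj in e *; congr (_, _); apply/permP => i.
  by apply: (@lift_inj _ ord0); rewrite -!(lift_perm_lift j) e.
rewrite pair_bigA /= (reindex h) //; apply: onW_bij; apply: inj_card_bij => //.
by rewrite card_prod card_ord !card_Sn factS.
Qed.

(* Split a permutation according to the position it moves to the front. *)
Lemma sum_perm_antisym m s (f : 'M[R]_(m, n) -> R) : size s = m ->
  \sum_(r : 'S_m) (-1) ^+ r * f (row_perm r (stack m s)) =
  antisym s (fun w => f (stack m w)).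
Proof.
elim: m s f => [|m IH] [|v s] f //= sm.
  rewrite (big_pred1 1%g) => [|r]; last by apply/esym/eqP/permP => -[].
  by rewrite odd_perm1 mul1r; congr f; apply/matrixP => -[].
case: sm => sm; rewrite sum_lift_perm sm; apply: eq_bigr => j _.
pose g (W : 'M[R]_(m, n)) := f (\matrix_i (if unlift j i is Some k then row k W else v)).
have -> : antisym s (fun w => f (stack m.+1 (take j w ++ v :: drop j w))) =
          antisym s (fun w => g (stack m w)).
  apply: eq_antisym => w sw; congr f; apply/row_matrixP => i.
  rewrite row_stack rowK nth_cat size_takel; last by rewrite sw sm -ltnS.
  case: unliftP => [k ->|->]; last by rewrite ltnn subnn.
  rewrite row_stack /= /bump; case: (leqP j k) => jk.
    by rewrite add1n ltnNge ltnW //= subSn //= nth_drop subnKC.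
  by rewrite add0n jk nth_take.
rewrite -IH // mulr_sumr; apply: eq_bigr => r _.
rewrite mulrA -[in RHS](signr_odd _ j) -signr_addb odd_lift_perm /= addbF; congr (_ * f _).
apply/matrixP => i q; rewrite !mxE; case: unliftP => [k ->|->].
  by rewrite lift_perm_lift !mxE lift0.
by rewrite lift_perm_id.
Qed.

(** The normalizing factor of [wedgef] cancels the number of permutations behind each shuffle, so
    that only signs are left and no denominators. All later computations in [int] rest on this. *)
Lemma ev_wedge k l (a : mform R n k) (b : mform R n l) s :
  multilin_alt k (ev a) -> multilin_alt l (ev b) -> size s = (k + l)%N ->
  ev (wedgef a b) s = shuf k l (ev a) (ev b) s.
Proof.
move=> aP bP sk.
rewrite /ev /wedgef.
rewrite (@sum_perm_antisym _ s (fun W => a (usubmx W) * b (dsubmx W))) //.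
rewrite (eq_antisym (g := fun w => ev a (take k w) * ev b (drop k w))); last first.
  by move=> w sw; have [|-> ->] := @stack_split k l w; rewrite ?sw.
rewrite (antisym_shuf sk); first last.
- by move=> l' e; apply: multilin_alt_insert; rewrite -e.
- by move=> k' e; apply: multilin_alt_insert; rewrite -e.
rewrite mulrA mulVf ?mul1r // pnatr_eq0 -lt0n muln_gt0 !fact_gt0 //.
Qed.

Lemma multilin_alt_wedge k l (a : mform R n k) (b : mform R n l) :
  multilin_alt k (ev a) -> multilin_alt l (ev b) ->
  multilin_alt (k + l) (ev (wedgef a b)).
Proof.
move=> aP bP; apply: (eq_multilin_alt _ (multilin_alt_shuf aP bP)) => w sw.
exact: ev_wedge.
Qed.

Lemma ev_hook k v (a : mform R n k.+1) s : size s = k -> ev (hook v a) s = ev a (v :: s).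
Proof.
move=> sk; have e1 : stack 1 [:: v] = v by apply/rowP => j; rewrite mxE.
by rewrite /ev /hook -{1}e1 stack_col_mx.
Qed.

Lemma multilin_alt_hook k v (a : mform R n k.+1) :
  multilin_alt k.+1 (ev a) -> multilin_alt k (ev (hook v a)).
Proof.
move=> aP; apply: (eq_multilin_alt _ (multilin_alt_cons v aP)) => w sw.
exact: ev_hook.
Qed.

End Evaluation.

(** * Sorting index lists with signs *)

Section IndexLists.
Implicit Types (s w u : seq nat).

(** One step of an insertion sort that keeps track of the sign. A repeated index gives the sign 0;
    the list returned with it is then only known to be a rearrangement. *)
Fixpoint sign_insert (x : nat) s : int * seq nat :=
  if s is y :: s' then
    if (x < y)%N then (1, x :: s) else
    if x == y then (0, x :: s) else
    let p := sign_insert x s' in (- p.1, y :: p.2)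
  else (1, [:: x]).

Fixpoint sign_sort s : int * seq nat :=
  if s is x :: s' then
    let p := sign_sort s' in let q := sign_insert x p.2 in (p.1 * q.1, q.2)
  else (1, [::]).

Lemma perm_sign_insert x s : perm_eq (sign_insert x s).2 (x :: s).
Proof.
elim: s => //= y s IH; case: ifP => // _; case: ifP => //= _.
by rewrite (permPr (permEl (perm_catCA [:: x] [:: y] s))) perm_cons.
Qed.

Lemma perm_sign_sort s : perm_eq (sign_sort s).2 s.
Proof.
elim: s => //= x s IH; rewrite (permPl (perm_sign_insert _ _)).
by rewrite perm_cons.
Qed.

Lemma sorted_sign_insert x s : sorted ltn s -> (sign_insert x s).1 != 0 ->
  sorted ltn (sign_insert x s).2.
Proof.
elim: s => //= y s IH ys; case: (ltngtP x y) => //= xy; first by rewrite xy ys.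
rewrite oppr_eq0 => /(IH (path_sorted ys)).
rewrite !(path_sortedE ltn_trans) => ->; rewrite andbT.
rewrite (perm_all _ (perm_sign_insert x s)) /= xy.
exact: order_path_min ltn_trans ys.
Qed.

Lemma sorted_sign_sort s : (sign_sort s).1 != 0 -> sorted ltn (sign_sort s).2.
Proof.
elim: s => //= x s IH; rewrite mulf_eq0 negb_or => /andP[/IH s1].
exact: sorted_sign_insert.
Qed.

(** For increasing [s] these are the increasing index lists of length [k], one for each basis
    element of the [k]-forms. *)
Fixpoint subseqs k s : seq (seq nat) :=
  if k is k'.+1 then
    if s is x :: s' then map (cons x) (subseqs k' s') ++ subseqs k s' else [::]
  else [:: [::]].

Lemma mem_subseqs k s w : subseq w s -> size w = k -> w \in subseqs k s.
Proof.
elim: s k w => [|x s IH] [|k] [|y w] //= h [sk].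
rewrite mem_cat; case: eqP h => [->|_] h.
  by rewrite map_f // IH.
by rewrite (IH _ (y :: w)) ?orbT //= sk.
Qed.

Fixpoint tuples n k : seq (seq nat) :=
  if k is k'.+1 then [seq i :: w | i <- iota 0 n, w <- tuples n k']
  else [:: [::]].

Lemma mem_tuples n k w : (w \in tuples n k) = (size w == k) && all (gtn n) w.
Proof.
elim: k w => [|k IH] [|x w] //=.
  by apply/allpairsP => -[p [_ _]].
rewrite eqSS; apply/allpairsP/idP => [[p [p1 p2 [-> ->]]]|/and3P[sk xn wn]].
  move: p1 p2; rewrite mem_iota IH /= => -> /andP[-> ->]; done.
by exists (x, w); rewrite mem_iota IH sk wn.
Qed.

Lemma sign_sort_subseqs n k w : w \in tuples n k -> (sign_sort w).1 != 0 ->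
  (sign_sort w).2 \in subseqs k (iota 0 n).
Proof.
rewrite mem_tuples => /andP[/eqP sk wn] /sorted_sign_sort so.
apply: mem_subseqs; last by rewrite (perm_size (perm_sign_sort w)).
(* A strictly increasing list is determined by its entries, so it is the sublist of [iota 0 n] that
   they select. *)
have -> : (sign_sort w).2 = [seq i <- iota 0 n | i \in (sign_sort w).2].
  apply: (irr_sorted_eq ltn_trans ltnn) => //.
    by apply: sorted_filter; [exact: ltn_trans|exact: iota_ltn_sorted].
  move=> i; rewrite mem_filter mem_iota /= add0n.
  rewrite (perm_mem (perm_sign_sort w)); case: (boolP (i \in w)) => //= iw.
  by move: (allP wn _ iw) => /= ->.
exact: filter_subseq.
Qed.

End IndexLists.

(** * Expansion of alternating functions in a frame *)

Section Multilinear.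
Context {R : comNzRingType} {V : lmodType R}.
Implicit Types (a b c : seq V -> R) (s x y : seq V) (w u : seq nat) (E : nat -> V).

Lemma multilin_alt_sum k a x y n (z : 'I_n -> R) (F : 'I_n -> V) :
  multilin_alt k a -> (size x + size y).+1 = k ->
  a (x ++ (\sum_i z i *: F i) :: y) = \sum_i z i * a (x ++ F i :: y).
Proof.
move=> [lin _] sk.
have a0 : a (x ++ 0 :: y) = 0.
  have /eqP := lin x y 0 0 (- 1) sk.
  by rewrite scaler0 addr0 mulN1r addNr => /eqP.
elim: n z F => [|n IH] z F; first by rewrite !big_ord0.
by rewrite !big_ord_recl lin // IH.
Qed.

Lemma sign_insertE k a E s (x : nat) w : multilin_alt k a ->
  (size s + size w).+1 = k ->
  a (s ++ map E (x :: w)) = (sign_insert x w).1%:~R * a (s ++ map E (sign_insert x w).2).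
Proof.
move=> aP; elim: w s => [|y w IH] s sk; first by rewrite mul1r.
rewrite /=; case: (ltngtP x y) => [xy|xy|->] /=; first by rewrite mul1r.
- rewrite (multilin_alt_swap _ _ aP); last by rewrite size_map -sk /= addnS.
  rewrite -!(cat_rcons (E y)) (IH (rcons s (E y))) ?size_rcons -?sk /= ?addnS //.
  by rewrite rmorphN mulNr.
- by rewrite mul0r aP.2 // size_map -sk /= addnS.
Qed.

Lemma sign_sortE k a E w : multilin_alt k a -> size w = k ->
  a (map E w) = (sign_sort w).1%:~R * a (map E (sign_sort w).2).
Proof.
elim: w k a => [|x w IH] k a aP sk; first by rewrite mul1r.
case: k aP sk => // k aP [sk].
have := IH _ _ (multilin_alt_cons (E x) aP) sk; rewrite /= => ->.
have /= := @sign_insertE _ _ E [::] x (sign_sort w).2 aP.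
rewrite add0n (perm_size (perm_sign_sort w)) sk => -> //.
by rewrite rmorphM mulrA.
Qed.

Lemma multilin_alt_catr k l a y : multilin_alt (k + l) a -> size y = l ->
  multilin_alt k (fun x => a (x ++ y)).
Proof.
move=> [lin alt] sy; split=> [x z u v c sk|x z u sk].
  by rewrite -!catA !cat_cons lin // size_cat; lia.
by rewrite -!catA !cat_cons alt // size_cat; lia.
Qed.

Lemma multilin_alt_catl k l a x : multilin_alt (k + l) a -> size x = k ->
  multilin_alt l (fun y => a (x ++ y)).
Proof.
move=> [lin alt] sx; split=> [y z u v c sk|y z u sk].
  by rewrite !catA lin // size_cat; lia.
by rewrite !catA alt // size_cat; lia.
Qed.

Lemma multilin_alt_big k (I : eqType) (r : seq I) (f : I -> seq V -> R) :
  (forall i, i \in r -> multilin_alt k (f i)) ->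
  multilin_alt k (fun s => \sum_(i <- r) f i s).
Proof.
move=> fP; split=> [x y u v z sk|x y u sk].
  rewrite mulr_sumr -big_split /=.
  by apply: eq_big_seq => i /fP[lin _]; exact: lin.
by rewrite big_seq big1 // => i /fP[_ alt]; exact: alt.
Qed.

(** Multilinearity expands the arguments one by one into frame vectors, and alternation sorts the
    resulting indices. *)
Lemma eq_multilin_alt_frame k n a b E : multilin_alt k a -> multilin_alt k b ->
  (forall v, exists z : 'I_n -> R, v = \sum_i z i *: E i) ->
  (forall w, w \in subseqs k (iota 0 n) -> a (map E w) = b (map E w)) ->
  forall s, size s = k -> a s = b s.
Proof.
move=> aP bP gen ab s sk.
(* The expansion starts from the last argument: [s] is the part still arbitrary, [w] the indices
   already chosen. *)
suff: forall w, (size s + size w)%N = k -> all (gtn n) w ->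
    a (s ++ map E w) = b (s ++ map E w).
  by move=> /(_ [::]); rewrite addn0 cats0; apply.
move: sk => _.
elim/last_ind: s => [|s v IH] w sk wn.
  rewrite /= (sign_sortE E aP sk) (sign_sortE E bP sk).
  have [-> |z0] := eqVneq (sign_sort w).1 0; first by rewrite !mul0r.
  congr (_ * _); apply: ab; apply: sign_sort_subseqs => //.
  by rewrite mem_tuples -sk eqxx.
have [z ->] := gen v; rewrite size_rcons addSn in sk.
rewrite !cat_rcons !(multilin_alt_sum _ _ aP, multilin_alt_sum _ _ bP) ?size_map //.
apply: eq_bigr => i _; congr (_ * _); apply: (IH (val i :: w)) => /=.
  by rewrite addnS.
by rewrite ltn_ord.
Qed.

Lemma big_iota_ord n (F : nat -> R) : \sum_(i <- iota 0 n) F i = \sum_(i < n) F i.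
Proof. by rewrite -(big_mkord xpredT) /index_iota subn0. Qed.

Lemma big_tuplesS n k (F : seq nat -> R) :
  \sum_(w <- tuples n k.+1) F w =
  \sum_(i < n) \sum_(w <- tuples n k) F (val i :: w).
Proof.
rewrite -(big_iota_ord n (fun i => \sum_(w <- tuples n k) F (i :: w))).
by rewrite [tuples _ _]/= big_allpairs_dep.
Qed.

Lemma sum_ffun_tuples n k (F : seq nat -> R) :
  \sum_(f : {ffun 'I_k -> 'I_n}) F [seq val (f i) | i <- enum 'I_k] =
  \sum_(w <- tuples n k) F w.
Proof.
elim: k F => [|k IH] F.
  rewrite big_seq1 (big_pred1 (ffun0 (card_ord 0))); first by rewrite enum_ord0.
  by move=> f; apply/esym/eqP/ffunP => -[].
pose h (p : 'I_n * {ffun 'I_k -> 'I_n}) : {ffun 'I_k.+1 -> 'I_n} :=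
  [ffun j => if unlift ord0 j is Some j' then p.2 j' else p.1].
have hI : injective h.
  move=> [i f] [i' f'] /ffunP e; congr (_, _).
    by have := e ord0; rewrite !ffunE unlift_none.
  by apply/ffunP => j; have := e (lift ord0 j); rewrite !ffunE liftK.
rewrite (reindex h); last first.
  apply: onW_bij; apply: inj_card_bij => //.
  by rewrite card_prod !card_ffun !card_ord expnS.
rewrite big_tuplesS -(pair_bigA _ (fun i f => F [seq val (h (i, f) j) | j <- enum 'I_k.+1])) /=.
apply: eq_bigr => i _; rewrite -IH; apply: eq_bigr => f _.
rewrite enum_ordSl /= ffunE unlift_none -map_comp; congr (F (_ :: _)).
by apply: eq_map => j /=; rewrite ffunE liftK.
Qed.

(** In each slot [\sum_i A i (x) B i = \sum_(i, j) q j i E j (x) B i = \sum_j E j (x) E j], with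
    [(x)] for the tensor product. It is applied with [A] the raised coordinate basis, [B] the
    coordinate basis and [E] an orthonormal frame. *)
Lemma sum_tuples_change_frame n k b c (A B E : nat -> V) (q : 'I_n -> 'I_n -> R) :
  multilin_alt k b -> multilin_alt k c ->
  (forall i : 'I_n, A i = \sum_j q j i *: E j) ->
  (forall j : 'I_n, E j = \sum_i q j i *: B i) ->
  \sum_(w <- tuples n k) b (map A w) * c (map B w) =
  \sum_(w <- tuples n k) b (map E w) * c (map E w).
Proof.
move=> bP cP AE EB; elim: k b c bP cP => [|k IH] b c bP cP.
  by rewrite !big_seq1.
rewrite !big_tuplesS /=.
under eq_bigr => i _.
  rewrite (IH (b \o cons (A i)) (c \o cons (B i))).
  - over.
  - exact: multilin_alt_cons.
  - exact: multilin_alt_cons.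
rewrite exchange_big [RHS]exchange_big /= big_seq [RHS]big_seq.
apply: eq_bigr => w; rewrite mem_tuples => /andP[/eqP sk _].
have sl m (a : seq V -> R) z (F : 'I_n -> V) : multilin_alt k.+1 a ->
  m = map E w -> a ((\sum_i z i *: F i) :: m) = \sum_i z i * a (F i :: m).
  by move=> aP ->; apply: (multilin_alt_sum (x := [::]) _ _ aP); rewrite size_map sk.
under eq_bigr => i _ do rewrite AE (sl _ b) // mulr_suml.
rewrite exchange_big /=; apply: eq_bigr => j _.
rewrite [in c _]EB (sl _ c) // mulr_sumr.
by apply: eq_bigr => i _; ring.
Qed.

End Multilinear.

(** * Orthonormal frames and the Hodge dual *)

Section Frames.
Context {R : realType} {n : nat}.
Implicit Types (Q G : 'M[R]_n) (w u : seq nat).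

(** Indexed by [nat], with value 0 from [n] on, so that index lists can be mapped and computed with
    without ordinals. *)
Definition frame Q (i : nat) : 'rV[R]_n := nth 0 [seq row j Q | j <- enum 'I_n] i.

Lemma frameE Q (i : 'I_n) : frame Q i = row i Q.
Proof. by rewrite /frame (nth_map i) ?size_enum_ord // nth_ord_enum. Qed.

Lemma frame_gen Q : Q \in unitmx ->
  forall v, exists z : 'I_n -> R, v = \sum_i z i *: frame Q i.
Proof.
move=> uQ v; exists (fun i => (v *m invmx Q) 0 i).
rewrite -{1}[v](mulmxKV uQ) mulmx_sum_row.
by apply: eq_bigr => i _; rewrite frameE.
Qed.

Lemma rowsub_frame k (f : {ffun 'I_k -> 'I_n}) Q :
  rowsub f Q = stack k (map (frame Q) [seq val (f i) | i <- enum 'I_k]).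
Proof.
apply/row_matrixP => i; rewrite row_rowsub row_stack -map_comp.
by rewrite (nth_map i) ?size_enum_ord // nth_ord_enum /= frameE.
Qed.

(** The hypothesis says that the rows of [Q] are orthonormal for [G]; it makes [G *m Q^T] and [Q]
    mutually inverse. *)
Lemma invmx_orthonormal G Q : Q *m G *m Q^T = 1%:M ->
  Q \in unitmx /\ invmx G = Q^T *m Q.
Proof.
rewrite -mulmxA => QG; have [uQ _] := mulmx1_unit QG; split=> //.
have GQ := mulmx1C QG; rewrite -mulmxA in GQ; have [uG _] := mulmx1_unit GQ.
by rewrite -[RHS](mulKmx uG) GQ mulmx1.
Qed.

Lemma ev_hodge k l G Q (vol : mform R n (k + l)) (b : mform R n k) s :
  Q *m G *m Q^T = 1%:M -> multilin_alt (k + l) (ev vol) -> multilin_alt k (ev b) ->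
  size s = l ->
  ev (hodge k l G vol b) s = (k`!)%:R^-1 *
    \sum_(w <- tuples n k) ev b (map (frame Q) w) * ev vol (map (frame Q) w ++ s).
Proof.
move=> QG vP bP sl; have [uQ iG] := invmx_orthonormal QG.
rewrite /ev /hodge; congr (_ * _).
rewrite -(@sum_tuples_change_frame _ _ n k (ev b) (fun x => ev vol (x ++ s))
  (frame (invmx G)) (frame 1%:M) (frame Q) (fun j i => Q j i)) //; first last.
- move=> j; rewrite frameE -{1}[Q]mulmx1 row_mul mulmx_sum_row.
  by apply: eq_bigr => i _; rewrite frameE mxE.
- move=> i; rewrite frameE iG row_mul mulmx_sum_row.
  by apply: eq_bigr => j _; rewrite frameE !mxE.
- exact: multilin_alt_catr vP sl.
rewrite -sum_ffun_tuples; apply: eq_bigr => f _.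
by rewrite !rowsub_frame stack_col_mx // !size_map -enumT size_enum_ord.
Qed.

End Frames.

(** * Forms with integer components in a frame *)

Section IntegerForms.
Implicit Types (t : seq (seq nat * int)) (w u : seq nat).

Fixpoint coef t w : int :=
  if t is (u, z) :: t' then if u == w then z else coef t' w else 0.

Definition alt_coef t w : int :=
  let p := sign_sort w in if p.1 == 0 then 0 else p.1 * coef t p.2.

Definition shuf_coef k l t t' w : int := shuf k l (alt_coef t) (alt_coef t') w.

Context {R : realType} {n : nat}.
Variable E : nat -> 'rV[R]_n.

(* Only increasing lists of indices are looked up in [t]; the other components
   follow by alternation, see [alt_coef]. *)
Definition int_form k (a : mform R n k) t :=
  multilin_alt k (ev a) /\
  forall w, w \in subseqs k (iota 0 7) -> ev a (map E w) = (coef t w)%:~R.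

Lemma int_formE k (a : mform R n k) t w : int_form a t -> w \in tuples 7 k ->
  ev a (map E w) = (alt_coef t w)%:~R.
Proof.
move=> [aP at_] wk; have := wk; rewrite mem_tuples => /andP[/eqP sw _].
rewrite (sign_sortE E aP sw) /alt_coef; case: eqVneq => [->|z0].
  by rewrite mul0r.
by rewrite at_ ?rmorphM //; exact: sign_sort_subseqs.
Qed.

Lemma shuf_intr k l (a b : seq 'rV[R]_n -> R) (a' b' : seq nat -> int) w :
  (forall u, u \in tuples 7 k -> a (map E u) = (a' u)%:~R) ->
  (forall u, u \in tuples 7 l -> b (map E u) = (b' u)%:~R) ->
  w \in tuples 7 (k + l) ->
  shuf k l a b (map E w) = (shuf k l a' b' w)%:~R.
Proof.
rewrite mem_tuples; elim: w k l a b a' b' => [|x w IH] k l a b a' b' aa bb.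
  move: aa bb; case: k => //; case: l => //= aa bb _.
  by rewrite (aa [::]) ?(bb [::]) ?rmorphM.
move=> /= /and3P[/eqP sk x7 w7]; rewrite rmorphD /=; congr (_ + _).
  case: k aa sk => [|k] // aa sk; apply: IH => //.
    by move=> u uk /=; rewrite -aa //; move: uk; rewrite !mem_tuples /= eqSS x7.
  by rewrite w7 andbT; apply/eqP; lia.
case: l bb sk => [|l] // bb sk; rewrite rmorphM rmorphXn rmorphN1 /=; congr (_ * _).
apply: IH => //.
  by move=> u uk /=; rewrite -bb //; move: uk; rewrite !mem_tuples /= eqSS x7.
by rewrite w7 andbT; apply/eqP; lia.
Qed.

Lemma subseqs_tuples m k w : w \in subseqs k (iota 0 m) -> w \in tuples m k.
Proof.
have : all (gtn m) (iota 0 m) by apply/allP => i; rewrite mem_iota.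
rewrite mem_tuples; elim: (iota 0 m) k w => [|x s IH] [|k] w //=.
- by rewrite inE => _ /eqP ->.
- by rewrite inE => _ /eqP ->.
move=> /andP[xm sm]; rewrite mem_cat => /orP[/mapP[u uk ->]|]; last exact: IH.
by rewrite /= eqSS xm IH.
Qed.

Lemma coef_map (f : seq nat -> int) (r : seq (seq nat)) w : w \in r ->
  coef [seq (u, f u) | u <- r] w = f w.
Proof.
by elim: r => //= u r IH; rewrite inE eq_sym; case: eqP => [->|_] // /IH.
Qed.

Lemma int_form_eq k (a : mform R n k) t t' : int_form a t ->
  all (fun w => coef t w == coef t' w) (subseqs k (iota 0 7)) -> int_form a t'.
Proof.
by move=> [aP at_] /allP tt; split=> // w wk; rewrite at_ // (eqP (tt w wk)).
Qed.

Definition wedge_coefs k l t t' : seq (seq nat * int) :=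
  [seq (w, shuf_coef k l t t' w) | w <- subseqs (k + l) (iota 0 7)].

Lemma int_form_wedge k l (a : mform R n k) (b : mform R n l) t t' :
  int_form a t -> int_form b t' -> int_form (wedgef a b) (wedge_coefs k l t t').
Proof.
move=> at_ bt; split; first exact: multilin_alt_wedge at_.1 bt.1.
move=> w wk; rewrite coef_map //.
have wt := subseqs_tuples wk; have := wt; rewrite mem_tuples => /andP[/eqP sw _].
rewrite ev_wedge ?size_map //; [|exact: at_.1|exact: bt.1].
by apply: shuf_intr => // u uk; exact: int_formE uk.
Qed.

Definition hook_coefs k i t : seq (seq nat * int) :=
  [seq (w, alt_coef t (i :: w)) | w <- subseqs k (iota 0 7)].

Lemma int_form_hook k (a : mform R n k.+1) t i : (i < 7)%N -> int_form a t ->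
  int_form (hook (E i) a) (hook_coefs k i t).
Proof.
move=> i7 at_; split; first exact: multilin_alt_hook at_.1.
move=> w wk; rewrite coef_map //.
have := subseqs_tuples wk; rewrite mem_tuples => /andP[sw w7].
rewrite ev_hook ?size_map ?(eqP sw) //.
by rewrite -(int_formE at_) // mem_tuples /= eqSS sw i7.
Qed.

(** The scalar [y] is given by its inverse [z], an integer that divides the table of [a]; factors
    such as [1/2] and [1/6] thus never leave [int]. *)
Lemma int_formZ k (a : mform R n k) t t' (z : int) (y : R) : y * z%:~R = 1 ->
  int_form a t -> all (fun w => coef t w == z * coef t' w) (subseqs k (iota 0 7)) ->
  int_form (y *: a) t'.
Proof.
move=> yz [aP at_] /allP tt; split; first exact: (multilin_altZ y aP).
move=> w wk; rewrite /ev /= [LHS](_ : _ = y * ev a (map E w)) //.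
by rewrite at_ // (eqP (tt w wk)) rmorphM mulrA yz mul1r.
Qed.

Lemma int_formD k (a b : mform R n k) t t' t'' :
  int_form a t -> int_form b t' ->
  all (fun w => coef t w + coef t' w == coef t'' w) (subseqs k (iota 0 7)) ->
  int_form (a + b) t''.
Proof.
move=> [aP at_] [bP bt] /allP tt; split; first exact: (multilin_altD aP bP).
move=> w wk; rewrite [LHS](_ : _ = ev a (map E w) + ev b (map E w)) //.
by rewrite at_ // bt // -(eqP (tt w wk)) rmorphD.
Qed.

(* The Hodge dual of a form [b] evaluated on [u] is a single component of [b], up
   to sign, repeated once per permutation of its indices; [star_ok] checks it. *)
Definition star_terms k tv u : seq (int * seq nat) :=
  [seq p <- [seq let p := sign_sort w in (p.1 * alt_coef tv (w ++ u), p.2)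
            | w <- tuples 7 k] | p.1 != 0].

Definition star k tv u : int * seq nat := head (0, [::]) (star_terms k tv u).

Definition star_ok k tv u : bool :=
  star_terms k tv u == if (star k tv u).1 == 0 then [::] else nseq k`! (star k tv u).

End IntegerForms.

(** * The Hodge dual as a signed rearrangement of components *)

Section HodgeFrame.
Context {R : realType}.

(** Only index lists that complete [u] to an index list of [vol] contribute. Sorting such a list
    changes the components of [b] and of [vol] by the same sign, so its [k!] orderings give equal
    terms, as [star_ok] records, and the factor [k!^-1] leaves one of them. *)
Lemma ev_hodge_star k l (G Q : 'M[R]_7) (vol : mform R 7 (k + l))
    (b : mform R 7 k) tv u :
  Q *m G *m Q^T = 1%:M -> int_form (frame Q) vol tv -> multilin_alt k (ev b) ->
  u \in tuples 7 l -> star_ok k tv u ->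
  ev (hodge k l G vol b) (map (frame Q) u) =
    (star k tv u).1%:~R * ev b (map (frame Q) (star k tv u).2).
Proof.
move=> QG vt bP ul /eqP ok; have := ul; rewrite mem_tuples => /andP[/eqP su u7].
rewrite (ev_hodge QG vt.1 bP) ?size_map //.
pose F (p : int * seq nat) := p.1%:~R * ev b (map (frame Q) p.2).
transitivity ((k`!)%:R^-1 * \sum_(p <- star_terms k tv u) F p).
  rewrite /star_terms big_filter big_map; congr (_ * _).
  rewrite (bigID (fun w => (sign_sort w).1 * alt_coef tv (w ++ u) != 0)) /=.
  rewrite [X in _ + X = _]big1_seq ?addr0; last first.
    move=> w /andP[]; rewrite negbK mem_tuples => /eqP z0 /andP[/eqP sw w7].
    rewrite (sign_sortE _ bP sw) -map_cat (int_formE vt); last first.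
      by rewrite mem_tuples size_cat sw su all_cat w7 u7 eqxx.
    by rewrite mulrAC -rmorphM z0 mul0r.
  rewrite big_seq_cond [RHS]big_seq_cond; apply: eq_bigr => w /andP[wk _].
  have := wk; rewrite mem_tuples => /andP[/eqP sw w7].
  rewrite (sign_sortE _ bP sw) -map_cat (int_formE vt); last first.
    by rewrite mem_tuples size_cat sw su all_cat w7 u7 eqxx.
  by rewrite /F /= mulrAC -rmorphM.
rewrite ok; case: eqVneq => [->|_]; first by rewrite big_nil mulr0 mul0r.
rewrite big_nseq iter_addr_0 -[X in _ * X]mulr_natl mulrA mulVf ?mul1r //.
Qed.

Lemma int_form_hodge k l (G Q : 'M[R]_7) (vol : mform R 7 (k + l))
    (b : mform R 7 k) tv t t' :
  Q *m G *m Q^T = 1%:M -> int_form (frame Q) vol tv -> int_form (frame Q) b t ->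
  multilin_alt l (ev (hodge k l G vol b)) ->
  all (fun u => star_ok k tv u && ((star k tv u).2 \in tuples 7 k) &&
       ((star k tv u).1 * alt_coef t (star k tv u).2 == coef t' u))
    (subseqs l (iota 0 7)) ->
  int_form (frame Q) (hodge k l G vol b) t'.
Proof.
move=> QG vt bt hP /allP tt; split=> // u ul.
have /andP[/andP[ok sk] /eqP <-] := tt u ul.
rewrite (ev_hodge_star QG vt bt.1) //; last exact: subseqs_tuples.
by rewrite (int_formE bt) // rmorphM.
Qed.

End HodgeFrame.

(** * The model form and its rotations *)

Definition vol_coefs : seq (seq nat * int) := [:: (iota 0 7, 1)].
Definition g2_coefs : seq (seq nat * int) :=
  [:: ([:: 0; 1; 2]%N, 1); ([:: 0; 3; 4]%N, 1); ([:: 0; 5; 6]%N, 1);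
      ([:: 1; 3; 5]%N, 1); ([:: 1; 4; 6]%N, -1); ([:: 2; 3; 6]%N, -1);
      ([:: 2; 4; 5]%N, -1)].
Definition g2_coform_coefs : seq (seq nat * int) :=
  [:: ([:: 3; 4; 5; 6]%N, 1); ([:: 1; 2; 5; 6]%N, 1); ([:: 1; 2; 3; 4]%N, 1);
      ([:: 0; 2; 4; 6]%N, 1); ([:: 0; 2; 3; 5]%N, -1); ([:: 0; 1; 4; 5]%N, -1);
      ([:: 0; 1; 3; 6]%N, -1)].

Section Model.

Definition det3 (R : pzRingType) (u v w : nat -> R) (i j k : nat) : R :=
  u i * (v j * w k - v k * w j) - u j * (v i * w k - v k * w i)
  + u k * (v i * w j - v j * w i).

(** Written over any ring, so that the same polynomial is computed over [int] on Kronecker deltas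
    and manipulated by [ring] over the reals. *)
Definition g2_cubic (R : pzRingType) (u v w : nat -> R) : R :=
  det3 u v w 0 1 2 + det3 u v w 0 3 4 + det3 u v w 0 5 6 + det3 u v w 1 3 5
  - det3 u v w 1 4 6 - det3 u v w 2 3 6 - det3 u v w 2 4 5.

Lemma g2_cubic_rmorph (R S : pzRingType) (h : {rmorphism R -> S}) (u v w : nat -> R) :
  h (g2_cubic u v w) = g2_cubic (h \o u) (h \o v) (h \o w).
Proof. by rewrite /g2_cubic /det3 !(rmorphB, rmorphD, rmorphM). Qed.

Context {R : realType}.
Implicit Types (u v w x : 'rV[R]_7) (P : 'M[R]_7).

Definition coord x (i : nat) : R := x 0 (inord i).

Lemma det_matrix3 (f : nat -> nat -> R) :
  \det (\matrix_(i < 3, j < 3) f i j) = det3 (f 0%N) (f 1%N) (f 2%N) 0 1 2.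
Proof.
rewrite (expand_det_row _ ord0) !big_ord_recl big_ord0 /cofactor.
rewrite !(expand_det_row _ ord0) !big_ord_recl !big_ord0 /cofactor !det_mx11.
rewrite !mxE /= /bump /= /det3; ring.
Qed.

Lemma ev_g2_model u v w :
  ev (g2_model : mform R 7 3) [:: u; v; w] = g2_cubic (coord u) (coord v) (coord w).
Proof.
have cE i j k : covol3 i j k (stack 3 [:: u; v; w]) =
    det3 (coord u) (coord v) (coord w) i j k.
  rewrite /covol3.
  pose c m := nth 0%N [:: i; j; k] m.
  transitivity (\det (\matrix_(r < 3, m < 3)
    (fun r m => coord (nth 0 [:: u; v; w] r) (c m)) r m)).
    congr (\det _); apply/matrixP => r m; rewrite !mxE /coord.
    by rewrite (tnth_nth ord0); case: m => -[|[|[|]]].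
  exact: (det_matrix3 (fun r m => coord (nth 0 [:: u; v; w] r) (c m))).
by rewrite /ev /g2_model /g2_cubic -!cE.
Qed.

Lemma multilin_alt_g2_model P : multilin_alt 3 (fun s => ev g2_model (map (mulmxr P) s)).
Proof.
have sz3 (T : Type) (s : seq T) : size s = 3%N -> exists a b c, s = [:: a; b; c].
  by case: s => [|a [|b [|c []]]] // _; exists a, b, c.
have cD (z : R) u v : coord ((z *: u + v) *m P) = fun i => z * coord (u *m P) i + coord (v *m P) i.
  by apply/funext => i; rewrite mulmxDl -scalemxAl /coord !mxE.
split=> [x y u v z|x y u].
  case: x => [|a [|b [|c x]]]; case: y => [|d [|e [|f y]]] //= _;
  by rewrite !ev_g2_model /= cD /g2_cubic /det3; ring.
case: x => [|a [|b x]]; case: y => [|d [|e y]] //= _;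
by rewrite !ev_g2_model /g2_cubic /det3; ring.
Qed.

Lemma coord_delta (i : 'I_7) (m : nat) : (m < 7)%N ->
  coord (delta_mx 0 i) m = (i == m :> nat)%:R.
Proof. by move=> m7; rewrite /coord mxE eqxx /= -val_eqE /= inordK // eq_sym. Qed.

Lemma int_form_g2_model P Q (a : mform R 7 3) :
  Q *m P = 1%:M -> a = (fun V => g2_model (V *m P)) -> int_form (frame Q) a g2_coefs.
Proof.
move=> QP aE.
have evE s : size s = 3%N -> ev a s = ev g2_model (map (mulmxr P) s).
  move=> ss; rewrite aE /ev; congr (g2_model _); apply/row_matrixP => i.
  by rewrite row_mul !row_stack (nth_map 0) ?ss.
split; first exact: eq_multilin_alt evE (multilin_alt_g2_model P).
move=> w wk; have := subseqs_tuples wk; rewrite mem_tuples => /andP[/eqP sw w7].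
rewrite evE ?size_map // -map_comp.
(* On frame vectors the cubic sees only Kronecker deltas; its values on the 35 increasing triples
   are computed over [int] and compared with the table. *)
have -> : (coef g2_coefs w)%:~R =
   g2_cubic (fun m => ((nth 0%N w 0 == m)%:Z)%:~R : R)
            (fun m => ((nth 0%N w 1 == m)%:Z)%:~R)
            (fun m => ((nth 0%N w 2 == m)%:Z)%:~R).
  rewrite -(g2_cubic_rmorph intr (fun m => (nth 0%N w 0 == m)%:Z)
    (fun m => (nth 0%N w 1 == m)%:Z) (fun m => (nth 0%N w 2 == m)%:Z)).
  congr (_%:~R); apply/eqP; move: w wk {sw w7}; apply/allP.
  by vm_compute.
case: w sw w7 {wk} => [|i [|j [|k []]]] //= _ /and4P[i7 j7 k7 _].
have fE m (m7 : (m < 7)%N) : frame Q m *m P = delta_mx 0 (Ordinal m7).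
  by rewrite -[m]/(val (Ordinal m7)) frameE -row_mul QP row1.
rewrite ev_g2_model !fE /g2_cubic /det3 !coord_delta //=.
Qed.

(** Coordinates after a rotation with cosine [c] and sine [s] in two planes. They are functions on
    [nat], whose values [ring] treats as atoms. *)
Definition rotate (i j k l : nat) (c s : R) (f : nat -> R) (m : nat) : R :=
  if m == i then c * f i + s * f j else if m == j then c * f j - s * f i else
  if m == k then c * f k + s * f l else if m == l then c * f l - s * f k else f m.

Definition rotation i j k l c s : 'M[R]_7 :=
  \matrix_(a, b) rotate i j k l c s (fun m => (a == m :> nat)%:R) b.

Lemma coordE x (i : 'I_7) : x 0 i = coord x i.
Proof. by rewrite /coord inord_val. Qed.

Lemma coord_eq x y : (forall m, (m < 7)%N -> coord x m = coord y m) -> x = y.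
Proof. by move=> xy; apply/rowP => i; rewrite !coordE xy. Qed.

Lemma coord_sum x m : (m < 7)%N -> \sum_a x 0 a * (a == m :> nat)%:R = coord x m.
Proof.
move=> m7; rewrite (bigD1 (Ordinal m7)) //= eqxx mulr1 coordE big1 ?addr0 // => a.
by rewrite -val_eqE /= => /negbTE ->; rewrite mulr0.
Qed.

Lemma coord_rotation x i j k l c s m : all (gtn 7) [:: i; j; k; l] -> (m < 7)%N ->
  coord (x *m rotation i j k l c s) m = rotate i j k l c s (coord x) m.
Proof.
move=> /and5P[i7 j7 k7 l7 _] m7.
rewrite {1}/coord mxE; under eq_bigr => a _ do rewrite mxE inordK //.
rewrite /rotate -!(coord_sum x) //.
by do 4![case: ifP => _; first by rewrite !mulr_sumr -?sumrB -?big_split /=;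
  apply: eq_bigr => a _; ring].
Qed.

(* [[:: i; j; k; l]] stands for the circle that rotates the plane [(i, j)] and the
   plane [(k, l)] by the same angle; it preserves the model form. *)
Definition g2_planes : seq (seq nat) := [:: [:: 1; 2; 4; 3]; [:: 3; 4; 6; 5]; [:: 5; 6; 4; 3];
  [:: 1; 3; 2; 4]; [:: 1; 5; 2; 6]; [:: 0; 1; 3; 6]]%N.

Lemma g2_planesP (T : nat -> nat -> nat -> nat -> Prop) i j k l :
  T 1%N 2%N 4%N 3%N -> T 3%N 4%N 6%N 5%N -> T 5%N 6%N 4%N 3%N -> T 1%N 3%N 2%N 4%N ->
  T 1%N 5%N 2%N 6%N -> T 0%N 1%N 3%N 6%N ->
  [:: i; j; k; l] \in g2_planes -> T i j k l.
Proof.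
move=> ? ? ? ? ? ?; rewrite !inE !eqseq_cons !andbT.
by case/or4P => [||| /or3P[]] /and4P[/eqP-> /eqP-> /eqP-> /eqP->].
Qed.

Lemma rotateK i j k l c s f : [:: i; j; k; l] \in g2_planes ->
  c ^+ 2 + s ^+ 2 = 1 -> rotate i j k l c (- s) (rotate i j k l c s f) =1 f.
Proof.
(* The relation between [c] and [s] enters as a factor of the right-hand side; both sides are then
   equal as polynomials. *)
move=> ijkl cs m; have e y : y = (c ^+ 2 + s ^+ 2) * y by rewrite cs mul1r.
move: ijkl; apply: (@g2_planesP (fun i j k l =>
  rotate i j k l c (- s) (rotate i j k l c s f) m = f m)); rewrite /rotate;
by case: m => [|[|[|[|[|[|[|m]]]]]]] //=; rewrite [RHS]e; ring.
Qed.

Lemma g2_cubic_rotate f g h i j k l c s : [:: i; j; k; l] \in g2_planes ->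
  c ^+ 2 + s ^+ 2 = 1 ->
  g2_cubic (rotate i j k l c s f) (rotate i j k l c s g) (rotate i j k l c s h) =
  g2_cubic f g h.
Proof.
move=> ijkl cs.
(* Every term of the model form picks up [c ^+ 2 + s ^+ 2], except the one whose
   three coordinates are not rotated. *)
have split_line d : g2_cubic f g h =
    (c ^+ 2 + s ^+ 2) * (g2_cubic f g h - d) + d by rewrite cs; ring.
move: ijkl; apply: (@g2_planesP (fun i j k l =>
  g2_cubic (rotate i j k l c s f) (rotate i j k l c s g) (rotate i j k l c s h)
  = g2_cubic f g h)).
- by rewrite (split_line (det3 f g h 0 5 6)) /g2_cubic /det3 /rotate /=; ring.
- by rewrite (split_line (det3 f g h 0 1 2)) /g2_cubic /det3 /rotate /=; ring.
- by rewrite (split_line (det3 f g h 0 1 2)) /g2_cubic /det3 /rotate /=; ring.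
- by rewrite (split_line (det3 f g h 0 5 6)) /g2_cubic /det3 /rotate /=; ring.
- by rewrite (split_line (det3 f g h 0 3 4)) /g2_cubic /det3 /rotate /=; ring.
- by rewrite (split_line (- det3 f g h 2 4 5)) /g2_cubic /det3 /rotate /=; ring.
Qed.

(** [v *m P] holds the coordinates of [v] in the frame formed by the rows of [invmx P]; in that
    frame [a] is the model form. *)
Definition adapted (a : mform R 7 3) P :=
  P \in unitmx /\ a = fun V => g2_model (V *m P).

Lemma adapted_rotation a P i j k l c s : [:: i; j; k; l] \in g2_planes ->
  c ^+ 2 + s ^+ 2 = 1 -> adapted a P -> adapted a (P *m rotation i j k l c s).
Proof.
move=> ijkl cs [uP ->].
have q7 : all (gtn 7) [:: i; j; k; l].
  exact: (allP (isT : all (all (gtn 7)) g2_planes) _ ijkl).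
split.
  rewrite unitmx_mul uP /=.
  suff : rotation i j k l c s *m rotation i j k l c (- s) = 1%:M.
    by case/mulmx1_unit.
  apply/row_matrixP => r; rewrite -(mul1mx (rotation _ _ _ _ _ s)) !row_mul.
  apply: coord_eq => m m7.
  rewrite coord_rotation // -[RHS](rotateK _ ijkl cs) /rotate.
  by move: (q7) => /and5P[? ? ? ? _]; rewrite !coord_rotation.
apply/funext => V; rewrite mulmxA; set W := V *m P.
have -> : W = stack 3 [:: row 0 W; row 1 W; row 2%:R W].
  by apply/row_matrixP => -[[|[|[|//]]] h]; rewrite row_stack /=; congr row; apply: val_inj.
rewrite [RHS](_ : _ = ev g2_model (map (mulmxr (rotation i j k l c s))
  [:: row 0 W; row 1 W; row 2%:R W])); last first.
  congr (g2_model _); apply/row_matrixP => -[[|[|[|//]]] h];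
  by rewrite row_mul !row_stack.
rewrite -/(ev _ _) !ev_g2_model /=.
move: (row 0 W) (row 1 W) (row 2%:R W) => u v w.
rewrite -(g2_cubic_rotate (coord u) (coord v) (coord w) ijkl cs).
by rewrite /g2_cubic /det3 !coord_rotation.
Qed.

(** The rotation takes [(a, b)] to the nonnegative half of the first axis. The sign matters in the
    end: the surviving coordinate of [xi] has to be its norm, not merely up to sign. *)
Lemma rotate_away (a b : R) : exists c s,
  [/\ c ^+ 2 + s ^+ 2 = 1, c * b - s * a = 0 & 0 <= c * a + s * b].
Proof.
have [r0|r0] := eqVneq (a ^+ 2 + b ^+ 2) 0.
  exists 1, 0; move/eqP: r0; rewrite paddr_eq0 ?sqr_ge0 // !sqrf_eq0.
  by move=> /andP[/eqP-> /eqP->]; split; rewrite ?mulr0 ?addr0 ?subr0 // !expr2; ring.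
have rp : 0 < a ^+ 2 + b ^+ 2 by rewrite lt_def r0 addr_ge0 ?sqr_ge0.
pose r := Num.sqrt (a ^+ 2 + b ^+ 2).
have rn : 0 < r by rewrite sqrtr_gt0.
have r2 : r ^+ 2 = a ^+ 2 + b ^+ 2 by rewrite sqr_sqrtr ?ltW.
exists (a / r), (b / r); split.
- by rewrite !expr_div_n -mulrDl -r2 divff // sqrf_eq0 gt_eqF.
- by ring.
- by rewrite ![_ / r * _]mulrAC -mulrDl -!expr2 divr_ge0 // ltW.
Qed.

(** Transitivity of G2 on spheres, made explicit with six of its circle subgroups, each of which
    kills one coordinate. *)
Lemma adapted_normal_form a x : nondegenerate3 a ->
  exists P r, [/\ adapted a P, 0 <= r & x *m P = r *: delta_mx 0 0].
Proof.
case=> P0 uP0 aE.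
have kill P i j k l : [:: i; j; k; l] \in g2_planes -> adapted a P ->
    exists P', [/\ adapted a P', coord (x *m P') j = 0,
      0 <= coord (x *m P') i,
      coord (x *m P) k = 0 -> coord (x *m P) l = 0 ->
        coord (x *m P') k = 0 /\ coord (x *m P') l = 0 &
      forall m, (m < 7)%N -> m \notin [:: i; j; k; l] ->
        coord (x *m P') m = coord (x *m P) m].
  move=> ijkl aP; have [c [s [cs c0 cp]]] := rotate_away (coord (x *m P) i) (coord (x *m P) j).
  exists (P *m rotation i j k l c s); rewrite mulmxA.
  have q7 := allP (isT : all (all (gtn 7)) g2_planes) _ ijkl.
  have uq := allP (isT : all uniq g2_planes) _ ijkl.
  move: (q7) (uq) => /and5P[/= i7 j7 k7 l7 _].
  rewrite !inE !negb_or => /and4P[/and3P[ij ik il] /andP[jk jl] kl _].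
  split; first exact: adapted_rotation.
  - by rewrite coord_rotation // /rotate eq_sym (negbTE ij) eqxx.
  - by rewrite coord_rotation // /rotate eqxx.
  - move=> k0 l0; rewrite !coord_rotation // /rotate !eqxx.
    rewrite ![k == _]eq_sym ![l == _]eq_sym.
    by rewrite (negbTE ik) (negbTE il) (negbTE jk) (negbTE jl) (negbTE kl) k0 l0; split; ring.
  - move=> m m7; rewrite !inE !negb_or => /and4P[mi mj mk ml].
    by rewrite coord_rotation // /rotate (negbTE mi) (negbTE mj) (negbTE mk) (negbTE ml).
(* Each rotation also turns its companion plane [(k, l)]. The first two disturb only coordinates
   that are still to be killed; from the third on, both coordinates of the companion plane are
   already zero and stay so. The last rotation makes coordinate 0 nonnegative. *)
have [P1 [a1 x12 _ _ _]] := kill _ 1%N 2%N 4%N 3%N isT (conj uP0 aE).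
have [P2 [a2 x24 _ _ n2]] := kill _ 3%N 4%N 6%N 5%N isT a1.
have x22 : coord (x *m P2) 2 = 0 by rewrite n2.
have [P3 [a3 x33 _ z3 n3]] := kill _ 1%N 3%N 2%N 4%N isT a2.
have {z3} [x32 x34] := z3 x22 x24.
have [P4 [a4 x46 _ z4 n4]] := kill _ 5%N 6%N 4%N 3%N isT a3.
have {z4} [x44 x43] := z4 x34 x33.
have x42 : coord (x *m P4) 2 = 0 by rewrite n4.
have [P5 [a5 x55 _ z5 n5]] := kill _ 1%N 5%N 2%N 6%N isT a4.
have {z5} [x52 x56] := z5 x42 x46.
have x53 : coord (x *m P5) 3 = 0 by rewrite n5.
have x54 : coord (x *m P5) 4 = 0 by rewrite n5.
have [P6 [a6 x61 x60 z6 n6]] := kill _ 0%N 1%N 3%N 6%N isT a5.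
have {z6} [x63 x66] := z6 x53 x56.
exists P6, (coord (x *m P6) 0); split=> //; apply: coord_eq => m m7.
rewrite [RHS](_ : _ = coord (x *m P6) 0 * coord (delta_mx 0 (ord0 : 'I_7)) m);
  last by rewrite /coord mxE.
rewrite coord_delta //.
by case: m m7 => [|[|[|[|[|[|[|m]]]]]]] //= _; rewrite ?mulr1 ?mulr0 // n6.
Qed.

End Model.

(** * Frames adapted to a G2-form and a vector *)

Section AdaptedFrame.
Context {R : realType}.

Lemma stack_frame n (Q : 'M[R]_n) : stack n (map (frame Q) (iota 0 n)) = Q.
Proof.
apply/row_matrixP => i; rewrite row_stack (nth_map 0%N) ?size_iota // nth_iota //.
by rewrite add0n frameE.
Qed.

Lemma alternating_det n : alternatingf (determinant : mform R n n).
Proof.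
split=> [i A B C z AE BE CE|A i j ij Aij].
  rewrite -[LHS]scale1r -[z * _]/(z *: _).
  rewrite (determinant_multilinear (b := z) (c := 1) (i0 := i) (B := B) (C := C)) //.
  - by rewrite scale1r mul1r.
  - by rewrite AE scale1r.
by apply: (determinant_alternate ij) => k; move/rowP: Aij => /(_ k); rewrite !mxE.
Qed.

(** Both sides are alternating in the rows of [Q], and there is only one increasing list of seven
    indices on which to compare them. *)
Lemma top_form_det (a : mform R 7 7) (Q : 'M[R]_7) : alternatingf a ->
  a Q = \det Q * a 1%:M.
Proof.
move=> /multilin_alt_ev aP.
rewrite -{1 2}[Q]stack_frame -![_ (stack 7 _)]/(ev _ _) [RHS]mulrC.
have dP := multilin_altZ (a 1%:M) (multilin_alt_ev (@alternating_det 7)).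
apply: (eq_multilin_alt_frame (E := frame 1%:M) (n := 7) aP dP).
- by apply: frame_gen; exact: unitmx1.
- move=> w; rewrite inE => /eqP ->.
  by rewrite /ev !stack_frame det1 mulr1.
- by rewrite size_map size_iota.
Qed.

(** The metric of the model is Euclidean: 6 is the value of [(e_i -| phi) /\ (e_i -| phi) /\ phi] on
    the frame, to be cancelled by the factor [1/6] in [g2_form_metric]. *)
Lemma g2_metric_coefs : all (fun i => all (fun j =>
    coef (wedge_coefs 4 3 (wedge_coefs 2 2 (hook_coefs 2 i g2_coefs)
      (hook_coefs 2 j g2_coefs)) g2_coefs) (iota 0 7) == 6 * (i == j)%:Z)
  (iota 0 7)) (iota 0 7).
Proof. by vm_compute. Qed.

Lemma adapted_frame (phi : mform R 7 3) (G : 'M[R]_7) (vol : mform R 7 7)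
    (xi : 'rV[R]_7) :
  nondegenerate3 phi -> alternatingf vol -> vol 1%:M ^+ 2 = \det G ->
  (forall u v : 'rV[R]_7, ip G u v *: vol =
    (6%:R^-1 : R) *: wedgef (wedgef (hook u phi) (hook v phi)) phi) ->
  exists Q : 'M[R]_7, [/\ Q *m G *m Q^T = 1%:M,
    int_form (frame Q) phi g2_coefs, int_form (frame Q) vol vol_coefs &
    xi = Num.sqrt (ip G xi xi) *: frame Q 0].
Proof.
move=> phi_nd volA vol2 metric.
have [P [r [[uP phiE] r0 xiP]]] := adapted_normal_form xi phi_nd.
pose Q := invmx P; exists Q.
have phiQ : int_form (frame Q) phi g2_coefs.
  by apply: (int_form_g2_model _ phiE); rewrite mulVmx.
pose nu := vol Q.
have gE (i j : 'I_7) : ip G (row i Q) (row j Q) * nu = (i == j)%:R.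
  have /(congr1 (fun f => f Q)) /= := metric (row i Q) (row j Q).
  rewrite -[X in X = _]/(ip G (row i Q) (row j Q) * nu) => ->.
  rewrite -[LHS]/(6%:R^-1 * wedgef (wedgef (hook (row i Q) phi)
    (hook (row j Q) phi)) phi Q) -{3}(stack_frame Q) -!frameE.
  have := int_form_wedge (int_form_wedge (int_form_hook (ltn_ord i) phiQ)
    (int_form_hook (ltn_ord j) phiQ)) phiQ.
  move=> [_ /(_ (iota 0 7) (mem_head _ _))]; rewrite /ev => ->.
  have /allP/(_ i) := g2_metric_coefs; rewrite mem_iota ltn_ord => /(_ isT).
  move=> /allP/(_ j); rewrite mem_iota ltn_ord => /(_ isT) /eqP ->.
  rewrite rmorphM /= mulrA -val_eqE; have -> : (6%:~R : R) = 6%:R by [].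
  by rewrite mulVf ?mul1r // pnatr_eq0.
have nu0 : nu != 0.
  by apply/eqP => nu0; move: (gE ord0 ord0) => /eqP; rewrite nu0 mulr0 eqxx eq_sym oner_eq0.
have QGE : Q *m G *m Q^T = (nu^-1)%:M.
  apply/matrixP => i j; rewrite !mxE.
  rewrite -[LHS](mulfK nu0) [X in X / nu](_ : _ = (i == j)%:R).
    by case: (i == j); rewrite ?mul1r ?mul0r ?mulr1n ?mulr0n.
  rewrite -gE /ip; congr (_ * _); rewrite -row_mul !mxE.
  by apply: eq_bigr => k _; rewrite !mxE.
(* [nu g] is the identity in the frame and [nu ^ 2 = det g] there. *)
have nu9 : nu ^+ 9 = 1.
  have : nu ^+ 2 = nu^-1 ^+ 7.
    rewrite -(det_scalar 7) -QGE !det_mulmx det_tr -vol2.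
    by rewrite /nu (top_form_det Q volA); ring.
  by move=> e; rewrite (exprD nu 2 7) e -exprMn mulVf // expr1n.
(* The exponent 9 is odd, which excludes a negative [nu]: the scale of the metric and the
   orientation are settled together. *)
have nu1 : nu = 1.
  have [n0|n0] := leP 0 nu.
    by move/eqP: nu9; rewrite pexpr_eq1 // => /eqP.
  have : nu ^+ 9 < 0 by rewrite exprn_odd_lt0.
  by rewrite nu9 ltr10.
rewrite nu1 invr1 in QGE; split=> //.
- split; first exact: multilin_alt_ev.
  by move=> w; rewrite inE => /eqP ->; rewrite /ev stack_frame.
- have -> : xi = r *: frame Q 0.
    rewrite -[xi](mulmxK uP) xiP -scalemxAl; congr (_ *: _).
    by rewrite -rowE [RHS](frameE Q ord0).
  have g00 : ip G (frame Q 0) (frame Q 0) = 1.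
    by have := gE ord0 ord0; rewrite nu1 mulr1 -frameE eqxx.
  have -> : ip G (r *: frame Q 0) (r *: frame Q 0) = r ^+ 2.
    rewrite /ip linearZ /= -!scalemxAl -scalemxAr mxE mxE.
    by rewrite [X in r * (r * X)]g00 mulr1.
  by rewrite sqrtr_sqr ger0_norm.
Qed.

End AdaptedFrame.

(** * The algebra of the Leibniz rule *)

Section AlternatingSum.
Context {R : comNzRingType} {V : Type}.
Implicit Types (d : V -> seq V -> R) (pre s : seq V).

(** The coordinate formula of the exterior derivative, [d v u] standing for the derivative along [v]
    of a form at [u]. The vectors already passed over are kept, in order, in [pre]. *)
Fixpoint alt_sum d pre s : R :=
  if s is v :: s' then d v (pre ++ s') - alt_sum d (rcons pre v) s' else 0.

Lemma alt_sumE d v0 pre s : alt_sum d pre s =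
  \sum_(i < size s) (-1) ^+ i * d (nth v0 s i) (pre ++ take i s ++ drop i.+1 s).
Proof.
elim: s pre => [|v s IH] pre /=; first by rewrite big_ord0.
rewrite big_ord_recl /= mul1r drop0; congr (_ + _).
rewrite IH -sumrN; apply: eq_bigr => i _.
by rewrite exprS mulN1r mulNr cat_rcons.
Qed.

Lemma eq_alt_sum d d' pre s k : (size pre + size s)%N = k.+1 ->
  (forall v u, size u = k -> d v u = d' v u) -> alt_sum d pre s = alt_sum d' pre s.
Proof.
move=> sk dd; elim: s pre sk => //= v s IH pre sk.
rewrite dd ?size_cat; last by move: sk; rewrite addnS => -[].
by rewrite IH // size_rcons addSn -sk addnS.
Qed.

Variables (a b : seq V -> R) (da db : V -> seq V -> R).

(** With [a], [b] and their derivatives as free symbols, the Leibniz rule in fixed degrees is a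
    polynomial identity in their values; the sign comes from moving the derivative past the 1-form
    [a]. *)
Lemma alt_sum_shuf12 s : size s = 4%N ->
  alt_sum (fun v u => shuf 1 2 (da v) b u + shuf 1 2 a (db v) u) [::] s =
  shuf 2 2 (alt_sum da [::]) b s - shuf 1 3 a (alt_sum db [::]) s.
Proof. by case: s => [|v0 [|v1 [|v2 [|v3 []]]]] // _; rewrite /=; ring. Qed.

Lemma alt_sum_shuf13 s : size s = 5%N ->
  alt_sum (fun v u => shuf 1 3 (da v) b u + shuf 1 3 a (db v) u) [::] s =
  shuf 2 3 (alt_sum da [::]) b s - shuf 1 4 a (alt_sum db [::]) s.
Proof. by case: s => [|v0 [|v1 [|v2 [|v3 [|v4 []]]]]] // _; rewrite /=; ring. Qed.

(** The two Leibniz terms [da /\ a] and [a /\ da] coincide because [a] has even degree. *)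
Lemma alt_sum_shuf22 s : size s = 5%N ->
  alt_sum (fun v u => shuf 2 2 (da v) a u + shuf 2 2 a (da v) u) [::] s =
  2 * shuf 3 2 (alt_sum da [::]) a s.
Proof. by case: s => [|v0 [|v1 [|v2 [|v3 [|v4 []]]]]] // _; rewrite /=; ring. Qed.

End AlternatingSum.

(** * Differentiation at a point of a chart *)

Section DirectionalDerivatives.
Context {R : realType} {n : nat}.
Variable x0 : 'rV[R]_n.
Implicit Types (f g : 'rV[R]_n -> R) (v : 'rV[R]_n).

(** Enough for the coordinate formula of the exterior derivative, and stable under the algebraic
    operations from which the forms are built. *)
Definition dderivable f := forall v, derivable (f : 'rV[R]_n -> R^o) x0 v.

Notation "'d[ v ] f" := ('D_v (f : 'rV[R]_n -> R^o) x0)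
  (at level 10, v at level 200, f at level 9, format "''d[' v ]  f").

Lemma dderivable_near f g : (\forall x \near x0, f x = g x) -> dderivable f -> dderivable g.
Proof. by move=> fg df v; apply: near_eq_derivable (df v). Qed.

Lemma dderivable_cst (a : R) : dderivable (fun=> a).
Proof. by move=> v; exact: derivable_cst. Qed.

Lemma dderivableD f g : dderivable f -> dderivable g -> dderivable (fun x => f x + g x).
Proof. by move=> df dg v; exact: derivableD. Qed.

Lemma dderivableM f g : dderivable f -> dderivable g -> dderivable (fun x => f x * g x).
Proof. by move=> df dg v; exact: derivableM. Qed.

Lemma dderivableV f : f x0 != 0 -> dderivable f -> dderivable (fun x => (f x)^-1).
Proof. by move=> f0 df v; exact: derivableV. Qed.

Lemma dderivable_sum (I : Type) (r : seq I) (P : pred I) (F : I -> 'rV[R]_n -> R) :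
  (forall i, dderivable (F i)) -> dderivable (fun x => \sum_(i <- r | P i) F i x).
Proof.
move=> dF; elim: r => [|i r IH].
  by rewrite [X in dderivable X](_ : _ = (fun=> 0)) ?funeqE => [|x];
    [exact: dderivable_cst|rewrite big_nil].
rewrite [X in dderivable X](_ : _ = (fun x =>
  if P i then F i x + \sum_(j <- r | P j) F j x else \sum_(j <- r | P j) F j x)).
  by case: (P i); [exact: dderivableD|exact: IH].
by apply/funext => x; rewrite big_cons.
Qed.

Lemma dderivable_prod (I : Type) (r : seq I) (P : pred I) (F : I -> 'rV[R]_n -> R) :
  (forall i, dderivable (F i)) -> dderivable (fun x => \prod_(i <- r | P i) F i x).
Proof.
move=> dF; elim: r => [|i r IH].
  by rewrite [X in dderivable X](_ : _ = (fun=> 1)) ?funeqE => [|x];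
    [exact: dderivable_cst|rewrite big_nil].
rewrite [X in dderivable X](_ : _ = (fun x =>
  if P i then F i x * \prod_(j <- r | P j) F j x else \prod_(j <- r | P j) F j x)).
  by case: (P i); [exact: dderivableM|exact: IH].
by apply/funext => x; rewrite big_cons.
Qed.

Lemma dderivable_det m (A : 'rV[R]_n -> 'M[R]_m) :
  (forall i j, dderivable (fun x => A x i j)) -> dderivable (fun x => \det (A x)).
Proof.
move=> dA; apply: dderivable_sum => s; apply: dderivableM; first exact: dderivable_cst.
by apply: dderivable_prod => i; exact: dA.
Qed.

Lemma dderivable_invmx m (A : 'rV[R]_n -> 'M[R]_m) i j :
  (\forall x \near x0, A x \in unitmx) ->
  (forall i j, dderivable (fun x => A x i j)) -> dderivable (fun x => invmx (A x) i j).
Proof.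
move=> uA dA.
(* Cramer's rule, available wherever [A x] is invertible. *)
apply: (@dderivable_near (fun x => (\det (A x))^-1 *
    ((-1) ^+ (j + i) * \det (row' j (col' i (A x)))))).
  by near=> x; rewrite /invmx (near uA x) // !mxE.
apply: dderivableM.
  apply: dderivableV; last exact: dderivable_det.
  by have := nbhs_singleton uA; rewrite unitmxE unitfE.
apply: dderivableM; first exact: dderivable_cst.
by apply: dderivable_det => k l; under eq_fun do rewrite !mxE; exact: dA.
Unshelve. all: by end_near. Qed.

(** Multilinearity expands the first moving argument in the coordinate basis, giving products of a
    coordinate with a value in which that argument is constant; [pre] collects the arguments already
    constant. *)
Lemma dderivable_args k (b : 'rV[R]_n -> seq 'rV[R]_n -> R)
    (Ys : seq ('rV[R]_n -> 'rV[R]_n)) (pre : seq 'rV[R]_n) :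
  (\forall x \near x0, multilin_alt k (b x)) ->
  (forall s, size s = k -> dderivable (fun x => b x s)) ->
  (forall i j, (i < size Ys)%N -> dderivable (fun x => nth (fun=> 0) Ys i x 0 j)) ->
  (size pre + size Ys)%N = k ->
  dderivable (fun x => b x (pre ++ [seq Y x | Y <- Ys])).
Proof.
move=> bP db; elim: Ys pre => [|Y Ys IH] pre dY sk.
  by under eq_fun do rewrite cats0; apply: db; rewrite -sk addn0.
apply: (@dderivable_near (fun x => \sum_j Y x 0 j *
    b x (rcons pre (delta_mx 0 j) ++ [seq Y x | Y <- Ys]))).
  near=> x; rewrite /= [in RHS](row_sum_delta (Y x)).
  rewrite (multilin_alt_sum (k := k)) ?size_map //; last by rewrite -sk addnS.
    by apply: eq_bigr => j _; rewrite cat_rcons.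
  exact: (near bP x).
apply: dderivable_sum => j; apply: dderivableM; first exact: (dY 0%N j).
apply: IH => [i l li|]; first exact: (dY i.+1 l).
by rewrite size_rcons addSn -sk addnS.
Unshelve. all: by end_near. Qed.

Lemma derive_shuf k l (a b : 'rV[R]_n -> seq 'rV[R]_n -> R) s v :
  size s = (k + l)%N ->
  (forall u, size u = k -> dderivable (fun x => a x u)) ->
  (forall u, size u = l -> dderivable (fun x => b x u)) ->
  is_derive x0 v (fun x => shuf k l (a x) (b x) s : R^o)
   (shuf k l (fun u => 'd[v] (fun x => a x u)) (b x0) s +
    shuf k l (a x0) (fun u => 'd[v] (fun x => b x u)) s).
Proof.
elim: s k l a b => [|w s IH] k l a b sk da db.
  move: sk da db; case: k => [|//]; case: l => [|//] _ da db /=.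
  apply: is_derive_eq; first by
    apply: is_deriveM; apply: derivableP; [exact: da|exact: db].
  by rewrite addrC mulrC.
rewrite /=.
pose Fl x : R^o := if k is k'.+1 then shuf k' l (a x \o cons w) (b x) s else 0.
pose Fr x : R^o := if l is l'.+1 then (-1) ^+ k * shuf k l' (a x) (b x \o cons w) s else 0.
have dl : is_derive x0 v Fl (
  (if k is k'.+1 then shuf k' l ((fun u => 'd[v] (fun x => a x u)) \o cons w) (b x0) s else 0) +
  (if k is k'.+1 then shuf k' l (a x0 \o cons w) (fun u => 'd[v] (fun x => b x u)) s else 0)).
  rewrite /Fl; case: k sk da {Fr Fl} => [|k] sk da.
    by rewrite addr0; exact: is_derive_cst.
  apply: (IH k l (fun x => a x \o cons w) b) => //; first by move: sk => [].
  by move=> u uk; apply: da; rewrite /= uk.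
have dr : is_derive x0 v Fr (
  (if l is l'.+1 then (-1) ^+ k * shuf k l' (fun u => 'd[v] (fun x => a x u)) (b x0 \o cons w) s else 0) +
  (if l is l'.+1 then (-1) ^+ k * shuf k l' (a x0) ((fun u => 'd[v] (fun x => b x u)) \o cons w) s else 0)).
  rewrite /Fr; case: l sk db {Fr Fl dl} => [|l] sk db.
    by rewrite addr0; exact: is_derive_cst.
  rewrite -mulrDr; apply: is_deriveZ.
  apply: (IH k l a (fun x => b x \o cons w)) => //; first by move: sk; rewrite addnS => -[].
  by move=> u uk; apply: db; rewrite /= uk.
by rewrite addrACA; exact: (is_deriveD dl dr).
Qed.

(** Acts on any family of functions on lists, so that shuffle products and local decompositions can
    be differentiated without being packaged as [kform]. *)
Definition ext_d_list (a : 'rV[R]_n -> seq 'rV[R]_n -> R) : seq 'rV[R]_n -> R :=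
  alt_sum (fun v u => 'd[v] (fun x => a x u)) [::].

Lemma ext_d_list_near (a b : 'rV[R]_n -> seq 'rV[R]_n -> R) k s : size s = k.+1 ->
  (forall u, size u = k -> \forall x \near x0, a x u = b x u) ->
  ext_d_list a s = ext_d_list b s.
Proof.
move=> sk ab; apply: (eq_alt_sum (k := k)) => // v u uk.
by apply: near_eq_derive; exact: ab.
Qed.

Section Leibniz.
Variables a b : 'rV[R]_n -> seq 'rV[R]_n -> R.

Lemma ext_d_list_shuf k l s : size s = (k + l).+1 ->
  (forall u, size u = k -> dderivable (fun x => a x u)) ->
  (forall u, size u = l -> dderivable (fun x => b x u)) ->
  ext_d_list (fun x => shuf k l (a x) (b x)) s =
  alt_sum (fun v u => shuf k l (fun u => 'd[v] (fun x => a x u)) (b x0) u +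
    shuf k l (a x0) (fun u => 'd[v] (fun x => b x u)) u) [::] s.
Proof.
move=> sk da db; apply: (eq_alt_sum (k := (k + l)%N)) => // v u uk.
exact: (derive_val (is_derive := derive_shuf _ _ _ _)).
Qed.

Lemma ext_d_listB k s : size s = k.+1 ->
  (forall u, size u = k -> dderivable (fun x => a x u)) ->
  (forall u, size u = k -> dderivable (fun x => b x u)) ->
  ext_d_list (fun x u => a x u - b x u) s = ext_d_list a s - ext_d_list b s.
Proof.
move=> sk da db; rewrite /ext_d_list.
rewrite (eq_alt_sum (k := k) (d' := fun v u => 'd[v] (fun x => a x u) - 'd[v] (fun x => b x u))) //.
  elim: s [::] {sk} => [|v s IH] pre /=; first by rewrite subr0.
  by rewrite IH; ring.
by move=> v u uk; apply: deriveB; [exact: da|exact: db].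
Qed.

Lemma ext_d_listZ (z : R) k s : size s = k.+1 ->
  (forall u, size u = k -> dderivable (fun x => a x u)) ->
  ext_d_list (fun x u => z * a x u) s = z * ext_d_list a s.
Proof.
move=> sk da; rewrite /ext_d_list.
rewrite (eq_alt_sum (k := k) (d' := fun v u => z * 'd[v] (fun x => a x u))) //.
  elim: s [::] {sk} => [|v s IH] pre /=; first by rewrite mulr0.
  by rewrite IH; ring.
by move=> v u uk; apply: (@deriveZ _ _ R^o); exact: da.
Qed.

End Leibniz.

End DirectionalDerivatives.

(** * The SU(3)-structure in an adapted frame *)

Definition eta_coefs : seq (seq nat * int) := [:: ([:: 0]%N, 1)].
Definition omega_coefs : seq (seq nat * int) :=
  [:: ([:: 1; 2]%N, 1); ([:: 3; 4]%N, 1); ([:: 5; 6]%N, 1)].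
Definition Re_coefs : seq (seq nat * int) :=
  [:: ([:: 1; 3; 5]%N, 1); ([:: 1; 4; 6]%N, -1); ([:: 2; 3; 6]%N, -1);
      ([:: 2; 4; 5]%N, -1)].
Definition Im_coefs : seq (seq nat * int) :=
  [:: ([:: 2; 4; 6]%N, -1); ([:: 2; 3; 5]%N, 1); ([:: 1; 4; 5]%N, 1);
      ([:: 1; 3; 6]%N, 1)].
Definition su3_vol_coefs : seq (seq nat * int) := [:: ([:: 1; 2; 3; 4; 5; 6]%N, 1)].

Section PointwiseSU3.
Context {R : realType}.

Lemma wedgeZl n k l (z : R) (a : mform R n k) (b : mform R n l) :
  wedgef (z *: a) b = z *: wedgef a b.
Proof.
apply/funext => V; rewrite /wedgef.
transitivity (z * ((k`! * l`!)%:R^-1 * \sum_(s : 'S_(k + l))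
  (-1) ^+ s * (a (usubmx (row_perm s V)) * b (dsubmx (row_perm s V))))) => //.
rewrite [RHS]mulrCA; congr (_ * _); rewrite mulr_sumr; apply: eq_bigr => s _.
rewrite [LHS](_ : _ = (-1) ^+ s * ((z * a (usubmx (row_perm s V))) *
  b (dsubmx (row_perm s V)))) //.
by rewrite [RHS]mulrCA -mulrA.
Qed.

Lemma hookZ n k (z : R) v (a : mform R n k.+1) : multilin_alt k.+1 (ev a) ->
  hook (z *: v) a = z *: hook v a.
Proof.
move=> aP; apply: ev_eq => s sk; rewrite ev_hook // -[RHS]/(z * ev (hook v a) s) ev_hook //.
have [lin _] := aP; have := lin [::] s v 0 z; rewrite /= addr0 add0n sk => ->//.
have := lin [::] s 0 0 (- 1); rewrite /= add0n sk scaler0 addr0 mulN1r addNr => ->//.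
by rewrite addr0.
Qed.

(** The arguments of the dual are passed on to [vol], so alternation is inherited from it term by
    term. *)
Lemma multilin_alt_hodge n k l (G : 'M[R]_n) (vol : mform R n (k + l)) (b : mform R n k) :
  multilin_alt (k + l) (ev vol) -> multilin_alt l (ev (hodge k l G vol b)).
Proof.
move=> vP; apply: multilin_altZ; apply: multilin_alt_big => f _; apply: multilin_altZ.
apply: (@eq_multilin_alt _ _ _ _ (fun s => ev vol (map (frame 1%:M) [seq val (f i) | i <- enum 'I_k] ++ s))).
  move=> s sl; rewrite rowsub_frame stack_col_mx //.
  by rewrite !size_map -enumT size_enum_ord.
by apply: (multilin_alt_catl vP); rewrite !size_map -enumT size_enum_ord.
Qed.

Lemma multilin_alt_flat n (G : 'M[R]_n) v : multilin_alt 1 (ev (flatv G v)).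
Proof.
split=> [[|? x] [|? y] u w z|x y u] //= _.
rewrite /ev /flatv /ip.
have stack1 (r : 'rV[R]_n) : stack 1 [:: r] = r by apply/rowP => j; rewrite mxE.
by rewrite !stack1 linearP mulmxDr -scalemxAr !mxE.
Qed.

Lemma ev_flat_frame n (G Q : 'M[R]_n) (i j : 'I_n) : Q *m G *m Q^T = 1%:M ->
  ev (flatv G (frame Q i)) [:: frame Q j] = (i == j)%:R.
Proof.
move=> QG; have -> : (i == j)%:R = (Q *m G *m Q^T) i j by rewrite QG mxE.
rewrite /ev /flatv /ip.
have -> : stack 1 [:: frame Q j] = frame Q j by apply/rowP => k; rewrite mxE.
by rewrite !frameE -row_mul !mxE; apply: eq_bigr => k _; rewrite !mxE.
Qed.

Variables (G : 'M[R]_7) (phi : mform R 7 3) (vol : mform R 7 7) (xi : 'rV[R]_7) (t : R).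
Let psi := hodge 3 4 G vol phi.
Let theta : mform R 7 1 := t ^- 2 *: flatv G xi.
Let omega : mform R 7 2 := t^-1 *: hook xi phi.
Let Im : mform R 7 3 := - (t^-1 *: hook xi psi).
Let Re : mform R 7 3 := phi - t *: wedgef theta omega.

(** As [xi = t E_0], each contraction with [xi] brings a factor [t] by which the definition divides;
    what remains is the standard SU(3)-structure on the span of [E_1, ..., E_6]. *)
Lemma su3_frame (Q : 'M[R]_7) : Q *m G *m Q^T = 1%:M ->
  int_form (frame Q) phi g2_coefs -> int_form (frame Q) vol vol_coefs ->
  xi = t *: frame Q 0 -> t != 0 ->
  [/\ int_form (frame Q) psi g2_coform_coefs,
      int_form (frame Q) (t *: theta) eta_coefs,
      int_form (frame Q) omega omega_coefs,
      int_form (frame Q) Re Re_coefs &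
      int_form (frame Q) Im Im_coefs].
Proof.
move=> QG phiQ volQ xiE t0.
have psiQ : int_form (frame Q) psi g2_coform_coefs.
  apply: (@int_form_hodge R 3 4 G Q vol phi vol_coefs g2_coefs _ QG volQ phiQ); first exact: (@multilin_alt_hodge 7 3 4 G vol phi volQ.1).
  by vm_compute.
have omQ : int_form (frame Q) omega omega_coefs.
  rewrite /omega xiE hookZ; last exact: phiQ.1.
  rewrite scalerA mulVf // scale1r.
  by apply: int_form_eq (int_form_hook (i := 0) isT phiQ) _; vm_compute.
have etaQ : int_form (frame Q) (t *: theta) eta_coefs.
  (* [t * t^-2 * t = 1]: one factor from [eta], one from [theta], one from [xi]. *)
  have -> : t *: theta = flatv G (frame Q 0).
    rewrite /theta xiE; apply/funext => V.
    rewrite -[LHS]/(t * (t ^- 2 * _)) /flatv /ip -!scalemxAl mxE.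
    by rewrite mulrCA [t * (t * _)]mulrA -expr2 mulrA mulVf ?mul1r // expf_neq0.
  split; first exact: multilin_alt_flat.
  move=> w; case: w => [|i [|j w]] wk; have := subseqs_tuples wk;
    rewrite mem_tuples //= andbT => i7.
  have := @ev_flat_frame _ _ _ ord0 (Ordinal i7) QG; rewrite /= => ->.
  by rewrite -val_eqE /= eq_sym; case: i i7 {wk} => [|i].
have imQ : int_form (frame Q) Im Im_coefs.
  rewrite /Im xiE hookZ; last exact: psiQ.1.
  rewrite scalerA mulVf // scale1r -scaleN1r.
  apply: (int_formZ (z := -1) _ (int_form_hook (i := 0) isT psiQ)).
    by rewrite mulrNN mul1r.
  by vm_compute.
split=> //; rewrite /Re -wedgeZl -scaleN1r.
apply: (int_formD phiQ).
  (* The table of [- eta /\ omega], which cancels the terms of [phi] that contain the index 0. *)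
  apply: (int_formZ (z := -1) (t' := [:: ([:: 0; 1; 2]%N, -1);
    ([:: 0; 3; 4]%N, -1); ([:: 0; 5; 6]%N, -1)]) _ (int_form_wedge etaQ omQ)).
    by rewrite mulrNN mul1r.
  by vm_compute.
by vm_compute.
Qed.

End PointwiseSU3.

(** * Decomposition and regularity near a point where [xi] does not vanish *)

Section CircleQuotient.
Context {R : realType} {M : manifold R 7} (S : g2_structure M) (xi : vfield M).
Hypothesis xi_vfield : is_vfield setT xi.

Local Notation phi := (g2_form S).
Local Notation g := (g2_metric S).
Local Notation vol := (g2_vol S).
Local Notation t := (orbit_norm S xi).
Local Notation theta := (conn_form S xi).
Local Notation omega := (su3_omega S xi).
Local Notation ImU := (su3_Im S xi).
Local Notation ReU := (su3_Re S xi).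

(** The definition evaluates in the chart [chart_at q]; the Jacobians by which the metric and [xi]
    change cancel in [ip]. *)
Lemma orbit_normE q (c : atlas M) : cdom c q ->
  t q = Num.sqrt (ip (g q c) (xi q c) (xi q c)).
Proof.
move=> qc; have [gS gP gJ gD] := g2_metric_is_metric S.
rewrite /orbit_norm; congr Num.sqrt; rewrite /ip.
rewrite (gJ _ _ _ qc (chart_atP q)).
rewrite (xi_vfield.1 _ _ _ I qc (chart_atP q)).
by rewrite trmx_mul !mulmxA.
Qed.

Lemma g2_adapted_frame q (c : atlas M) : cdom c q -> exists Q : 'M[R]_7,
  [/\ Q *m g q c *m Q^T = 1%:M, int_form (frame Q) (phi q c) g2_coefs,
      int_form (frame Q) (vol q c) vol_coefs & xi q c = t q *: frame Q 0].
Proof.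
move=> qc; have [[volA _ _] vol2] := g2_vol_is_volume_form S.
have [Q [h1 h2 h3 h4]] := adapted_frame (xi q c) (g2_form_nondegenerate S qc)
  (volA _ _ I qc) (vol2 _ _ qc) (g2_form_metric S qc).
by exists Q; split=> //; rewrite (orbit_normE qc).
Qed.

Lemma orbit_norm_neq0 q : nonfixed xi q -> t q != 0.
Proof.
apply: contraNneq => t0; have [Q [_ _ _ ->]] := g2_adapted_frame (chart_atP q).
by rewrite t0 scale0r.
Qed.

Lemma su3_adapted_frame q (c : atlas M) : cdom c q -> t q != 0 ->
  exists Q : 'M[R]_7,
  [/\ Q *m g q c *m Q^T = 1%:M, int_form (frame Q) (phi q c) g2_coefs,
      int_form (frame Q) (vol q c) vol_coefs & xi q c = t q *: frame Q 0] /\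
  [/\ int_form (frame Q) (g2_coform S q c) g2_coform_coefs,
      int_form (frame Q) (t q *: theta q c) eta_coefs,
      int_form (frame Q) (omega q c) omega_coefs,
      int_form (frame Q) (ReU q c) Re_coefs &
      int_form (frame Q) (ImU q c) Im_coefs].
Proof.
move=> qc t0; have [Q [h1 h2 h3 h4]] := g2_adapted_frame qc.
by exists Q; split=> //; exact: su3_frame.
Qed.

(** Both sides have the same integer table in an adapted frame at [q]. The frame does not appear in
    the statement, which can therefore be differentiated in [q]. *)
Lemma coform_decomposition q (c : atlas M) s : cdom c q -> t q != 0 -> size s = 4%N ->
  ev (g2_coform S q c) s =
    2^-1 * shuf 2 2 (ev (omega q c)) (ev (omega q c)) s -
    shuf 1 3 (ev (t q *: theta q c)) (ev (ImU q c)) s.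
Proof.
move=> qc t0 s4; have [Q [[QG _ _ _] [psiQ etaQ omQ _ imQ]]] := su3_adapted_frame qc t0.
rewrite -!ev_wedge //; try by [exact: omQ.1|exact: etaQ.1|exact: imQ.1].
pose b : mform R 7 4 := (2%:R^-1 : R) *: wedgef (omega q c) (omega q c) +
  (- 1 : R) *: wedgef (t q *: theta q c) (ImU q c).
have bQ : int_form (frame Q) b g2_coform_coefs.
  apply: int_formD.
  - apply: (int_formZ (z := 2) (t' := [:: ([:: 3; 4; 5; 6]%N, 1);
      ([:: 1; 2; 5; 6]%N, 1); ([:: 1; 2; 3; 4]%N, 1)]) _ (int_form_wedge omQ omQ)).
      by rewrite mulVf // pnatr_eq0.
    by vm_compute.
  - apply: (int_formZ (z := - 1) (t' := [:: ([:: 0; 2; 4; 6]%N, 1);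
      ([:: 0; 2; 3; 5]%N, -1); ([:: 0; 1; 4; 5]%N, -1); ([:: 0; 1; 3; 6]%N, -1)])
      _ (int_form_wedge etaQ imQ)).
      by rewrite mulrNN mul1r.
    by vm_compute.
  - by vm_compute.
have [uQ _] := invmx_orthonormal QG.
transitivity (ev b s); last by rewrite /ev /b -[LHS]/(_ * _ + -1 * _) mulN1r.
apply: (eq_multilin_alt_frame psiQ.1 bQ.1 (frame_gen uQ)) => // w wk.
by rewrite psiQ.2 // bQ.2.
Qed.

Section AtPoint.
Variables (p : M) (c : atlas M).
Hypotheses (p_nonfixed : nonfixed xi p) (p_c : cdom c p).
Let x0 := ccoord c p.
Local Notation F := (cparam c).
Local Notation dderiv := (dderivable x0).

Lemma param_coord : F x0 = p. Proof. exact: ccoordK. Qed.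

Lemma near_cdom : \forall x \near x0, cdom c (F x).
Proof.
have : nbhs x0 (cimg c) by apply: open_nbhs_nbhs; split;
  [exact: open_cimg|exact: coord_cimg].
by apply: filterS => x; exact: param_cdom.
Qed.

Let smooth_deriv (f : 'rV[R]_7 -> R) : smooth_on (chart_region c setT) f ->
  differentiable (f : 'rV[R]_7 -> R^o) x0.
Proof. by move=> /(_ [::] x0); apply; split=> //; exact: coord_cimg. Qed.

Let diff_dderiv (f : 'rV[R]_7 -> R) : differentiable (f : 'rV[R]_7 -> R^o) x0 ->
  dderiv f.
Proof. by move=> df v; exact: diff_derivable. Qed.

Lemma differentiable_metric i j :
  differentiable ((fun x => g (F x) c i j) : 'rV[R]_7 -> R^o) x0.
Proof.
have [_ _ _ gD] := g2_metric_is_metric S.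
by apply: (gD c i j [::] x0); exact: coord_cimg.
Qed.

Lemma differentiable_xi j :
  differentiable ((fun x => xi (F x) c 0 j) : 'rV[R]_7 -> R^o) x0.
Proof. exact/smooth_deriv/xi_vfield.2. Qed.

Lemma dderivable_form k (a : kform M k) s : is_kform setT a ->
  dderiv (fun x => ev (a (F x) c) s).
Proof. by case=> _ _ aD; apply/diff_dderiv/smooth_deriv/aD. Qed.

Let norm2 x : R := ip (g (F x) c) (xi (F x) c) (xi (F x) c).

Let differentiable_norm2 : differentiable (norm2 : 'rV[R]_7 -> R^o) x0.
Proof.
rewrite (_ : norm2 = fun x => \sum_j (\sum_i xi (F x) c 0 i * g (F x) c i j) * xi (F x) c 0 j).
  rewrite (_ : (fun x => _) = \sum_j (fun x => (\sum_i xi (F x) c 0 i * g (F x) c i j) * xi (F x) c 0 j)).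
    apply: differentiable_sum => j; apply: differentiableM; last exact: differentiable_xi.
    rewrite (_ : (fun x => _) = \sum_i (fun x => xi (F x) c 0 i * g (F x) c i j)).
      apply: differentiable_sum => i; apply: differentiableM.
        exact: differentiable_xi.
      exact: differentiable_metric.
    by apply/funext => x; rewrite fct_sumE.
  by apply/funext => x; rewrite fct_sumE.
by apply/funext => x; rewrite /norm2 /ip mxE; apply: eq_bigr => j _; rewrite !mxE.
Qed.

Let norm2_gt0 : 0 < norm2 x0.
Proof.
have := orbit_norm_neq0 p_nonfixed; rewrite (orbit_normE p_c) => t0.
rewrite /norm2 param_coord.
by rewrite lt_neqAle eq_sym; move: t0; rewrite sqrtr_eq0 -ltNge => /[dup] ? /ltW ->; rewrite gt_eqF.
Qed.

Let norm x : R := Num.sqrt (norm2 x).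

Let norm_near : \forall x \near x0, norm x = t (F x).
Proof.
by apply: filterS near_cdom => x xc; rewrite (orbit_normE xc).
Qed.

Let differentiable_norm : differentiable (norm : 'rV[R]_7 -> R^o) x0.
Proof.
apply: (differentiable_comp (f := norm2 : 'rV[R]_7 -> R^o)) => //.
by apply/derivable1_diffP; apply: ex_derive; exact: is_derive1_sqrt.
Qed.

Lemma dderivable_orbit_norm : dderiv (fun x => t (F x)).
Proof. exact: dderivable_near norm_near (diff_dderiv differentiable_norm). Qed.

Lemma near_orbit_norm_neq0 : \forall x \near x0, t (F x) != 0.
Proof.
have n0 : norm x0 != 0 by rewrite gt_eqF // sqrtr_gt0.
have /cvgr_neq0/(_ n0) : (norm : 'rV[R]_7 -> R^o) x @[x --> x0] --> norm x0.
  exact: differentiable_continuous.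
by apply: filterS2 norm_near => x <-.
Qed.

(** The norm is differentiable as a composition, and its differential is linear in [v]; derivatives
    along single directions would not show that [d ln t] is a 1-form. *)
Lemma orbit_norm_derive : exists L : {linear 'rV[R]_7 -> R^o},
  forall v, 'D_v ((fun x => t (F x)) : 'rV[R]_7 -> R^o) x0 = L v /\
    dfun (fun q => ln (t q)) p c v = (t p)^-1 * L v.
Proof.
exists ('d (norm : 'rV[R]_7 -> R^o) x0) => v.
have e1 : 'D_v ((fun x => t (F x)) : 'rV[R]_7 -> R^o) x0 = 'D_v (norm : 'rV[R]_7 -> R^o) x0.
  by apply: near_eq_derive; apply: filterS norm_near => x ->.
have n0 : 0 < norm x0 by rewrite sqrtr_gt0.
have dln : is_derive (norm x0 : R^o) 1 (@ln R : R^o -> R^o) (norm x0)^-1.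
  exact: is_derive1_ln.
have lnD : differentiable (@ln R : R^o -> R^o) (norm x0).
  by apply/derivable1_diffP; apply: ex_derive.
split; first by rewrite e1 deriveE.
rewrite /dfun (near_eq_derive (g := (@ln R \o norm) : 'rV[R]_7 -> R^o)); last first.
  by apply: filterS norm_near => x /= ->.
rewrite deriveE; last exact: differentiable_comp.
rewrite (@diff_comp _ _ R^o R^o) //= (@deriv1E _ R^o); last exact: ex_derive.
rewrite derive1E derive_val /= -[LHS]/(_ * _) mulrC; congr (_^-1 * _).
by rewrite /norm /norm2 param_coord -orbit_normE.
Qed.

Lemma near_multilin_form k (a : kform M k) : is_kform setT a ->
  \forall x \near x0, multilin_alt k (ev (a (F x) c)).
Proof.
move=> [aA _ _]; apply: filterS near_cdom => x xc.
by apply: multilin_alt_ev; exact: aA.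
Qed.

Lemma dderivable_hook_xi k (b : 'rV[R]_7 -> seq 'rV[R]_7 -> R) s :
  (\forall x \near x0, multilin_alt k.+1 (b x)) ->
  (forall s, size s = k.+1 -> dderiv (fun x => b x s)) ->
  size s = k -> dderiv (fun x => b x (xi (F x) c :: s)).
Proof.
move=> bP db sk.
pose Ys := (fun x => xi (F x) c) :: [seq (fun=> v) | v <- s].
rewrite (_ : (fun x => _) = fun x => b x ([::] ++ [seq Y x | Y <- Ys])).
  apply: (@dderivable_args _ _ _ k.+1) => //; last by rewrite /= size_map sk.
  move=> [|i] j ij /=; first exact/diff_dderiv/differentiable_xi.
  rewrite (nth_map 0); last by move: ij; rewrite /= size_map.
  exact: dderivable_cst.
by apply/funext => x /=; rewrite -map_comp; congr (b x (_ :: _)); rewrite map_id.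
Qed.

Lemma dderivable_norm_inv : dderiv (fun x => (t (F x))^-1).
Proof.
apply: dderivableV; last exact: dderivable_orbit_norm.
by rewrite param_coord orbit_norm_neq0.
Qed.

Lemma dderivable_omega s : size s = 2%N -> dderiv (fun x => ev (omega (F x) c) s).
Proof.
move=> s2; rewrite (_ : (fun x => _) = fun x => (t (F x))^-1 *
    ev (phi (F x) c) (xi (F x) c :: s)).
  apply: dderivableM; first exact: dderivable_norm_inv.
  apply: (@dderivable_hook_xi 2 (fun x => ev (phi (F x) c))) => // [|u u3].
    exact/near_multilin_form/g2_form_is_kform.
  exact/dderivable_form/g2_form_is_kform.
by apply/funext => x; rewrite -ev_hook.
Qed.

Lemma dderivable_theta s : size s = 1%N -> dderiv (fun x => ev (theta (F x) c) s).
Proof.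
case: s => [|v []] // _.
rewrite (_ : (fun x => _) = fun x => ((t (F x))^-1 * (t (F x))^-1) *
    \sum_j (\sum_i xi (F x) c 0 i * g (F x) c i j) * v 0 j).
  apply: dderivableM; first by apply: dderivableM; exact: dderivable_norm_inv.
  apply: dderivable_sum => j; apply: dderivableM; last exact: dderivable_cst.
  apply: dderivable_sum => i; apply: dderivableM; apply: diff_dderiv.
    exact: differentiable_xi.
  exact: differentiable_metric.
apply/funext => x; rewrite /ev -[LHS]/(_ * _) -invfM -expr2; congr (_ * _).
rewrite /flatv /ip mxE; apply: eq_bigr => j _.
by rewrite !mxE; congr (_ * _).
Qed.

Lemma near_metric_unit : \forall x \near x0, g (F x) c \in unitmx.
Proof.
apply: filterS near_cdom => x xc; have [Q [QG _ _ _]] := g2_adapted_frame xc.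
by move: QG; rewrite -mulmxA => /mulmx1C; rewrite -mulmxA => /mulmx1_unit[].
Qed.

Lemma dderivable_coform s : size s = 4%N -> dderiv (fun x => ev (g2_coform S (F x) c) s).
Proof.
move=> s4; apply: dderivableM; first exact: dderivable_cst.
apply: dderivable_sum => f; apply: dderivableM.
  (* In the Hodge dual the vectors raised by the inverse metric move with [x]; those fed to [vol]
     are constant. *)
  pose Ys := [seq (fun x => frame (invmx (g (F x) c)) (f i)) | i <- enum 'I_3].
  rewrite (_ : (fun x => _) = fun x => ev (phi (F x) c) ([::] ++ [seq Y x | Y <- Ys])).
    apply: (@dderivable_args _ _ x0 3 (fun x => ev (phi (F x) c)) Ys [::]).
    - exact/near_multilin_form/g2_form_is_kform.
    - by move=> u _; exact/dderivable_form/g2_form_is_kform.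
    - rewrite size_map => i j i3; rewrite (nth_map ord0) //.
      rewrite (_ : (fun x => _) = fun x => invmx (g (F x) c) (f (nth ord0 (enum 'I_3) i)) j).
        apply: (@dderivable_invmx _ _ _ 7 (fun x => g (F x) c)); first exact: near_metric_unit.
        by move=> k l; exact/diff_dderiv/differentiable_metric.
      by apply/funext => x; rewrite frameE mxE.
    - by rewrite size_map size_enum_ord.
  by apply/funext => x; rewrite rowsub_frame /Ys /= -!map_comp.
rewrite (_ : (fun x => _) = fun x => ev (vol (F x) c)
   (map (frame 1%:M) [seq val (f i) | i <- enum 'I_3] ++ s)).
  by apply/dderivable_form; case: (g2_vol_is_volume_form S).
apply/funext => x; rewrite rowsub_frame stack_col_mx //.
by rewrite !size_map -enumT size_enum_ord.
Qed.

Lemma dderivable_ImU s : size s = 3%N -> dderiv (fun x => ev (ImU (F x) c) s).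
Proof.
move=> s3; rewrite (_ : (fun x => _) = fun x => - 1 * ((t (F x))^-1 *
    ev (g2_coform S (F x) c) (xi (F x) c :: s))).
  apply: dderivableM; first exact: dderivable_cst.
  apply: dderivableM; first exact: dderivable_norm_inv.
  apply: (@dderivable_hook_xi 3 (fun x => ev (g2_coform S (F x) c))) => // [|u u4].
    apply: filterS near_cdom => x xc; apply: (@multilin_alt_hodge _ 7 3 4).
    by apply: multilin_alt_ev; case: (g2_vol_is_volume_form S) => -[+ _ _] _; apply.
  exact: dderivable_coform.
by apply/funext => x; rewrite -ev_hook // mulN1r.
Qed.

Lemma ev_ext_d k (a : kform M k) s : size s = k.+1 ->
  ev (ext_d a p c) s = ext_d_list x0 (fun x => ev (a (F x) c)) s.
Proof.
move=> sk; rewrite /ext_d_list (alt_sumE _ 0) /ev /ext_d sk.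
apply: eq_bigr => i _; rewrite row_stack.
suff -> : row' i (stack k.+1 s) = stack k (take i s ++ drop i.+1 s) by [].
apply/row_matrixP => j.
rewrite row_rowsub !row_stack nth_cat size_takel ?sk //= /bump; last exact: ltnW.
case: (leqP i j) => ji; last by rewrite add0n ?ji nth_take.
by rewrite nth_drop addSn subnKC // add1n.
Qed.

End AtPoint.

End CircleQuotient.

(** * Exterior derivatives of [phi] and of its dual *)

Section ExteriorDerivatives.
Context {R : realType} {M : manifold R 7} (S : g2_structure M) (xi : vfield M).
Hypothesis xi_vfield : is_vfield setT xi.
Variables (p : M) (c : atlas M).
Hypotheses (p_nonfixed : nonfixed xi p) (p_c : cdom c p).

Local Notation phi := (g2_form S).
Local Notation t := (orbit_norm S xi).
Local Notation theta := (conn_form S xi).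
Local Notation omega := (su3_omega S xi).
Local Notation ImU := (su3_Im S xi).
Local Notation ReU := (su3_Re S xi).
Local Notation x0 := (ccoord c p).
Local Notation F := (cparam c).
Local Notation D v f := ('D_v (f : 'rV[R]_7 -> R^o) x0).
Local Notation eta := (fun q => (t q *: theta q c : mform R 7 1)).

Let xp : F x0 = p. Proof. exact: param_coord. Qed.

Lemma dderivable_eta s : size s = 1%N -> dderivable x0 (fun x => ev (eta (F x)) s).
Proof.
move=> s1; apply: dderivableM; first exact: dderivable_orbit_norm.
exact: dderivable_theta.
Qed.

(** The last bracket is [dt /\ theta] on [u] and [v]. Keeping [d theta] apart lets the curvature be
    substituted for it. *)
Lemma ext_d_eta u v :
  ext_d_list x0 (fun x => ev (eta (F x))) [:: u; v] =
  t p * ev (ext_d theta p c) [:: u; v] +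
  (D u (fun x => t (F x)) * ev (theta p c) [:: v] -
   D v (fun x => t (F x)) * ev (theta p c) [:: u]).
Proof.
have dE w z : D w (fun x => ev (eta (F x)) [:: z]) =
    t p * D w (fun x => ev (theta (F x) c) [:: z]) +
    D w (fun x => t (F x)) * ev (theta p c) [:: z].
  rewrite -[LHS]/(D w ((fun x => t (F x)) * (fun x => ev (theta (F x) c) [:: z]))).
  rewrite deriveM; last 2 first.
  - exact: dderivable_orbit_norm.
  - exact: dderivable_theta.
  by rewrite xp -[_ *: _]/(_ * _) -[X in _ + X]/(_ * _) [X in _ + X]mulrC.
rewrite (ev_ext_d _ _ (k := 1)) // /ext_d_list /= !dE.
move: (D u _) (D v _) (D u _) (D v _) => a b d e; ring.
Qed.

(** [Re] is by definition [phi - eta /\ omega]; this is the derivative of that definition, solved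
    for [d phi]. *)
Lemma ext_d_phi s : size s = 4%N ->
  ev (ext_d phi p c) s =
  shuf 2 2 (ext_d_list x0 (fun x => ev (eta (F x)))) (ev (omega p c)) s
  - shuf 1 3 (ev (eta p)) (ev (ext_d omega p c)) s + ev (ext_d ReU p c) s.
Proof.
move=> s4; rewrite !(ev_ext_d _ _ (k := 3)) //.
pose b x := shuf 1 2 (ev (eta (F x))) (ev (omega (F x) c)).
have db u : size u = 3%N -> dderivable x0 (fun x => b x u).
  by move=> u3 v; apply: ex_derive; apply: (derive_shuf (k := 1) (l := 2)) => // w w1;
    [exact: dderivable_eta|exact: dderivable_omega].
have dphi u : size u = 3%N -> dderivable x0 (fun x => ev (phi (F x) c) u).
  by move=> _; exact/dderivable_form/g2_form_is_kform.
have -> : ext_d_list x0 (fun x => ev (ReU (F x) c)) s =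
    ext_d_list x0 (fun x u => ev (phi (F x) c) u - b x u) s.
  apply: (ext_d_list_near s4) => u u3.
  have nc := near_cdom p_c.
  have nt := near_orbit_norm_neq0 S xi_vfield p_nonfixed p_c.
  near=> x; have xc : cdom c (F x) by exact: (near nc x).
  have tx0 : t (F x) != 0 by exact: (near nt x).
  (* The shuffle formula for the wedge needs [eta] and [omega] to be alternating at [F x]; an
     adapted frame there provides this. *)
  have [Q [_ [_ etaQ omQ _ _]]] := su3_adapted_frame xi_vfield xc tx0.
  rewrite /b -(ev_wedge etaQ.1 omQ.1) // wedgeZl //.
rewrite (ext_d_listB s4 dphi db) (ext_d_list_shuf (k := 1) (l := 2)) //; last 2 first.
- exact: dderivable_eta.
- exact: dderivable_omega.
rewrite alt_sum_shuf12 // !xp.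
have -> : shuf 1 3 (ev (eta p)) (ev (ext_d omega p c)) s =
    shuf 1 3 (ev (eta p)) (alt_sum (fun v u => D v (fun x => ev (omega (F x) c) u)) [::]) s.
  by apply: eq_shuf => // w w3; rewrite (ev_ext_d _ _ (k := 2)).
rewrite -/(ext_d_list _ _); ring.
Unshelve. all: by end_near. Qed.

(** The factor 1/2 of [omega^2] cancels the 2 in [d(omega^2) = 2 d omega /\ omega]; the last two
    terms are [- d(eta /\ Im)]. *)
Lemma ext_d_coform s : size s = 5%N ->
  ev (ext_d (g2_coform S) p c) s =
  shuf 3 2 (ev (ext_d omega p c)) (ev (omega p c)) s
  - shuf 2 3 (ext_d_list x0 (fun x => ev (eta (F x)))) (ev (ImU p c)) s
  + shuf 1 4 (ev (eta p)) (ev (ext_d ImU p c)) s.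
Proof.
move=> s5; rewrite !(ev_ext_d _ _ (k := 4)) //.
pose a x := shuf 2 2 (ev (omega (F x) c)) (ev (omega (F x) c)).
pose b x := shuf 1 3 (ev (eta (F x))) (ev (ImU (F x) c)).
have da u : size u = 4%N -> dderivable x0 (fun x => a x u).
  by move=> u4 v; apply: ex_derive; apply: (derive_shuf (k := 2) (l := 2)) => // w w1;
    exact: dderivable_omega.
have db u : size u = 4%N -> dderivable x0 (fun x => b x u).
  by move=> u4 v; apply: ex_derive; apply: (derive_shuf (k := 1) (l := 3)) => // w w1;
    [exact: dderivable_eta|exact: dderivable_ImU].
have -> : ext_d_list x0 (fun x => ev (g2_coform S (F x) c)) s =
    ext_d_list x0 (fun x u => 2^-1 * a x u - b x u) s.
  apply: (ext_d_list_near s5) => u u4.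
  have nc := near_cdom p_c.
  have nt := near_orbit_norm_neq0 S xi_vfield p_nonfixed p_c.
  near=> x; have xc : cdom c (F x) by exact: (near nc x).
  have tx0 : t (F x) != 0 by exact: (near nt x).
  exact: coform_decomposition.
rewrite (ext_d_listB s5 _ db) => [|u u4]; last first.
  by apply: dderivableM; [exact: dderivable_cst|exact: da].
rewrite (ext_d_listZ _ s5 da).
rewrite (ext_d_list_shuf (k := 2) (l := 2)) //; try exact: dderivable_omega.
rewrite (ext_d_list_shuf (k := 1) (l := 3)) //; last 2 first.
- exact: dderivable_eta.
- exact: dderivable_ImU.
rewrite alt_sum_shuf13 // xp alt_sum_shuf22 //.
have -> : shuf 1 4 (ev (eta p)) (ev (ext_d ImU p c)) s =
    shuf 1 4 (ev (eta p)) (alt_sum (fun v u => D v (fun x => ev (ImU (F x) c) u)) [::]) s.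
  by apply: eq_shuf => // w w4; rewrite (ev_ext_d _ _ (k := 3)).
have -> : shuf 3 2 (ev (ext_d omega p c)) (ev (omega p c)) s =
    shuf 3 2 (alt_sum (fun v u => D v (fun x => ev (omega (F x) c) u)) [::]) (ev (omega p c)) s.
  by apply: eq_shuf => // w w3; rewrite (ev_ext_d _ _ (k := 2)).
rewrite mulrA mulVf ?pnatr_eq0 // mul1r opprB addrA -/(ext_d_list _ _); ring.
Unshelve. all: by end_near. Qed.

End ExteriorDerivatives.

(** * Invariance of the norm of [xi] *)

Section InvariantNorm.
Context {R : realType} {M : manifold R 7} (S : g2_structure M) (xi : vfield M).
Hypothesis xi_vfield : is_vfield setT xi.
Variables (p : M) (c : atlas M).
Hypotheses (p_nonfixed : nonfixed xi p) (p_c : cdom c p).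

Local Notation phi := (g2_form S).
Local Notation t := (orbit_norm S xi).
Local Notation omega := (su3_omega S xi).
Local Notation x0 := (ccoord c p).
Local Notation F := (cparam c).
Local Notation D v f := ('D_v (f : 'rV[R]_7 -> R^o) x0).

Let xp : F x0 = p. Proof. exact: param_coord. Qed.

(** The inserted vector [xi] moves along with the form, and its derivative contributes the last
    term. Expanding it in the coordinate basis reduces this to the product rule for numbers. *)
Lemma derive_hook_xi k (b : 'rV[R]_7 -> seq 'rV[R]_7 -> R) s w :
  (\forall x \near x0, multilin_alt k.+1 (b x)) ->
  (forall s, size s = k.+1 -> dderivable x0 (fun x => b x s)) ->
  size s = k ->
  D w (fun x => b x (xi (F x) c :: s)) =
  D w (fun x => b x (xi p c :: s)) + b x0 (dvfield xi p c w :: s).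
Proof.
move=> bP db sk.
have dxi j : derivable ((fun x => xi (F x) c 0 j) : 'rV[R]_7 -> R^o) x0 w.
  by apply: diff_derivable; exact: differentiable_xi.
have dbe (j : 'I_7) : derivable ((fun x => b x (delta_mx 0 j :: s)) : 'rV[R]_7 -> R^o) x0 w.
  by apply: db; rewrite /= sk.
have expand x (v : 'rV[R]_7) : multilin_alt k.+1 (b x) ->
    b x (v :: s) = \sum_j v 0 j * b x (delta_mx 0 j :: s).
  move=> bx; rewrite {1}(row_sum_delta v).
  by apply: (multilin_alt_sum (x := [::]) _ _ bx); rewrite add0n sk.
have e1 : is_derive x0 w ((fun x => b x (xi (F x) c :: s)) : 'rV[R]_7 -> R^o)
    (\sum_j (xi p c 0 j * D w (fun x => b x (delta_mx 0 j :: s)) +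
      b x0 (delta_mx 0 j :: s) * D w (fun x => xi (F x) c 0 j))).
  apply: (@near_eq_is_derive _ _ _ (\sum_j (fun x => xi (F x) c 0 j * b x (delta_mx 0 j :: s)))).
    near=> x; rewrite fct_sumE (expand x (xi (F x) c)) //; exact: (near bP x).
  apply: is_derive_sum => j.
  by have := is_deriveM (derivableP (dxi j)) (derivableP (dbe j)); rewrite xp.
have e2 : is_derive x0 w ((fun x => b x (xi p c :: s)) : 'rV[R]_7 -> R^o)
    (\sum_j xi p c 0 j * D w (fun x => b x (delta_mx 0 j :: s))).
  apply: (@near_eq_is_derive _ _ _ (\sum_j (fun x => xi p c 0 j * b x (delta_mx 0 j :: s)))).
    near=> x; rewrite fct_sumE (expand x (xi p c)) //; exact: (near bP x).
  apply: is_derive_sum => j; apply: (@is_deriveZ _ _ R^o); exact: derivableP.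
rewrite (derive_val (is_derive := e1)) (derive_val (is_derive := e2)) big_split /=.
congr (_ + _); rewrite expand; last exact: nbhs_singleton bP.
apply: eq_bigr => j _; rewrite mulrC; congr (_ * _).
rewrite /dvfield derive_mx ?mxE //.
apply/derivable_mxP => i l; rewrite ord1; apply: diff_derivable; exact: differentiable_xi.
Unshelve. all: by end_near. Qed.

(** With Lie derivatives written in coordinates, those of [omega] and of [t omega] share the terms
    containing derivatives of [xi]; their comparison leaves [xi(t) omega], tested on [E_1, E_2],
    where [omega] is 1. *)
Lemma orbit_norm_invariant : lie_kform xi phi p c = 0 ->
  hook (xi p c) (ext_d omega p c) = 0 -> D (xi p c) (fun x => t (F x)) = 0.
Proof.
move=> lie_phi hook_domega.
have tp0 := orbit_norm_neq0 S xi_vfield p_nonfixed.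
have phiA := near_multilin_form p_c (g2_form_is_kform S).
have phiA0 := nbhs_singleton phiA; rewrite xp in phiA0.
have dphi s : size s = 3%N -> dderivable x0 (fun x => ev (phi (F x) c) s).
  by move=> _; exact/dderivable_form/g2_form_is_kform.
have domega s : size s = 2%N -> dderivable x0 (fun x => ev (omega (F x) c) s).
  exact: dderivable_omega.
have omA : \forall x \near x0, multilin_alt 2 (ev (omega (F x) c)).
  near=> x; apply: multilin_altZ; apply: multilin_alt_hook; exact: (near phiA x).
have omA0 := nbhs_singleton omA; rewrite xp in omA0.
have phiE q u v : ev (omega q c) [:: u; v] = (t q)^-1 * ev (phi q c) [:: xi q c; u; v].
  by rewrite -(@ev_hook _ _ 2 (xi q c) (phi q c) [:: u; v] erefl).
(* This differentiates [omega(xi, v) = 0], which holds near the point. *)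
have om_xi w v : D w (fun x => ev (omega (F x) c) [:: xi p c; v]) =
    - ev (omega p c) [:: dvfield xi p c w; v].
  have := derive_hook_xi (s := [:: v]) w omA domega erefl; rewrite xp => h.
  apply/eqP; rewrite -addr_eq0 -h; apply/eqP => {h}.
  rewrite (near_eq_derive (g := cst 0)) ?derive_cst //.
  near=> x; rewrite phiE; have [_ alt] : multilin_alt 3 (ev (phi (F x) c)) by exact: (near phiA x).
  by rewrite (alt [::]) // mulr0.
(* The vanishing of the Lie derivative of [omega] along [xi], obtained from [xi -| d omega = 0] by
   the preceding identity. *)
have d_omega u v : D (xi p c) (fun x => ev (omega (F x) c) [:: u; v]) =
    - ev (omega p c) [:: dvfield xi p c u; v] + ev (omega p c) [:: dvfield xi p c v; u].
  have := congr1 (fun a => ev a [:: u; v]) hook_domega.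
  rewrite /= ev_hook // (ev_ext_d _ _ (k := 2)) // /ext_d_list /= !om_xi => h.
  apply/eqP; rewrite -subr_eq0; apply/eqP; rewrite -[RHS]/(ev (0 : mform R 7 2) [:: u; v]) -h.
  ring.
have lie_phi3 u v : D (xi p c) (fun x => ev (phi (F x) c) [:: xi p c; u; v]) =
    - (ev (phi p c) [:: dvfield xi p c (xi p c); u; v] +
       ev (phi p c) [:: xi p c; dvfield xi p c u; v] +
       ev (phi p c) [:: xi p c; u; dvfield xi p c v]).
  have /eqP := congr1 (fun a => a (stack 3 [:: xi p c; u; v])) lie_phi.
  rewrite /lie_kform -[X in _ == X]/(0 : R) addr_eq0 => /eqP ->; congr (- _).
  rewrite (eq_bigr (fun i : 'I_3 => ev (phi p c) (set_nth 0 [:: xi p c; u; v] i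
      (dvfield xi p c (nth 0 [:: xi p c; u; v] i))))) => [|i _].
    rewrite !big_ord_recl big_ord0 addr0 [RHS](esym (addrA _ _ _)); reflexivity.
  congr (phi p c _); apply/matrixP => r j; rewrite !mxE nth_set_nth /= row_stack.
  by rewrite -val_eqE /=; case: ifP.
(* The product rule for [t omega = xi -| phi], an equality near the point. *)
have d_tomega u v : D (xi p c) (fun x => t (F x)) * ev (omega p c) [:: u; v] +
    t p * D (xi p c) (fun x => ev (omega (F x) c) [:: u; v]) =
    D (xi p c) (fun x => ev (phi (F x) c) [:: xi p c; u; v]) +
    ev (phi p c) [:: dvfield xi p c (xi p c); u; v].
  have := derive_hook_xi (s := [:: u; v]) (xi p c) phiA dphi erefl; rewrite xp => <-.
  rewrite (near_eq_derive (f := fun x => ev (phi (F x) c) [:: xi (F x) c; u; v])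
    (g := (fun x => t (F x)) * (fun x => ev (omega (F x) c) [:: u; v]))).
    rewrite [RHS]deriveM; [|exact: dderivable_orbit_norm|exact: domega].
    rewrite xp; move: (D _ (fun x => t (F x))) (D _ (fun x => ev (omega (F x) c) _)) => a b.
    rewrite addrC [a * _]mulrC; reflexivity.
  have nt := near_orbit_norm_neq0 S xi_vfield p_nonfixed p_c.
  near=> x; rewrite -[RHS]/(t (F x) * ev (omega (F x) c) [:: u; v]) phiE mulrA mulfV ?mul1r //.
  exact: (near nt x).
have [Q [_ [_ _ omQ _ _]]] := su3_adapted_frame xi_vfield p_c tp0.
have := d_tomega (frame Q 1) (frame Q 2).
have -> : ev (omega p c) [:: frame Q 1; frame Q 2] = 1.
  by have := omQ.2 [:: 1; 2]%N isT.
rewrite lie_phi3 d_omega.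
have tom a b : ev (phi p c) [:: xi p c; a; b] = t p * ev (omega p c) [:: a; b].
  by rewrite phiE mulrA mulfV ?mul1r.
rewrite !tom mulr1.
have := multilin_alt_swap (frame Q 1) (dvfield xi p c (frame Q 2)) omA0 (x := [::]) (y := [::]) erefl.
rewrite /= => ->; move: (D _ _) (ev (phi p c) _) => d a /eqP.
rewrite -subr_eq0 => /eqP h; rewrite -[RHS]h; ring.
Unshelve. all: by end_near. Qed.

End InvariantNorm.

(** * Wedges and contractions as linear combinations of components *)

Section Splits.
Implicit Types (t : seq (seq nat * int)) (w u : seq nat).

(** The shuffles of [w], listed with their signs. Against a form with an integer table the shuffle
    sum becomes a short linear combination of the components of the other factor. *)
Fixpoint splits k l w : seq (int * (seq nat * seq nat)) :=
  if w is i :: w' then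
    (if k is k'.+1 then
       [seq (p.1, (i :: p.2.1, p.2.2)) | p <- splits k' l w'] else [::]) ++
    (if l is l'.+1 then
       [seq ((-1) ^+ k * p.1, (p.2.1, i :: p.2.2)) | p <- splits k l' w'] else [::])
  else [:: (1, ([::], [::]))].

(** Pairs of a coefficient and an index list of the unknown factor: the table [t] belongs to the
    left factor here, to the right one in [wedge_right], and to the form contracted with an unknown
    vector in [hook_terms]. *)
Definition wedge_left k l t w : seq (int * seq nat) :=
  [seq p <- [seq (p.1 * alt_coef t p.2.1, p.2.2) | p <- splits k l w] | p.1 != 0].
Definition wedge_right k l t w : seq (int * seq nat) :=
  [seq p <- [seq (p.1 * alt_coef t p.2.2, p.2.1) | p <- splits k l w] | p.1 != 0].
Definition hook_terms t w : seq (int * seq nat) :=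
  [seq p <- [seq (alt_coef t (i :: w), [:: i]) | i <- iota 0 7] | p.1 != 0].

Context {R : realFieldType}.
Implicit Types (z : seq nat -> R).

(* The special cases keep the expanded component equations free of factors
   [1] and [-1]. *)
Definition scale_int (m : int) (y : R) : R :=
  match m with
  | Posz 0 => 0 | Posz 1 => y | Posz 2 => 2 * y | Negz 0 => - y | _ => m%:~R * y
  end.

Fixpoint lincomb z (ts : seq (int * seq nat)) : R :=
  match ts with
  | [::] => 0
  | [:: p] => scale_int p.1 (z p.2)
  | p :: ts' => scale_int p.1 (z p.2) + lincomb z ts'
  end.

Lemma scale_intE m (y : R) : scale_int m y = m%:~R * y.
Proof.
case: m => [[|[|[|m]]]|[|m]] //=; first by rewrite mul0r.
  by rewrite mul1r.
by rewrite mulN1r.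
Qed.

Lemma lincombE z ts : lincomb z ts = \sum_(p <- ts) p.1%:~R * z p.2.
Proof.
elim: ts => [|p [|q ts] IH]; first by rewrite big_nil.
  by rewrite big_seq1 /= scale_intE.
by rewrite big_cons -IH /= -scale_intE.
Qed.

Lemma lincomb_filter z ts : lincomb z [seq p <- ts | p.1 != 0] = lincomb z ts.
Proof.
rewrite !lincombE big_filter [RHS](bigID (fun p => p.1 != 0)) /=.
by rewrite [X in _ = _ + X]big1 ?addr0 // => p; rewrite negbK => /eqP ->; rewrite mul0r.
Qed.

Lemma shuf_splits k l z z' w :
  shuf k l z z' w = \sum_(p <- splits k l w) p.1%:~R * (z p.2.1 * z' p.2.2).
Proof.
elim: w k l z z' => [|i w IH] k l z z' /=; first by rewrite big_seq1 mul1r.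
rewrite big_cat /=; congr (_ + _).
  by case: k => [|k]; rewrite ?big_nil // IH big_map.
case: l => [|l]; first by rewrite big_nil.
rewrite IH big_map mulr_sumr; apply: eq_bigr => p _ /=.
by rewrite rmorphM rmorphXn rmorphN1 /= !mulrA.
Qed.

Lemma shuf_left k l t z w :
  shuf k l (fun u => (alt_coef t u)%:~R) z w = lincomb z (wedge_left k l t w).
Proof.
rewrite lincomb_filter lincombE big_map shuf_splits; apply: eq_bigr => p _ /=.
by rewrite rmorphM mulrA.
Qed.

Lemma shuf_right k l t z w :
  shuf k l z (fun u => (alt_coef t u)%:~R) w = lincomb z (wedge_right k l t w).
Proof.
rewrite lincomb_filter lincombE big_map shuf_splits; apply: eq_bigr => p _ /=.
by rewrite rmorphM mulrA mulrAC.
Qed.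

Definition star_c k tv z w : R := scale_int (star k tv w).1 (z (star k tv w).2).
Definition coef_c t (y : R) w : R := scale_int (alt_coef t w) y.

(** In dimension 7 the Hodge dual is an involution in every degree. On components this is a finite
    check, the first hypothesis; it turns equations for the dual of a form into equations for the
    form. *)
Lemma star_star k l (z z' : seq nat -> R) :
  all (fun w => let p := star l vol_coefs w in let q := star k vol_coefs p.2 in
    [&& p.2 \in subseqs l (iota 0 7), q.2 == w & p.1 * q.1 == 1]) (subseqs k (iota 0 7)) ->
  (forall w, w \in subseqs l (iota 0 7) -> z' w = star_c k vol_coefs z w) ->
  forall w, w \in subseqs k (iota 0 7) -> z w = star_c l vol_coefs z' w.
Proof.
move=> /allP ok zz w /ok /and3P[pl /eqP qw /eqP pq].
by rewrite /star_c scale_intE zz // /star_c scale_intE qw mulrA -rmorphM pq mul1r.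
Qed.

End Splits.

(** Index combinatorics is replaced by its computed value before the linear combinations are
    unfolded; the components themselves remain atoms for [lra]. *)
Ltac compute_terms :=
  repeat match goal with
  | |- context [alt_coef ?t ?w] =>
    let v := eval vm_compute in (alt_coef t w) in change (alt_coef t w) with v
  | |- context [wedge_left ?k ?l ?t ?w] =>
    let v := eval vm_compute in (wedge_left k l t w) in
    change (wedge_left k l t w) with v
  | |- context [wedge_right ?k ?l ?t ?w] =>
    let v := eval vm_compute in (wedge_right k l t w) in
    change (wedge_right k l t w) with v
  | |- context [hook_terms ?t ?w] =>
    let v := eval vm_compute in (hook_terms t w) in
    change (hook_terms t w) with v
  | |- context [star ?k ?t ?w] =>
    let v := eval vm_compute in (star k t w) in change (star k t w) with v
  end;
  cbn [lincomb scale_int fst snd].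

(** * Solving the component equations for the torsion *)

(* Components in the adapted frame: [l], [a], [b], [x] stand for [d ln t], [u6],
   [u6'] and [X]; [s], [e], [e'], [h] for [sigma], [u8], [u8'] and [u12]. *)
Section Components.
Context {R : realFieldType}.
Variables (t lam u1 u1' : R) (l a b x : seq nat -> R) (s e e' h : seq nat -> R).
Implicit Types (w : seq nat).

Definition dtheta_c w : R :=
  lincomb x (hook_terms Re_coefs w) + coef_c omega_coefs lam w + s w.
Definition deta_c w : R := t * dtheta_c w + lincomb l (wedge_right 1 1 eta_coefs w).
Definition domega_c w : R :=
  coef_c Re_coefs (3 * u1) w + coef_c Im_coefs (3 * u1') w + h w +
  lincomb a (wedge_right 1 2 omega_coefs w).
Definition dRe_c w : R :=
  coef_c (wedge_coefs 2 2 omega_coefs omega_coefs) (2 * u1') w +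
  lincomb b (wedge_right 1 3 Re_coefs w) + lincomb e (wedge_right 2 2 omega_coefs w).
Definition dIm_c w : R :=
  coef_c (wedge_coefs 2 2 omega_coefs omega_coefs) (- 2 * u1) w +
  lincomb b (wedge_right 1 3 Im_coefs w) + lincomb e' (wedge_right 2 2 omega_coefs w).
Definition dphi_c w : R :=
  lincomb deta_c (wedge_right 2 2 omega_coefs w) -
  lincomb domega_c (wedge_left 1 3 eta_coefs w) + dRe_c w.
Definition dpsi_c w : R :=
  lincomb domega_c (wedge_right 3 2 omega_coefs w) -
  lincomb deta_c (wedge_right 2 3 Im_coefs w) +
  lincomb dIm_c (wedge_left 1 4 eta_coefs w).

Definition horizontal k (z : seq nat -> R) := forall u, size u = k -> z (0%N :: u) = 0.

Definition type8 z := [/\ horizontal 1 z,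
  lincomb z (wedge_right 2 4 (wedge_coefs 2 2 omega_coefs omega_coefs) (iota 1 6)) = 0 &
  forall w, w \in subseqs 5 (iota 1 6) -> lincomb z (wedge_right 2 3 Re_coefs w) = 0].

Definition type12 z := [/\ horizontal 2 z,
  forall w, w \in subseqs 5 (iota 1 6) -> lincomb z (wedge_right 3 2 omega_coefs w) = 0,
  lincomb z (wedge_right 3 3 Re_coefs (iota 1 6)) = 0 &
  lincomb z (wedge_right 3 3 Im_coefs (iota 1 6)) = 0].

(** Of the 15 components of a horizontal 2-form the 1 + 6 equations with [omega^2] and [Re] leave 8
    free. Packaged as a tuple, the solution is a multirule that eliminates the dependent ones. *)
Lemma type8_relations z : type8 z ->
  ((forall i, z [:: 0; i]%N = 0) *
   (z [:: 5; 6]%N = - z [:: 1; 2]%N - z [:: 3; 4]%N) *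
   (z [:: 2; 4]%N = z [:: 1; 3]%N) * (z [:: 2; 3]%N = - z [:: 1; 4]%N) *
   (z [:: 2; 6]%N = z [:: 1; 5]%N) * (z [:: 2; 5]%N = - z [:: 1; 6]%N) *
   (z [:: 4; 6]%N = z [:: 3; 5]%N) * (z [:: 4; 5]%N = - z [:: 3; 6]%N))%type.
Proof.
move=> [zh h1 h2]; move: h1; compute_terms => h1.
have := h2 [:: 1; 2; 3; 4; 5]%N isT; compute_terms => h3.
have := h2 [:: 1; 2; 3; 4; 6]%N isT; compute_terms => h4.
have := h2 [:: 1; 2; 3; 5; 6]%N isT; compute_terms => h5.
have := h2 [:: 1; 2; 4; 5; 6]%N isT; compute_terms => h6.
have := h2 [:: 1; 3; 4; 5; 6]%N isT; compute_terms => h7.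
have := h2 [:: 2; 3; 4; 5; 6]%N isT; compute_terms => h8.
by clear h2; (do !split); try lra; move=> i; exact: zh.
Qed.

(** Of the 20 components of a horizontal 3-form the 6 + 1 + 1 equations leave 12 free. *)
Lemma type12_relations z : type12 z ->
  ((forall i j, z [:: 0; i; j]%N = 0) *
   (z [:: 3; 4; 5]%N = - z [:: 1; 2; 5]%N) * (z [:: 3; 4; 6]%N = - z [:: 1; 2; 6]%N) *
   (z [:: 3; 5; 6]%N = - z [:: 1; 2; 3]%N) * (z [:: 4; 5; 6]%N = - z [:: 1; 2; 4]%N) *
   (z [:: 1; 5; 6]%N = - z [:: 1; 3; 4]%N) * (z [:: 2; 5; 6]%N = - z [:: 2; 3; 4]%N) *
   (z [:: 2; 4; 6]%N = (z [:: 1; 3; 6]%N + z [:: 1; 4; 5]%N + z [:: 2; 3; 5]%N)%R) *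
   (z [:: 2; 4; 5]%N = (z [:: 1; 3; 5]%N - z [:: 1; 4; 6]%N - z [:: 2; 3; 6]%N)%R))%type.
Proof.
move=> [zh h2 + +]; compute_terms => h9 h10.
have := h2 [:: 1; 2; 3; 4; 5]%N isT; compute_terms => h3.
have := h2 [:: 1; 2; 3; 4; 6]%N isT; compute_terms => h4.
have := h2 [:: 1; 2; 3; 5; 6]%N isT; compute_terms => h5.
have := h2 [:: 1; 2; 4; 5; 6]%N isT; compute_terms => h6.
have := h2 [:: 1; 3; 4; 5; 6]%N isT; compute_terms => h7.
have := h2 [:: 2; 3; 4; 5; 6]%N isT; compute_terms => h8.
by clear h2; (do !split); try lra; move=> i j; exact: zh.
Qed.

Definition jx_c w : R := lincomb x (hook_terms omega_coefs w).
Definition y1_c w : R := - (t * jx_c w) + a w + b w + l w.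
Definition y2_c w : R := 2 * t * jx_c w - 2 * a w + b w + l w.
Definition y3_c w : R := t * jx_c w + a w - b w + l w.
Definition jy_c (y : seq nat -> R) w : R := lincomb y (hook_terms omega_coefs w).
Definition inner_c w : R :=
  coef_c omega_coefs (8 / 7 * (t * lam + 1 / 2 * u1')) w
  - 1 / 2 * lincomb (jy_c y3_c) (hook_terms Re_coefs w) - (e w + t * s w).

(** By the structure equations this is the dual of [tau27], and [resid5_c] that of [tau14]. *)
Definition resid4_c (T1 : R) (T7 : seq nat -> R) w : R :=
  dphi_c w - coef_c g2_coform_coefs T1 w - 3 * lincomb T7 (wedge_right 1 3 g2_coefs w).
Definition resid5_c (T7 : seq nat -> R) w : R :=
  dpsi_c w - 4 * lincomb T7 (wedge_right 1 4 g2_coform_coefs w).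

Hypotheses (lh : l [:: 0]%N = 0) (ah : a [:: 0]%N = 0)
  (bh : b [:: 0]%N = 0) (s8 : type8 s) (e8 : type8 e) (e'8 : type8 e') (h12 : type12 h).

Variables (T1 : R) (T7 T14 T27 : seq nat -> R).
Hypotheses
  (T27phi : forall w, w \in subseqs 6 (iota 0 7) ->
     lincomb T27 (wedge_right 3 3 g2_coefs w) = 0)
  (T27psi : lincomb T27 (wedge_right 3 4 g2_coform_coefs (iota 0 7)) = 0)
  (dphiE : forall w, w \in subseqs 4 (iota 0 7) ->
     resid4_c T1 T7 w = star_c 3 vol_coefs T27 w)
  (dpsiE : forall w, w \in subseqs 5 (iota 0 7) ->
     resid5_c T7 w = star_c 2 vol_coefs T14 w).

Let T27E : forall w, w \in subseqs 3 (iota 0 7) ->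
  T27 w = star_c 4 vol_coefs (resid4_c T1 T7) w.
Proof. by apply: star_star dphiE; vm_compute. Qed.
Let T14E : forall w, w \in subseqs 2 (iota 0 7) ->
  T14 w = star_c 5 vol_coefs (resid5_c T7) w.
Proof. by apply: star_star dpsiE; vm_compute. Qed.

(** Unfolds layer by layer and computes the index lists of each layer, so that the next one is met
    only at explicit indices. *)
Ltac expand_components :=
  cbv [inner_c jy_c y1_c y2_c y3_c jx_c]; compute_terms;
  cbv [star_c inner_c jy_c y1_c y2_c y3_c jx_c]; compute_terms;
  cbv [resid4_c resid5_c jx_c]; compute_terms;
  cbv [dphi_c dpsi_c jx_c]; compute_terms;
  cbv [dRe_c dIm_c domega_c deta_c]; compute_terms;
  cbv [dtheta_c coef_c star_c]; compute_terms.

Let relations := (lh, ah, bh, type8_relations s8, type8_relations e8,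
  type8_relations e'8, type12_relations h12).

(** Pairing [d phi] with [*phi] isolates [T1]. The denominator 7 is the square norm of [phi]; the
    contributions are [6 t lam] from [t lam omega^2] and [12 u1'] from each of [d Re] and
    [- eta /\ d omega]. *)
Lemma tau1_component : T1 = 6 / 7 * (t * lam + 4 * u1').
Proof.
by have := T27psi; compute_terms; rewrite !T27E //; expand_components;
  rewrite !relations; lra.
Qed.

Lemma tau7_component w : w \in subseqs 1 (iota 0 7) ->
  T7 w = - coef_c eta_coefs u1 w + 1 / 6 * y1_c w.
Proof.
have eqs := T27phi.
rewrite !inE => /or4P[|||/or4P[]] /eqP ->.
(* The equation on the six indices other than [i] determines component [i] of [tau7]; [T1] drops out
   because [phi /\ phi = 0]. *)
- have := eqs [:: 1; 2; 3; 4; 5; 6]%N isT; compute_terms; rewrite !T27E //.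
  expand_components; rewrite !relations; lra.
- have := eqs [:: 0; 2; 3; 4; 5; 6]%N isT; compute_terms; rewrite !T27E //.
  expand_components; rewrite !relations; lra.
- have := eqs [:: 0; 1; 3; 4; 5; 6]%N isT; compute_terms; rewrite !T27E //.
  expand_components; rewrite !relations; lra.
- have := eqs [:: 0; 1; 2; 4; 5; 6]%N isT; compute_terms; rewrite !T27E //.
  expand_components; rewrite !relations; lra.
- have := eqs [:: 0; 1; 2; 3; 5; 6]%N isT; compute_terms; rewrite !T27E //.
  expand_components; rewrite !relations; lra.
- have := eqs [:: 0; 1; 2; 3; 4; 6]%N isT; compute_terms; rewrite !T27E //.
  expand_components; rewrite !relations; lra.
- have := eqs [:: 0; 1; 2; 3; 4; 5]%N isT; compute_terms; rewrite !T27E //.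
  expand_components; rewrite !relations; lra.
Qed.

Lemma tau14_component w : w \in subseqs 2 (iota 0 7) ->
  T14 w = 2 / 3 * lincomb (jy_c y2_c) (wedge_left 1 1 eta_coefs w) +
    1 / 3 * lincomb y2_c (hook_terms Re_coefs w) - e' w.
Proof.
move=> wk; rewrite (T14E wk); apply/eqP; move: w wk; apply/allP.
(* The quantifier over index lists becomes a conjunction of 21 equations. *)
let v := eval vm_compute in (subseqs 2 (iota 0 7)) in change (subseqs 2 (iota 0 7)) with v.
rewrite ![all _ _]/=.
do ![apply/andP; split]; last by [].
(* The formula for [tau7] brings in further component definitions, hence a second expansion. *)
all: apply/eqP; expand_components;
  rewrite ?tau7_component //; expand_components; rewrite ?relations; lra.
Qed.

Lemma tau27_component w : w \in subseqs 3 (iota 0 7) ->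
  T27 w = lincomb inner_c (wedge_left 1 2 eta_coefs w)
    - 1 / 2 * lincomb (jy_c y3_c) (wedge_right 1 2 omega_coefs w)
    - coef_c Re_coefs (6 / 7 * (1 / 2 * u1' + t * lam)) w
    - star_c 3 su3_vol_coefs h w.
Proof.
move=> wk; rewrite (T27E wk); apply/eqP; move: w wk; apply/allP.
let v := eval vm_compute in (subseqs 3 (iota 0 7)) in change (subseqs 3 (iota 0 7)) with v.
rewrite ![all _ _]/=.
do ![apply/andP; split]; last by [].
all: apply/eqP; expand_components;
  rewrite ?tau7_component ?tau1_component //; expand_components; rewrite ?relations; lra.
Qed.

End Components.

(** * Vectors and covectors *)

Section FlatSharp.
Context {R : realType} {n : nat}.
Implicit Types (G Q : 'M[R]_n) (u v : 'rV[R]_n).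

Lemma flatvD G u v : flatv G (u + v) = flatv G u + flatv G v.
Proof.
by apply/funext => V; rewrite /flatv /ip !mulmxDl mxE.
Qed.

Lemma flatvZ G (z : R) v : flatv G (z *: v) = z *: flatv G v.
Proof. by apply/funext => V; rewrite /flatv /ip -!scalemxAl mxE. Qed.

Lemma flatvN G v : flatv G (- v) = - flatv G v.
Proof. by apply/funext => V; rewrite /flatv /ip !mulNmx mxE. Qed.

Lemma flat_sharp G (a : mform R n 1) : G \in unitmx -> multilin_alt 1 (ev a) ->
  flatv G (sharpv G a) = a.
Proof.
move=> uG aP; apply/funext => V; rewrite /flatv /ip /sharpv mulmxKV // !mxE.
have stack1 (r : 'rV[R]_n) : stack 1 [:: r] = r by apply/rowP => j; rewrite mxE.
rewrite -[in RHS](stack1 V) -/(ev a _) {2}(row_sum_delta V).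
rewrite (multilin_alt_sum (x := [::]) (y := [::]) _ _ aP) //=.
by apply: eq_bigr => j _; rewrite !mxE mulrC /ev stack1.
Qed.

(** In an orthonormal frame the coordinates of a vector are the components of its dual form; this is
    how vectors enter the calculus of components. *)
Lemma frame_expansion G Q v : Q *m G *m Q^T = 1%:M ->
  v = \sum_(i < n) ev (flatv G v) [:: frame Q i] *: frame Q i.
Proof.
move=> QG; have QGQ : G *m Q^T *m Q = 1%:M by apply: mulmx1C; rewrite mulmxA.
rewrite -{1}[v]mulmx1 -QGQ !mulmxA mulmx_sum_row; apply: eq_bigr => i _.
rewrite frameE /ev /flatv /ip; congr (_ *: _).
have -> : stack 1 [:: row i Q] = row i Q by apply/rowP => j; rewrite mxE.
by rewrite !mxE; apply: eq_bigr => j _; rewrite !mxE.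
Qed.

End FlatSharp.

(** * Components of wedges, contractions and duals in a fixed frame *)

Section FrameComponents.
Context {R : realType}.
Variables (G Q : 'M[R]_7).
Hypothesis QG : Q *m G *m Q^T = 1%:M.
Implicit Types (w u : seq nat).

Definition comps k (a : mform R 7 k) w : R := ev a (map (frame Q) w).

Lemma form_eq k (a b : mform R 7 k) : multilin_alt k (ev a) -> multilin_alt k (ev b) ->
  (forall w, w \in subseqs k (iota 0 7) -> comps a w = comps b w) -> a = b.
Proof.
move=> aP bP ab; have [uQ _] := invmx_orthonormal QG.
by apply: ev_eq => s; apply: (eq_multilin_alt_frame aP bP (frame_gen uQ)).
Qed.

Lemma shuf_map k l (a b : seq 'rV[R]_7 -> R) w : size w = (k + l)%N ->
  shuf k l a b (map (frame Q) w) =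
  shuf k l (a \o map (frame Q)) (b \o map (frame Q)) w.
Proof.
elim: w k l a b => [|i w IH] [|k] [|l] a b //= [sk].
- by rewrite (IH 0 l a (b \o cons _)).
- by rewrite (IH k 0 (a \o cons _) b).
- rewrite (IH k l.+1 (a \o cons _) b) // (IH k.+1 l a (b \o cons _)) //.
  by rewrite sk addnS.
Qed.

Lemma eq_shuf_tuples k l (a a' b b' : seq nat -> R) w : w \in tuples 7 (k + l) ->
  (forall u, u \in tuples 7 k -> a u = a' u) ->
  (forall u, u \in tuples 7 l -> b u = b' u) ->
  shuf k l a b w = shuf k l a' b' w.
Proof.
rewrite mem_tuples; elim: w k l a a' b b' => [|i w IH] k l a a' b b' /=.
  by case: k => //; case: l => // _ aa bb; rewrite aa ?bb.
move=> /and3P[/eqP sk i7 w7] aa bb.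
have ins m u : u \in tuples 7 m -> i :: u \in tuples 7 m.+1.
  by rewrite !mem_tuples /= eqSS i7.
congr (_ + _).
  case: k aa sk => [|k] // aa sk; apply: IH => //; last by move=> u uk; apply/aa/ins.
  by rewrite w7 andbT; apply/eqP; lia.
case: l bb sk => [|l] // bb sk; congr (_ * _).
apply: IH => //; last by move=> u uk; apply/bb/ins.
by rewrite w7 andbT; apply/eqP; lia.
Qed.

Lemma tuples_size n k w : w \in tuples n k -> size w = k.
Proof. by rewrite mem_tuples => /andP[/eqP]. Qed.

Lemma shuf_comps_right k l (a : seq 'rV[R]_7 -> R) z (b : mform R 7 l) t w :
  int_form (frame Q) b t -> w \in tuples 7 (k + l) ->
  (forall u, u \in tuples 7 k -> a (map (frame Q) u) = z u) ->
  shuf k l a (ev b) (map (frame Q) w) = lincomb z (wedge_right k l t w).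
Proof.
move=> bt wk az; rewrite shuf_map ?(tuples_size wk) // -shuf_right.
by apply: eq_shuf_tuples => // u uk; exact: (int_formE bt).
Qed.

Lemma shuf_comps_left k l (a : mform R 7 k) t (b : seq 'rV[R]_7 -> R) z w :
  int_form (frame Q) a t -> w \in tuples 7 (k + l) ->
  (forall u, u \in tuples 7 l -> b (map (frame Q) u) = z u) ->
  shuf k l (ev a) b (map (frame Q) w) = lincomb z (wedge_left k l t w).
Proof.
move=> at_ wk bz; rewrite shuf_map ?(tuples_size wk) // -shuf_left.
by apply: eq_shuf_tuples => // u uk; exact: (int_formE at_).
Qed.

Lemma comps_wedge_right_eq k l (a : mform R 7 k) z (b : mform R 7 l) t w :
  multilin_alt k (ev a) -> int_form (frame Q) b t -> w \in tuples 7 (k + l) ->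
  (forall u, u \in tuples 7 k -> comps a u = z u) ->
  comps (wedgef a b) w = lincomb z (wedge_right k l t w).
Proof.
move=> aP bt wk az; rewrite /comps ev_wedge ?size_map ?(tuples_size wk) //.
  exact: (shuf_comps_right bt wk).
exact: bt.1.
Qed.

Lemma comps_wedge_right k l (a : mform R 7 k) (b : mform R 7 l) t w :
  multilin_alt k (ev a) -> int_form (frame Q) b t -> w \in tuples 7 (k + l) ->
  comps (wedgef a b) w = lincomb (comps a) (wedge_right k l t w).
Proof. by move=> aP bt wk; apply: comps_wedge_right_eq. Qed.

Lemma comps_wedge_left k l (a : mform R 7 k) (b : mform R 7 l) z t w :
  int_form (frame Q) a t -> multilin_alt l (ev b) -> w \in tuples 7 (k + l) ->
  (forall u, u \in tuples 7 l -> comps b u = z u) ->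
  comps (wedgef a b) w = lincomb z (wedge_left k l t w).
Proof.
move=> at_ bP wk bz; rewrite /comps ev_wedge ?size_map ?(tuples_size wk) //.
  exact: (shuf_comps_left at_ wk).
exact: at_.1.
Qed.

Lemma comps_int k (a : mform R 7 k) t (z : R) w :
  int_form (frame Q) a t -> w \in tuples 7 k -> z * comps a w = coef_c t z w.
Proof. by move=> at_ wk; rewrite /coef_c scale_intE mulrC /comps (int_formE at_). Qed.

Lemma comps_hook k v (a : mform R 7 k.+1) z t w :
  int_form (frame Q) a t -> w \in tuples 7 k ->
  (forall u, u \in tuples 7 1 -> comps (flatv G v) u = z u) ->
  comps (hook v a) w = lincomb z (hook_terms t w).
Proof.
move=> at_ wk vz; rewrite /comps ev_hook ?size_map ?(tuples_size wk) //.
rewrite {1}(frame_expansion v QG).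
rewrite (multilin_alt_sum (x := [::]) _ _ at_.1) ?size_map ?(tuples_size wk) //=.
rewrite lincomb_filter lincombE big_map big_iota_ord; apply: eq_bigr => i _ /=.
rewrite -vz ?mem_tuples /= ?ltn_ord // mulrC; congr (_ * _).
rewrite -[frame Q i :: _]/(map (frame Q) (val i :: w)).
apply: (int_formE at_); move: wk; rewrite !mem_tuples /= eqSS => /andP[-> ->].
by rewrite ltn_ord.
Qed.

Lemma comps_hodge k l (vol : mform R 7 (k + l)) (b : mform R 7 k) tv w :
  int_form (frame Q) vol tv -> multilin_alt k (ev b) -> w \in subseqs l (iota 0 7) ->
  all (star_ok k tv) (subseqs l (iota 0 7)) ->
  comps (hodge k l G vol b) w = star_c k tv (comps b) w.
Proof.
move=> vt bP wl /allP ok; rewrite /comps (ev_hodge_star QG vt bP _ (ok _ wl)).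
  by rewrite /star_c scale_intE.
exact: subseqs_tuples.
Qed.

Lemma comps0 k w : comps (0 : mform R 7 k) w = 0.
Proof. by []. Qed.

Lemma compsD k (a b : mform R 7 k) w : comps (a + b) w = comps a w + comps b w.
Proof. by []. Qed.

Lemma compsN k (a : mform R 7 k) w : comps (- a) w = - comps a w.
Proof. by []. Qed.

Lemma compsZ k (z : R) (a : mform R 7 k) w : comps (z *: a) w = z * comps a w.
Proof. by []. Qed.

Lemma multilin_altN k (a : seq 'rV[R]_7 -> R) : multilin_alt k a ->
  multilin_alt k (fun s => - a s).
Proof.
move=> aP; apply: eq_multilin_alt (multilin_altZ (-1) aP) => s _; by rewrite mulN1r.
Qed.

End FrameComponents.

(** The tables of [omega], [Re] and [Im] do not contain the index 0, so contraction with [E_0]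
    leaves only [a [:: 0]] and components of [h], which vanish. *)
Lemma domega_c_horizontal (R : realFieldType) (u1 u1' : R) (a h : seq nat -> R) w :
  a [:: 0%N] = 0 -> horizontal 2 h -> w \in subseqs 2 (iota 0 7) ->
  domega_c u1 u1' a h (0%N :: w) = 0.
Proof.
move=> a0 hh wk; rewrite /domega_c hh; last exact: tuples_size (subseqs_tuples wk).
apply/eqP; move: w wk; apply/allP.
let v := eval vm_compute in (subseqs 2 (iota 0 7)) in change (subseqs 2 (iota 0 7)) with v.
rewrite ![all _ _]/=; do ![apply/andP; split]; last by [].
all: by apply/eqP; rewrite /coef_c; compute_terms; rewrite ?a0 ?oppr0 ?addr0.
Qed.

(** * The structure equations in components and the torsion formulas *)

Section StructureEquations.
Context {R : realType} {M : manifold R 7} (S : g2_structure M) (xi : vfield M).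
Hypothesis xi_vfield : is_vfield setT xi.
Hypothesis xi_inv : forall p (c : atlas M), cdom c p -> lie_kform xi (g2_form S) p c = 0.
Variables (u1 u1' : M -> R) (u6 u6' : kform M 1) (u8 u8' : kform M 2) (u12 : kform M 3).
Hypothesis su3_tor : su3_torsion S xi u1 u1' u6 u6' u8 u8' u12.
Variables (X : vfield M) (lambda : M -> R) (sigma : kform M 2).
Hypothesis sigma_type : Omega2_8 S xi sigma.
Hypothesis curvature : forall p (c : atlas M), nonfixed xi p -> cdom c p ->
  ext_d (conn_form S xi) p c =
    hook (X p c) (su3_Re S xi p c) + lambda p *: su3_omega S xi p c + sigma p c.
Variables (p : M) (c : atlas M).
Hypotheses (p_nonfixed : nonfixed xi p) (p_c : cdom c p).

Local Notation g := (g2_metric S p c).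
Local Notation t := (orbit_norm S xi p).
Local Notation theta := (conn_form S xi p c).
Local Notation omega := (su3_omega S xi p c).
Local Notation ReU := (su3_Re S xi p c).
Local Notation ImU := (su3_Im S xi p c).
Local Notation x0 := (ccoord c p).
Let dlnt : mform R 7 1 := dfun (fun q => ln (orbit_norm S xi q)) p c.

Variable Q : 'M[R]_7.
Hypothesis QG : Q *m g *m Q^T = 1%:M.
Hypothesis phiQ : int_form (frame Q) (g2_form S p c) g2_coefs.
Hypothesis xiE : xi p c = t *: frame Q 0.
Hypothesis etaQ : int_form (frame Q) (t *: theta) eta_coefs.
Hypothesis omQ : int_form (frame Q) omega omega_coefs.
Hypothesis reQ : int_form (frame Q) ReU Re_coefs.
Hypothesis imQ : int_form (frame Q) ImU Im_coefs.

Local Notation cmp := (comps Q).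
Local Notation x := (cmp (flatv g (X p c))).
Local Notation l := (cmp dlnt).
Local Notation a := (cmp (u6 p c)).
Local Notation b := (cmp (u6' p c)).
Local Notation s := (cmp (sigma p c)).
Local Notation e := (cmp (u8 p c)).
Local Notation e' := (cmp (u8' p c)).
Local Notation h := (cmp (u12 p c)).

Let t0 : t != 0. Proof. exact: orbit_norm_neq0. Qed.

Lemma basic_multilin k (z : kform M k.+1) : basic_form xi z ->
  multilin_alt k.+1 (ev (z p c)).
Proof. by case=> -[zA _ _] _; apply: multilin_alt_ev; exact: zA. Qed.

Lemma basic_horizontal k (z : kform M k.+1) : basic_form xi z ->
  horizontal k (cmp (z p c)).
Proof.
move=> zb u uk; have zP := basic_multilin zb; case: zb => _ /(_ p c p_nonfixed p_c)[hz _].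
have := congr1 (fun f => ev f (map (frame Q) u)) hz.
rewrite /= xiE hookZ // -[LHS]/(t * ev (hook (frame Q 0) (z p c)) _).
rewrite ev_hook ?size_map // -[RHS]/(0 : R) => /eqP.
by rewrite mulf_eq0 (negbTE t0) => /eqP.
Qed.

Lemma Omega2_8_type8 (z : kform M 2) : Omega2_8 S xi z -> type8 (cmp (z p c)).
Proof.
case=> zb /(_ p c p_nonfixed p_c)[z1 z2 _]; have zP := basic_multilin zb.
split; first exact: basic_horizontal.
  by rewrite -(comps_wedge_right zP (int_form_wedge omQ omQ)) // z1 comps0.
move=> w wk; have w7 : w \in tuples 7 (2 + 3).
  by apply: (allP (a := mem (tuples 7 5)) _ _ wk); vm_compute.
by rewrite -(comps_wedge_right zP reQ w7) z2 comps0.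
Qed.

Lemma Omega3_12_type12 (z : kform M 3) : Omega3_12 S xi z -> type12 (cmp (z p c)).
Proof.
case=> zb /(_ p c p_nonfixed p_c)[z1 z2 z3]; have zP := basic_multilin zb.
split; first exact: basic_horizontal.
- move=> w wk; have w7 : w \in tuples 7 (3 + 2).
    by apply: (allP (a := mem (tuples 7 5)) _ _ wk); vm_compute.
  by rewrite -(comps_wedge_right zP omQ w7) z1 comps0.
- by rewrite -(comps_wedge_right zP reQ) // z2 comps0.
- by rewrite -(comps_wedge_right zP imQ) // z3 comps0.
Qed.

Lemma ext_d_theta_comps w : w \in tuples 7 2 ->
  cmp (ext_d (conn_form S xi) p c) w = dtheta_c (lambda p) x s w.
Proof.
move=> wk; rewrite curvature // 2!compsD compsZ (comps_hook QG reQ wk (fun _ _ => erefl)) //.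
by rewrite (comps_int _ omQ).
Qed.

Lemma ext_d_omega_comps w : w \in tuples 7 3 ->
  cmp (ext_d (su3_omega S xi) p c) w = domega_c (u1 p) (u1' p) a h w.
Proof.
move=> wk; rewrite (d_su3_omega su3_tor) // 3!compsD 2!compsZ.
rewrite (comps_wedge_right (k := 1) (l := 2) _ omQ) //; last exact: basic_multilin (u6_basic su3_tor).
by rewrite (comps_int _ reQ) // (comps_int _ imQ).
Qed.

Lemma ext_d_Re_comps w : w \in tuples 7 4 ->
  cmp (ext_d (su3_Re S xi) p c) w = dRe_c (u1' p) b e w.
Proof.
move=> wk; rewrite (d_su3_Re su3_tor) // 2!compsD compsZ.
rewrite (comps_int (k := 4) _ (int_form_wedge omQ omQ)) //.
rewrite (comps_wedge_right (k := 1) (l := 3) _ reQ) //; last exact: basic_multilin (u6'_basic su3_tor).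
rewrite (comps_wedge_right (k := 2) (l := 2) _ omQ) //; last exact: basic_multilin (u8_type su3_tor).1.
Qed.

Lemma ext_d_Im_comps w : w \in tuples 7 4 ->
  cmp (ext_d (su3_Im S xi) p c) w = dIm_c (u1 p) b e' w.
Proof.
move=> wk; rewrite (d_su3_Im su3_tor) // 2!compsD compsZ.
rewrite (comps_int (k := 4) _ (int_form_wedge omQ omQ)) //.
rewrite (comps_wedge_right (k := 1) (l := 3) _ imQ) //; last exact: basic_multilin (u6'_basic su3_tor).
rewrite (comps_wedge_right (k := 2) (l := 2) _ omQ) //; last exact: basic_multilin (u8'_type su3_tor).1.
Qed.

Lemma dlnt_multilin : multilin_alt 1 (ev dlnt).
Proof.
have [L LE] := orbit_norm_derive S xi_vfield p_nonfixed p_c.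
split=> [[|? ?] [|? ?] v w z|x y v] //= _.
have stack1 (r : 'rV[R]_7) : stack 1 [:: r] = r by apply/rowP => j; rewrite mxE.
rewrite /ev !stack1 /dlnt; have [_ ->] := LE (z *: v + w).
have [_ ->] := LE v; have [_ ->] := LE w.
by rewrite linearD linearZ /= mulrDr mulrCA.
Qed.

Lemma comps_theta w : cmp theta w = t^-1 * cmp (t *: theta) w.
Proof. by rewrite compsZ mulrA mulVf ?mul1r. Qed.

Lemma derive_orbit_norm (v : 'rV[R]_7) :
  'D_v ((fun y => orbit_norm S xi (cparam c y)) : 'rV[R]_7 -> R^o) x0 = t * ev dlnt [:: v].
Proof.
have [L LE] := orbit_norm_derive S xi_vfield p_nonfixed p_c.
have [-> e2] := LE v.
have stack1 : stack 1 [:: v] = v by apply/rowP => j; rewrite mxE.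
by rewrite /ev /dlnt stack1 e2 mulrA mulfV ?mul1r.
Qed.

(** [dt /\ theta] is rewritten as [d ln t /\ eta], whose second factor has an integer table; the
    factors [t] and [t^-1] cancel. *)
Lemma ext_d_eta_comps w : w \in tuples 7 2 ->
  ext_d_list x0 (fun y => ev (orbit_norm S xi (cparam c y) *: conn_form S xi (cparam c y) c
    : mform R 7 1)) (map (frame Q) w) = deta_c t (lambda p) l x s w.
Proof.
move=> wk; have := tuples_size wk; case: w wk => [|i [|j []]] // wk _.
rewrite (ext_d_eta S xi_vfield p_nonfixed p_c) /deta_c -ext_d_theta_comps //.
congr (_ + _); rewrite !derive_orbit_norm.
have := shuf_comps_right (k := 1) (a := ev dlnt) (z := cmp dlnt) etaQ wk (fun u _ => erefl).
move=> <-; rewrite /= -!/(comps Q theta [:: _]) !comps_theta /comps /=.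
rewrite -!/(map (frame Q) [:: _]).
move: (ev dlnt _) (ev dlnt _) (ev (_ *: _) _) (ev (_ *: _) _) => A B C D.
have tt : t * t^-1 = 1 by rewrite mulfV.
have tE (y y' : R) : t * y * (t^-1 * y') = y * y'.
  by rewrite mulrACA tt mul1r.
by rewrite !tE; ring.
Qed.

Lemma ext_d_phi_comps w : w \in tuples 7 4 ->
  cmp (ext_d (g2_form S) p c) w =
  dphi_c t (lambda p) (u1 p) (u1' p) l a b x s e h w.
Proof.
move=> wk; rewrite /comps (ext_d_phi S xi_vfield p_nonfixed p_c) ?size_map ?(tuples_size wk) //.
rewrite (shuf_comps_right (k := 2) (l := 2) omQ wk ext_d_eta_comps).
rewrite (shuf_comps_left (k := 1) (l := 3) etaQ wk ext_d_omega_comps).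
by rewrite -/(comps _ _ _) ext_d_Re_comps.
Qed.

Lemma ext_d_coform_comps w : w \in tuples 7 5 ->
  cmp (ext_d (g2_coform S) p c) w =
  dpsi_c t (lambda p) (u1 p) (u1' p) l a b x s e' h w.
Proof.
move=> wk; rewrite /comps (ext_d_coform S xi_vfield p_nonfixed p_c) ?size_map ?(tuples_size wk) //.
rewrite (shuf_comps_right (k := 3) (l := 2) omQ wk ext_d_omega_comps).
rewrite (shuf_comps_right (k := 2) (l := 3) imQ wk ext_d_eta_comps).
by rewrite (shuf_comps_left (k := 1) (l := 4) etaQ wk ext_d_Im_comps).
Qed.

(** Every term of the torsion equation for [d omega] is horizontal, so [xi -| d omega = 0] and hence
    [xi(t) = 0]; then [xi = t E_0] gives the component along [E_0]. *)
Lemma comps_dlnt0 : l [:: 0%N] = 0.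
Proof.
have dom0 : hook (xi p c) (ext_d (su3_omega S xi) p c) = 0.
  have [uQ _] := invmx_orthonormal QG.
  have dP : multilin_alt 3 (ev (ext_d (su3_omega S xi) p c)).
    rewrite (d_su3_omega su3_tor) //.
    apply: multilin_altD; first apply: multilin_altD; first apply: multilin_altD.
    - exact: multilin_altZ reQ.1.
    - exact: multilin_altZ imQ.1.
    - exact: basic_multilin (u12_type su3_tor).1.
    - apply: (@multilin_alt_wedge _ _ 1 2); last exact: omQ.1.
      exact: basic_multilin (u6_basic su3_tor).
  apply: (form_eq QG); first exact: multilin_alt_hook.
    by split=> *; rewrite -[LHS]/(0 : R) ?mulr0 ?addr0.
  move=> w wk; have wt := subseqs_tuples wk.
  rewrite xiE hookZ // compsZ [RHS](_ : _ = 0) // /comps ev_hook ?size_map ?(tuples_size wt) //.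
  rewrite -[frame Q 0 :: _]/(map (frame Q) (0%N :: w)) -/(comps _ _ _) ext_d_omega_comps; last first.
    by move: wt; rewrite !mem_tuples /= eqSS.
  rewrite domega_c_horizontal ?mulr0 //.
    by apply: (basic_horizontal (u6_basic su3_tor)).
  exact: basic_horizontal (u12_type su3_tor).1.
have := orbit_norm_invariant xi_vfield p_nonfixed p_c (xi_inv p_c) dom0.
rewrite derive_orbit_norm => /eqP; rewrite mulf_eq0 (negbTE t0) /= => /eqP.
have -> : ev dlnt [:: xi p c] = t * ev dlnt [:: frame Q 0].
  rewrite -(@ev_hook _ _ 0 (xi p c) dlnt [::] erefl) xiE.
  by rewrite (hookZ _ _ dlnt_multilin) -(@ev_hook _ _ 0 (frame Q 0) dlnt [::] erefl).
by move=> /eqP; rewrite mulf_eq0 (negbTE t0) => /eqP.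
Qed.

Variables (tau1 : M -> R) (tau7 : kform M 1) (tau14 : kform M 2) (tau27 : kform M 3).
Hypothesis g2_tor : g2_torsion S tau1 tau7 tau14 tau27.
Hypothesis volQ : int_form (frame Q) (g2_vol S p c) vol_coefs.
Hypothesis psiQ : int_form (frame Q) (g2_coform S p c) g2_coform_coefs.

Local Notation T1 := (tau1 p).
Local Notation T7 := (cmp (tau7 p c)).
Local Notation T14 := (cmp (tau14 p c)).
Local Notation T27 := (cmp (tau27 p c)).

Lemma kform_multilin k (z : kform M k) : is_kform setT z -> multilin_alt k (ev (z p c)).
Proof. by case=> zA _ _; apply: multilin_alt_ev; exact: zA. Qed.

Lemma tau27_phi w : w \in subseqs 6 (iota 0 7) ->
  lincomb T27 (wedge_right 3 3 g2_coefs w) = 0.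
Proof.
move=> wk; have [h1 _] := tau27_type g2_tor p_c.
rewrite -(comps_wedge_right (kform_multilin (tau27_form g2_tor)) phiQ) ?h1 ?comps0 //.
exact: (subseqs_tuples (k := 6)).
Qed.

Lemma tau27_psi : lincomb T27 (wedge_right 3 4 g2_coform_coefs (iota 0 7)) = 0.
Proof.
have [_ h1] := tau27_type g2_tor p_c.
by rewrite -(comps_wedge_right (kform_multilin (tau27_form g2_tor)) psiQ) ?h1 ?comps0.
Qed.

Lemma resid4_comps w : w \in subseqs 4 (iota 0 7) ->
  resid4_c t (lambda p) (u1 p) (u1' p) l a b x s e h T1 T7 w = star_c 3 vol_coefs T27 w.
Proof.
move=> wk; have wt := subseqs_tuples wk.
rewrite -(comps_hodge (k := 3) (l := 4) QG volQ (kform_multilin (tau27_form g2_tor)) wk);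
  last by vm_compute.
rewrite /resid4_c -ext_d_phi_comps // (d_g2_form g2_tor p_c) 2!compsD.
rewrite (@compsZ _ Q 4 T1) (@compsZ _ Q 4 3%:R).
rewrite (comps_int _ psiQ) //.
rewrite (comps_wedge_right (k := 1) (l := 3) (kform_multilin (tau7_form g2_tor)) phiQ) //.
move: (coef_c _ _ _) (lincomb _ _) (comps _ _ _) => A B C; ring.
Qed.

Lemma resid5_comps w : w \in subseqs 5 (iota 0 7) ->
  resid5_c t (lambda p) (u1 p) (u1' p) l a b x s e' h T7 w = star_c 2 vol_coefs T14 w.
Proof.
move=> wk; have wt := subseqs_tuples wk.
rewrite -(comps_hodge (k := 2) (l := 5) QG volQ (kform_multilin (tau14_form g2_tor)) wk);
  last by vm_compute.
rewrite /resid5_c -ext_d_coform_comps // (d_g2_coform g2_tor p_c) compsD (@compsZ _ Q 5 4%:R).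
rewrite (comps_wedge_right (k := 1) (l := 4) (kform_multilin (tau7_form g2_tor)) psiQ) //.
move: (lincomb _ _) (comps _ _ _) => A B; ring.
Qed.

Let s8 := Omega2_8_type8 sigma_type.
Let e8 := Omega2_8_type8 (u8_type su3_tor).
Let e'8 := Omega2_8_type8 (u8'_type su3_tor).
Let h12 := Omega3_12_type12 (u12_type su3_tor).
Let a0 : a [:: 0%N] = 0. Proof. exact: (basic_horizontal (u6_basic su3_tor)). Qed.
Let b0 : b [:: 0%N] = 0. Proof. exact: (basic_horizontal (u6'_basic su3_tor)). Qed.

Let uG : g \in unitmx.
Proof.
by move: QG; rewrite -mulmxA => /mulmx1C; rewrite -mulmxA => /mulmx1_unit[].
Qed.

Local Notation J := (su3_J S xi p c).
Local Notation v6 := (sharpv g (u6 p c)).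
Local Notation v6' := (sharpv g (u6' p c)).
Local Notation dln := (sharpv g dlnt).
Local Notation Y1 := (- (t *: J (X p c)) + v6 + v6' + dln).
Local Notation Y2 := ((2 * t) *: J (X p c) - 2 *: v6 + v6' + dln).
Local Notation Y3 := (t *: J (X p c) + v6 - v6' + dln).

Lemma flat_J v : flatv g (J v) = hook v omega.
Proof. by rewrite flat_sharp //; apply: multilin_alt_hook; exact: omQ.1. Qed.

Lemma comps_flat_J v w : w \in tuples 7 1 ->
  cmp (flatv g (J v)) w = jy_c (cmp (flatv g v)) w.
Proof. by move=> wk; rewrite flat_J (comps_hook QG omQ wk (fun _ _ => erefl)). Qed.

Let flat_v6 : flatv g v6 = u6 p c.
Proof. by rewrite flat_sharp //; exact: basic_multilin (u6_basic su3_tor). Qed.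
Let flat_v6' : flatv g v6' = u6' p c.
Proof. by rewrite flat_sharp //; exact: basic_multilin (u6'_basic su3_tor). Qed.
Let flat_dln : flatv g dln = dlnt.
Proof. by rewrite flat_sharp //; exact: dlnt_multilin. Qed.

Lemma comps_Y1 w : w \in tuples 7 1 -> cmp (flatv g Y1) w = y1_c t l a b x w.
Proof.
move=> wk; rewrite !flatvD flatvN flatvZ flat_v6 flat_v6' flat_dln.
by rewrite /y1_c /jx_c -/(jy_c _ _) -comps_flat_J.
Qed.

Lemma comps_Y2 w : w \in tuples 7 1 -> cmp (flatv g Y2) w = y2_c t l a b x w.
Proof.
move=> wk; rewrite !flatvD flatvN !flatvZ flat_v6 flat_v6' flat_dln.
by rewrite /y2_c /jx_c -/(jy_c _ _) -comps_flat_J.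
Qed.

Lemma comps_Y3 w : w \in tuples 7 1 -> cmp (flatv g Y3) w = y3_c t l a b x w.
Proof.
move=> wk; rewrite !flatvD flatvN flatvZ flat_v6 flat_v6' flat_dln.
by rewrite /y3_c /jx_c -/(jy_c _ _) -comps_flat_J.
Qed.

Lemma tau1_formula : T1 = 6 / 7 * (t * lambda p + 4 * u1' p).
Proof. exact: (tau1_component s8 e8 h12 tau27_psi resid4_comps). Qed.

Lemma tau7_formula :
  tau7 p c = - ((t * u1 p) *: theta) + (1 / 6 : R) *: flatv g Y1.
Proof.
apply: (form_eq QG); first exact: kform_multilin (tau7_form g2_tor).
  apply: multilin_altD; last by apply: multilin_altZ; exact: multilin_alt_flat.
  by apply: multilin_altN; apply: multilin_altZ; apply: multilin_altZ; exact: multilin_alt_flat.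
move=> w wk; have wt := subseqs_tuples wk.
rewrite (tau7_component comps_dlnt0 a0 b0 s8 e8 h12 tau27_phi resid4_comps wk).
rewrite compsD compsN (@compsZ _ Q 1 (t * u1 p)) (@compsZ _ Q 1 (1 / 6)) comps_Y1 //.
by rewrite -(comps_int _ etaQ wt) compsZ mulrCA mulrA.
Qed.

Lemma tau14_formula :
  tau14 p c = (2 / 3 * t) *: wedgef theta (flatv g (J Y2))
    + (1 / 3 : R) *: hook Y2 ReU - u8' p c.
Proof.
have JP : multilin_alt 1 (ev (flatv g (J Y2))) by exact: multilin_alt_flat.
apply: (form_eq QG); first exact: kform_multilin (tau14_form g2_tor).
  apply: multilin_altD; last by apply: multilin_altN; exact: basic_multilin (u8'_type su3_tor).1.
  apply: multilin_altD; last by apply: multilin_altZ; apply: multilin_alt_hook; exact: reQ.1.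
  apply: multilin_altZ; apply: (@multilin_alt_wedge _ _ 1 1) => //.
  by apply: multilin_altZ; exact: multilin_alt_flat.
move=> w wk; have wt := subseqs_tuples wk.
rewrite (tau14_component comps_dlnt0 a0 b0 s8 e8 e'8 h12 tau27_phi resid4_comps resid5_comps wk).
(* The factor [t] is moved onto [theta], since it is [eta = t theta] that has an integer table. *)
rewrite 2!compsD compsN -scalerA -wedgeZl.
rewrite (@compsZ _ Q 2 (2 / 3)) (@compsZ _ Q 2 (1 / 3)).
have JY u : u \in tuples 7 1 -> cmp (flatv g (J Y2)) u = jy_c (y2_c t l a b x) u.
  by move=> uk; rewrite flat_J (comps_hook QG omQ uk comps_Y2).
rewrite (comps_wedge_left (k := 1) (l := 1) etaQ JP wt JY).
by rewrite (comps_hook QG reQ wt comps_Y2).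
Qed.

Lemma tau27_formula :
  tau27 p c =
    t *: wedgef theta
      ((8 / 7 * (t * lambda p + 1 / 2 * u1' p)) *: omega
       - (1 / 2 : R) *: hook (J Y3) ReU - (u8 p c + t *: sigma p c))
    - (1 / 2 : R) *: wedgef (flatv g (J Y3)) omega
    - (6 / 7 * (1 / 2 * u1' p + t * lambda p)) *: ReU
    - hodge 3 3 g (su3_vol S xi p c) (u12 p c).
Proof.
have JP : multilin_alt 1 (ev (flatv g (J Y3))) by exact: multilin_alt_flat.
(* [omega^3 / 6] has the single index list 1 to 6. Used as [vol] in degree 3 + 3 it makes [hodge]
   the dual on the quotient: components of the result that contain the index 0 vanish. *)
have svQ : int_form (frame Q) (su3_vol S xi p c) su3_vol_coefs.
  apply: (int_formZ (z := 6) _ (int_form_wedge (int_form_wedge omQ omQ) omQ)).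
    by rewrite mulVf // pnatr_eq0.
  by vm_compute.
have u12P : multilin_alt 3 (ev (u12 p c)) := basic_multilin (u12_type su3_tor).1.
have hP : multilin_alt 3 (ev (hodge 3 3 g (su3_vol S xi p c) (u12 p c))).
  exact: (@multilin_alt_hodge _ 7 3 3 _ _ _ svQ.1).
rewrite -wedgeZl; set inner := (X in wedgef (t *: theta) X).
have innerP : multilin_alt 2 (ev inner).
  apply: multilin_altD; last apply: multilin_altN.
    apply: multilin_altD; last apply: multilin_altN.
      by apply: multilin_altZ; exact: omQ.1.
    by apply: multilin_altZ; apply: multilin_alt_hook; exact: reQ.1.
  apply: multilin_altD; first exact: basic_multilin (u8_type su3_tor).1.
  by apply: multilin_altZ; exact: basic_multilin sigma_type.1.
apply: (form_eq QG); first exact: kform_multilin (tau27_form g2_tor).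
  apply: multilin_altD; last by apply: multilin_altN.
  apply: multilin_altD; last by apply: multilin_altN; apply: multilin_altZ; exact: reQ.1.
  apply: multilin_altD; last apply: multilin_altN; last apply: multilin_altZ.
    by apply: (@multilin_alt_wedge _ _ 1 2) => //; exact: etaQ.1.
  by apply: (@multilin_alt_wedge _ _ 1 2) => //; exact: omQ.1.
move=> w wk; have wt := subseqs_tuples wk.
rewrite (tau27_component comps_dlnt0 a0 b0 s8 e8 h12 tau27_phi tau27_psi resid4_comps wk).
have JY u : u \in tuples 7 1 -> cmp (flatv g (J Y3)) u = jy_c (y3_c t l a b x) u.
  by move=> uk; rewrite flat_J (comps_hook QG omQ uk comps_Y3).
have innerE u : u \in tuples 7 2 -> cmp inner u =
    inner_c t (lambda p) (u1' p) l a b x s e u.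
  move=> uk; rewrite /inner 2!compsD 2!compsN.
  rewrite (@compsZ _ Q 2 (8 / 7 * (t * lambda p + 1 / 2 * u1' p))) (@compsZ _ Q 2 (1 / 2)).
  rewrite (comps_int _ omQ uk) (comps_hook QG reQ uk JY).
  by rewrite [cmp (u8 p c + _) u]compsD (@compsZ _ Q 2 t).
rewrite 3!compsD 3!compsN (@compsZ _ Q 3 (1 / 2)).
rewrite (@compsZ _ Q 3 (6 / 7 * (1 / 2 * u1' p + t * lambda p))).
rewrite (comps_wedge_left (k := 1) (l := 2) etaQ innerP wt innerE).
rewrite (comps_wedge_right_eq (k := 1) (l := 2) JP omQ wt JY).
rewrite (comps_int (6 / 7 * (1 / 2 * u1' p + t * lambda p)) reQ wt).
rewrite (comps_hodge (k := 3) (l := 3) QG svQ u12P wk); last by vm_compute.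
by [].
Qed.

End StructureEquations.

Theorem proposition13 (R : realType) (M : manifold R 7) (S : g2_structure M)
    (xi : vfield M) (A : circle_action M)
    (xi_vfield : is_vfield setT xi) (xi_gen : generates xi A)
    (xi_inv : forall (p : M) (c : atlas M), cdom c p ->
       lie_kform xi (g2_form S) p c = 0)
    (u1 u1' : M -> R) (u6 u6' : kform M 1) (u8 u8' : kform M 2) (u12 : kform M 3)
    (su3_tor : su3_torsion S xi u1 u1' u6 u6' u8 u8' u12)
    (X : vfield M) (lambda : M -> R) (sigma : kform M 2)
    (X_basic : basic_vfield S xi X) (lambda_basic : basic_function xi lambda)
    (sigma_type : Omega2_8 S xi sigma)
    (curvature : forall (p : M) (c : atlas M), nonfixed xi p -> cdom c p ->
       ext_d (conn_form S xi) p c =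
         hook (X p c) (su3_Re S xi p c)
         + lambda p *: su3_omega S xi p c + sigma p c)
    (tau1 : M -> R) (tau7 : kform M 1) (tau14 : kform M 2) (tau27 : kform M 3)
    (g2_tor : g2_torsion S tau1 tau7 tau14 tau27)
    (p : M) (c : atlas M) (p_nonfixed : nonfixed xi p) (p_c : cdom c p) :
  let g := g2_metric S p c in
  let t := orbit_norm S xi p in
  let theta := conn_form S xi p c in
  let omega := su3_omega S xi p c in
  let ReU := su3_Re S xi p c in
  let J := su3_J S xi p c in
  let dlnt := sharpv g (dfun (fun q => ln (orbit_norm S xi q)) p c) in
  let JX := J (X p c) in
  let v6 := sharpv g (u6 p c) in
  let v6' := sharpv g (u6' p c) in
  let Y1 := - (t *: JX) + v6 + v6' + dlnt in
  let Y2 := (2 * t) *: JX - 2 *: v6 + v6' + dlnt in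
  let Y3 := t *: JX + v6 - v6' + dlnt in
  [/\ tau1 p = 6 / 7 * (t * lambda p + 4 * u1' p),
      tau7 p c = - ((t * u1 p) *: theta) + (1 / 6 : R) *: flatv g Y1,
      tau14 p c =
        (2 / 3 * t) *: wedgef theta (flatv g (J Y2))
        + (1 / 3 : R) *: hook Y2 ReU - u8' p c &
      tau27 p c =
        t *: wedgef theta
          ((8 / 7 * (t * lambda p + 1 / 2 * u1' p)) *: omega
           - (1 / 2 : R) *: hook (J Y3) ReU
           - (u8 p c + t *: sigma p c))
        - (1 / 2 : R) *: wedgef (flatv g (J Y3)) omega
        - (6 / 7 * (1 / 2 * u1' p + t * lambda p)) *: ReU
        - hodge 3 3 g (su3_vol S xi p c) (u12 p c)].
Proof.
cbv zeta; have [Q [[QG phiQ volQ xiE] [psiQ etaQ omQ reQ imQ]]] :=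
  su3_adapted_frame xi_vfield p_c (orbit_norm_neq0 S xi_vfield p_nonfixed).
by split; [eapply tau1_formula|eapply tau7_formula|eapply tau14_formula|
  eapply tau27_formula]; eassumption.
Qed.
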